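(* Let $\Omega\subset\mathbb{R}^n$ be an open domain. Let $M:[0,\infty)\to[0,\infty)$ be an $N$-function of class $C^1((0,\infty))$ that satisfies the $\Delta_2$-condition and is such that $M'(\lambda)/\lambda$ is bounded for $\lambda$ near zero. Let $\mu(dx)=e^{-\varphi(x)}dx$ be a Radon measure on $\Omega$, where $\varphi:\Omega\to\mathbb{R}$ belongs to $W^{1,\infty}_{loc}(\Omega)$. Moreover, assume that $M(\lambda)/\lambda^2$ is nondecreasing. Suppose that there are constants $K_1,K_2$ such that for every $u\in C_0^\infty(\Omega)$ $$\int_\Omega M(|\nabla\varphi|\,|u|)\,d\mu\le K_1\int_\Omega M(|\nabla u|)\,d\mu+K_2\int_\Omega M(|u|)\,d\mu .$$ Then: 1) There exist positive constants $C_1,C_2$ such that for every $\theta\in(0,1]$ and every $u\in C_0^\infty(\Omega)$ $$\int_\Omega M(|\nabla u|)\,d\mu\le C_1\int_\Omega M(\theta|\nabla^{(2)}u|)\,d\mu+C_2\int_\Omega M\Big(\frac{|u|}{\theta}\Big)\,d\mu .$$ 2) There exist positive constants $\tilde C_1,\tilde C_2$ such that for every $u\in C_0^\infty(\Omega)$ $$\|\nabla u\|_{L^M(\Omega,\mu)}\le\tilde C_1\sqrt{\|\nabla^{(2)}u\|_{L^M(\Omega,\mu)}\,\|u\|_{L^M(\Omega,\mu)}}+\tilde C_2\|u\|_{L^M(\Omega,\mu)} .$$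
   Context: $C_0^\infty(\Omega)$ denotes the smooth real-valued functions compactly supported in $\Omega$; $\nabla^{(2)}u$ is the matrix of second-order partial derivatives of $u$ and $|\nabla^{(2)}u|$ its Euclidean (Hilbert–Schmidt) norm. An $N$-function is a continuous convex function $M:[0,\infty)\to[0,\infty)$ with $\lim_{\lambda\to0}M(\lambda)/\lambda=\lim_{\lambda\to\infty}\lambda/M(\lambda)=0$. $M$ satisfies the $\Delta_2$-condition if there is $c>0$ with $M(2\lambda)\le cM(\lambda)$ for all $\lambda>0$. The Luxemburg norm is $\|f\|_{L^M(\Omega,\mu)}=\inf\{k>0:\int_\Omega M(|f(x)|/k)\,d\mu(x)\le1\}$; for vector- or matrix-valued $f$, $|f|$ denotes the Euclidean norm. *)

(* Defs.v *)
From HB Require Import structures.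
From mathcomp Require Import all_boot all_order all_algebra.
From mathcomp Require Import all_classical all_reals all_analysis.
From mathcomp Require Import lra.

Set Implicit Arguments.
Unset Strict Implicit.
Unset Printing Implicit Defensive.

Import Order.TTheory GRing.Theory Num.Theory.
Import numFieldNormedType.Exports.

Local Open Scope classical_set_scope.
Local Open Scope ring_scope.

Definition rV_display : measure_display -> measure_display.
Proof. exact. Qed.

Section measurable_rV.
Context {d} {T : measurableType d}.
Variable n : nat.

Let coor (i : 'I_n) (v : 'rV[T]_n) : T := v ord0 i.

Let rV_set0 : g_sigma_preimage coor set0.
Proof. exact: sigma_algebra0. Qed.

Let rV_setC A : g_sigma_preimage coor A -> g_sigma_preimage coor (~` A).
Proof. exact: sigma_algebraC. Qed.

Let rV_bigcup (F : _^nat) : (forall i, g_sigma_preimage coor (F i)) ->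
  g_sigma_preimage coor (\bigcup_i (F i)).
Proof. exact: sigma_algebra_bigcup. Qed.

HB.instance Definition _ := @isMeasurable.Build (rV_display d)
  'rV[T]_n (g_sigma_preimage coor) rV_set0 rV_setC rV_bigcup.

Lemma measurable_coord i : measurable_fun [set: 'rV[T]_n] (fun v => v ord0 i).
Proof.
move=> _ Y mY; rewrite setTI; apply: sub_sigma_algebra => /=.
rewrite -bigcup_seq/=; exists i => /=; first by rewrite mem_index_enum.
by exists Y => //; rewrite setTI.
Qed.

End measurable_rV.


Section lebesgue_rV.
Context {R : realType}.

Lemma measurable_rVP d (T : measurableType d) n (f : T -> 'rV[R]_n) :
  (forall i, measurable_fun [set: T] (fun x => f x ord0 i : R)) ->
  measurable_fun [set: T] f.
Proof.
move=> mf; pose G := \big[setU/set0]_(i < n)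
  preimage_set_system setT (fun v : 'rV[R]_n => v ord0 i) measurable.
apply: (@measurability _ _ _ _ setT f G) => // A [B].
rewrite /G -bigcup_seq => -[i _ [C mC <-]] <-; rewrite !setTI.
by rewrite -[X in measurable X]setTI; exact: mf.
Qed.

(* balls of 'rV[R]_n are cubes, the norm being the sup norm *)
Lemma open_measurable_rV n (U : set 'rV[R]_n) : open U -> measurable U.
Proof.
move=> oU.
pose B (p : 'rV[rat]_n * nat) := ball (map_mx ratr p.1 : 'rV[R]_n) p.2.+1%:R^-1.
have mB p : measurable (B p).
  have -> : B p = \bigcap_(i in [set: 'I_n])
      (fun v : 'rV[R]_n => v ord0 i) @^-1`
      (ball (ratr (p.1 ord0 i) : R) p.2.+1%:R^-1).
    apply/seteqP; split => [v [_ Bv] i _|v Bv]; first by have := Bv ord0 i; rewrite mxE.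
    split; first by rewrite invr_gt0.
    by move=> j i; rewrite ord1 mxE; exact: Bv.
  apply: fin_bigcap_measurable => // i _.
  rewrite -[X in measurable X]setTI; apply: measurable_coord => //.
  exact: measurable_realfun.open_measurable (ball_open _ _).
have -> : U = \bigcup_p (if `[< B p `<=` U >] then B p else set0).
  apply/seteqP; split => [x Ux|x [p _]]; last by case: asboolP => // pU; exact: pU.
  have /nbhs_ballP[e /= e0 eU] : nbhs x U by apply: open_nbhs_nbhs.
  have [k ke] := ltr_add_invr e0; rewrite add0r in ke.
  pose r : R := (k.*2.+1).+1%:R^-1.
  have r0 : 0 < r by rewrite invr_gt0.
  have r2 : r + r < e.
    apply: le_lt_trans ke; rewrite -mulr2n /r -doubleS -mul2n natrM invfM.
    by rewrite -[leLHS]mulr_natl mulrA divff ?mul1r.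
  have /choice[q qx] : forall i, exists q : rat, `|ratr q - x ord0 i| < r.
    move=> i; have [|q] := @rat_in_itvoo _ (x ord0 i - r) (x ord0 i + r).
      by rewrite ltrD2l; lra.
    by rewrite in_itv/= => qr; exists q; rewrite ltr_distl.
  exists (\row_i q i, k.*2.+1) => //; case: asboolP => [_|[]].
    by split; [rewrite invr_gt0|move=> j i; rewrite ord1 !mxE; exact: qx].
  move=> y [_ By]; apply: eU; split => // j i; rewrite ord1.
  have := By ord0 i; rewrite !mxE /ball/= => qy; rewrite /ball/=.
  rewrite (le_lt_trans _ r2)// (le_trans (ler_distD (ratr (q i)) _ _))//.
  by rewrite lerD// ltW// distrC.
apply: countable_bigcupT_measurable => [|p]; first exact: countableP.
by case: asboolP.
Qed.

Definition rV_cons n (p : measurableTypeR R * 'rV[R]_n) : 'rV[R]_n.+1 :=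
  row_mx (const_mx p.1 : 'rV_1) p.2.

Lemma rV_cons0 n (p : measurableTypeR R * 'rV[R]_n) :
  rV_cons p ord0 ord0 = p.1.
Proof.
transitivity ((const_mx p.1 : 'rV[R]_1) ord0 ord0); last by rewrite mxE.
rewrite -(row_mxEl (const_mx p.1 : 'rV[R]_1) p.2 ord0 ord0).
by congr (_ _ _); exact/val_inj.
Qed.

Lemma rV_consS n (p : measurableTypeR R * 'rV[R]_n) i :
  rV_cons p ord0 (lift ord0 i) = p.2 ord0 i.
Proof.
rewrite -(row_mxEr (const_mx p.1 : 'rV_1) p.2 ord0 i).
by congr (_ _ _); exact/val_inj.
Qed.

Lemma measurable_rV_cons n : measurable_fun [set: _] (@rV_cons n).
Proof.
apply: measurable_rVP => i; have [j ->|->] := unliftP ord0 i.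
  under eq_fun do rewrite rV_consS.
  apply: (@measurableT_comp _ _ _ _ _ _ (fun v : 'rV[R]_n => v ord0 j)) => //.
  exact: measurable_coord.
under eq_fun do rewrite rV_cons0.
exact: measurable_fst.
Qed.

Definition rV_uncons n (v : 'rV[R]_n.+1) : measurableTypeR R * 'rV[R]_n :=
  (v ord0 ord0, \row_i v ord0 (lift ord0 i)).

Lemma rV_consK n : cancel (@rV_cons n) (@rV_uncons n).
Proof.
move=> p; rewrite /rV_uncons rV_cons0 [RHS]surjective_pairing.
by congr (_, _); apply/rowP => i; rewrite mxE rV_consS.
Qed.

Lemma measurable_rV_uncons n : measurable_fun [set: _] (@rV_uncons n).
Proof.
apply: measurable_fun_pair; first exact: measurable_coord.
apply: measurable_rVP => i; under eq_fun do rewrite mxE.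
exact: measurable_coord.
Qed.

Section step.
Variables (n : nat) (m : {sigma_finite_measure set 'rV[R]_n -> \bar R}).

Definition lebesgue_rV_step : set 'rV[R]_n.+1 -> \bar R :=
  pushforward (lebesgue_measure \x m)%E (@rV_cons n).

HB.instance Definition _ := Measure.copy lebesgue_rV_step
  (measure_function_pushforward__canonical__measure_function_Measure
     (lebesgue_measure \x m)%E (@measurable_rV_cons n)).

Let lebesgue_rV_step_sigma_finite : sigma_finite setT lebesgue_rV_step.
Proof.
have /sigma_finiteP[F [TF ndF Foo]] := sigma_finiteT (@lebesgue_measure R).
have /sigma_finiteP[G [TG ndG Goo]] := sigma_finiteT m.
exists (fun k => @rV_uncons n @^-1` (F k `*` G k)).
  rewrite -preimage_bigcup (_ : \bigcup_k _ = setT) ?preimage_setT//.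
  apply/seteqP; split => // -[x y] _.
  have [i _ Fix] : (\bigcup_k F k) x by rewrite -TF.
  have [j _ Gjy] : (\bigcup_k G k) y by rewrite -TG.
  exists (maxn i j) => //; split.
  - by move: x Fix; exact/subsetPset/ndF/leq_maxl.
  - by move: y Gjy; exact/subsetPset/ndG/leq_maxr.
move=> k; have [mF Fkoo] := Foo k; have [mG Gkoo] := Goo k; split.
  rewrite -[X in measurable X]setTI; apply: measurable_rV_uncons => //.
  exact: measurableX.
rewrite /lebesgue_rV_step /pushforward -comp_preimage.
rewrite (_ : _ \o _ = id) ?preimage_id; last by apply/funext => p; exact: rV_consK.
by rewrite product_measure1E// lte_mul_pinfty// ge0_fin_numE.
Qed.

HB.instance Definition _ := Measure_isSigmaFinite.Build _ _ _ lebesgue_rV_step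
  lebesgue_rV_step_sigma_finite.

End step.

Fixpoint lebesgue_rV n : {sigma_finite_measure set 'rV[R]_n -> \bar R} :=
  if n is n'.+1 then lebesgue_rV_step (lebesgue_rV n') else dirac (0 : 'rV[R]_0).

Lemma lebesgue_rV_box n (A : 'I_n -> set R) : (forall i, measurable (A i)) ->
  lebesgue_rV n [set v | forall i, A i (v ord0 i)] =
  (\prod_(i < n) @lebesgue_measure R (A i))%E.
Proof.
elim: n A => [|n IH] A mA.
  rewrite big_ord0 /= diracE mem_set//; by case.
rewrite big_ord_recl -(IH (fun i => A (lift ord0 i)))//.
have mB : measurable [set v : 'rV[R]_n | forall i, A (lift ord0 i) (v ord0 i)].
  rewrite (_ : mkset _ = \bigcap_(i in [set: 'I_n])
    (fun v : 'rV[R]_n => v ord0 i) @^-1` A (lift ord0 i)).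
    apply: fin_bigcap_measurable => // i _.
    by rewrite -[X in measurable X]setTI; exact: measurable_coord.
  by apply/seteqP; split => v /= Av i; [move=> _|]; exact: Av.
rewrite -product_measure1E//; last exact: mA.
congr (product_measure1 _ _ _); apply/seteqP; split => [p /= Ap|p /= [Ap0 Ap] i].
  split; first by have := Ap ord0; rewrite rV_cons0.
  by move=> i; rewrite -rV_consS.
by have [j ->|->] := unliftP ord0 i; [rewrite rV_consS; exact: Ap|rewrite rV_cons0].
Qed.

End lebesgue_rV.

Section calculus.
Context {R : realType}.

(* Frobenius norm; on row vectors it is the Euclidean norm *)
Definition enorm m n (A : 'M[R]_(m, n)) : R :=
  Num.sqrt (\sum_i \sum_j A i j ^+ 2).

Variable n : nat.
Implicit Types (Omega : set 'rV[R]_n) (u : 'rV[R]_n -> R).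

Definition pderiv (i : 'I_n) u : 'rV[R]_n -> R := 'D_(delta_mx ord0 i) u.

Definition grad u (x : 'rV[R]_n) : 'rV[R]_n := \row_i pderiv i u x.

Definition hess u (x : 'rV[R]_n) : 'M[R]_n :=
  \matrix_(i, j) pderiv i (pderiv j u) x.

Fixpoint Ck (k : nat) u : Prop :=
  if k is k'.+1 then
    continuous u /\ forall i, (forall x, derivable u x (delta_mx ord0 i)) /\
                              Ck k' (pderiv i u)
  else continuous u.

Definition smooth u := forall k, Ck k u.

(* Elements of C_0^oo(Omega) are represented by their extension by zero *)
Definition Cc_smooth Omega u :=
  let supp := closure [set x | u x != 0] in
  [/\ smooth u, compact supp & supp `<=` Omega].

Definition Linfty_loc Omega u :=
  measurable_fun Omega u /\
  forall K, compact K -> K `<=` Omega ->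
    exists C : R, {ae lebesgue_rV n, forall x, K x -> `|u x| <= C}.

Definition weak_gradient Omega u (g : 'rV[R]_n -> 'rV[R]_n) :=
  forall psi, Cc_smooth Omega psi -> forall i,
    (\int[lebesgue_rV n]_(x in Omega) (u x * pderiv i psi x)%:E =
     - \int[lebesgue_rV n]_(x in Omega) (g x ord0 i * psi x)%:E)%E.

(* u belongs to W^{1,oo}_loc(Omega) and g is a version of its weak gradient,
   which is only determined almost everywhere *)
Definition W1infty_loc Omega u (g : 'rV[R]_n -> 'rV[R]_n) :=
  [/\ Linfty_loc Omega u, forall i, Linfty_loc Omega (fun x => g x ord0 i) &
      weak_gradient Omega u g].

Definition radon_on Omega (mu : {measure set 'rV[R]_n -> \bar R}) :=
  (forall K, compact K -> K `<=` Omega -> mu K < +oo)%E /\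
  (forall A, measurable A -> A `<=` Omega ->
    mu A = ereal_sup [set mu K | K in [set K | compact K /\ K `<=` A]]).

Definition density_on Omega (mu : {measure set 'rV[R]_n -> \bar R}) (f : 'rV[R]_n -> R) :=
  forall A, measurable A -> A `<=` Omega ->
    mu A = (\int[lebesgue_rV n]_(x in A) (f x)%:E)%E.

End calculus.

Section orlicz.
Context {R : realType}.
Implicit Types M : R -> R.

(* An N-function is only constrained on [0, +oo[. As x / 0 = 0 here, the limit
   at infinity alone would not prevent M from vanishing. *)
Definition N_function M :=
  [/\ {within `[0, +oo[%classic, continuous M},
      convex_function (`[0, +oo[%classic : set R^o) M,
      (forall x, 0 <= x -> 0 <= M x),
      M x / x @[x --> 0^'+] --> 0 &
      (\forall x \near +oo, 0 < M x) /\ (x / M x @[x --> +oo] --> 0)].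

Definition Delta2 M :=
  exists2 c, 0 < c & forall x, 0 < x -> M (2 * x) <= c * M x.

Definition C1_pos M :=
  (forall x, 0 < x -> derivable M x 1) /\
  {in `]0, +oo[, continuous (derive1 M)}.

(* Valued in \bar R, with the infimum of the empty set being +oo. A vector- or
   matrix-valued f is passed through its pointwise Euclidean norm. *)
Definition luxemburg d (T : measurableType d) (mu : {measure set T -> \bar R})
    M (D : set T) (f : T -> R) : \bar R :=
  ereal_inf [set k%:E | k in
    [set k : R | 0 < k /\ (\int[mu]_(x in D) (M (`|f x| / k))%:E <= 1)%E]].

End orlicz.

(* Main.v *)
(* Put G t = M (sqrt t) / t and T = |grad u|^2 + eps^2. Integrating by parts
   against e^(-phi), one derivative is moved from u onto the C^1 field
   G(T) d_i u. Since lambda M'(lambda) <= c M(lambda), the derivative of this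
   field is at most a constant times G(T) |hess u|, whence
     int M(|grad u|) dmu <= C int G(T) |u| (|hess u| + |grad u| |grad phi|) dmu.
   As M(lambda)/lambda^2 is nondecreasing, a Young inequality
   M(l)/l^2 a^2 <= eta M(l) + C_eta M(a) splits the right-hand side; the term with
   grad phi is controlled by the assumed inequality applied to delta theta d_i u,
   and for small eta and delta everything involving grad u is absorbed. The
   inequality between Luxemburg norms follows by applying this to u / k with
   theta balancing the two terms.

   As phi is only weakly differentiable, integration by parts against e^(-phi)
   is proved with difference quotients: for almost every x the increment of phi
   along a segment is the integral of the weak derivative. *)

Require Import Defs.
From HB Require Import structures.
From mathcomp Require Import all_boot all_order all_algebra.
From mathcomp Require Import all_classical all_reals all_analysis.
From mathcomp Require Import measurable_realfun ring lra.

Set Implicit Arguments.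
Unset Strict Implicit.
Unset Printing Implicit Defensive.

Import Order.TTheory GRing.Theory Num.Theory.
Import numFieldNormedType.Exports.

Local Open Scope classical_set_scope.
Local Open Scope ring_scope.

(** * Lebesgue measure on row vectors *)

(** The weak gradient is tested against smooth functions only, whereas the function to be tested
    here is [w * expR (- phi)] with [w] merely of class C^1, so a product and chain rule for
    [expR (- phi)] has to be proved. Difference quotients need only Fubini, translation invariance
    and the formula for increments. That formula is tested on products of one-variable bumps, which
    approximate indicators of boxes, and boxes determine measures. [eps] is there because [G] need
    not be differentiable at 0; it costs a multiple of [M eps] times the measure of the support of
    [u], which vanishes in the limit. Absorption is legitimate because the modulars involved are
    finite: the support is compact, [mu] is Radon, and the assumed inequality bounds the term with
    [dphi]. The factor [delta * theta] on [pderiv i u] does two things: [theta] puts the second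
    derivatives at the required scale, and [delta] makes the [K2] term a small multiple of the
    gradient term. Its inverse only enlarges the coefficient of the term in [|u| / theta]. *)

Lemma rV_consD (R : realType) n (p : measurableTypeR R * 'rV[R]_n) (a : 'rV[R]_n.+1) :
  rV_cons p + a = rV_cons (p.1 + a ord0 ord0, p.2 + \row_i a ord0 (lift ord0 i)).
Proof.
apply/rowP => i; rewrite mxE; have [j ->|->] := unliftP ord0 i.
  by rewrite !rV_consS/= !mxE.
by rewrite !rV_cons0.
Qed.

Lemma measurable_rV_shift (R : realType) n (a : 'rV[R]_n) :
  measurable_fun [set: 'rV[R]_n] (fun v => v + a).
Proof.
apply: measurable_rVP => i; under eq_fun do rewrite mxE.
by apply: measurable_funD => //; exact: measurable_coord.
Qed.

(** The image measure agrees with Lebesgue measure on half-open intervals, which determine it. *)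
Lemma lebesgue_measure_shift (R : realType) (a : R) (A : set R) :
  measurable A -> lebesgue_measure ((fun x : R => x + a) @^-1` A) = lebesgue_measure A.
Proof.
move=> mA.
have mf : measurable_fun [set: measurableTypeR R] (fun x : measurableTypeR R => (x + a : measurableTypeR R)).
  exact: measurable_funD.
transitivity (pushforward lebesgue_measure
  (fun x : measurableTypeR R => (x + a : measurableTypeR R)) A) => //.
have := @lebesgue_measure_unique R
   (measure_function_pushforward__canonical__measure_function_Measure
     lebesgue_measure mf).
move=> /= <-//.
move=> X /ocitvP[->|[[x y] /= xy ->]]; first by rewrite !measure0.
rewrite /pushforward.
have -> : (fun x : R => x + a) @^-1` `]x, y]%classic = `]x - a, y - a]%classic.
  by apply/seteqP; split => z /=; rewrite !in_itv /= ltrBlDr lerBrDr.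
by rewrite !lebesgue_measure_itv /= !lte_fin ltrD2r; case: ifP => // _; rewrite -!EFinD; congr EFin; ring.
Qed.

(** Induction on the dimension: [rV_cons] turns a translation of rows into a pair of translations,
    and a product measure is determined by its values on rectangles. *)
Lemma lebesgue_rV_shift (R : realType) n (a : 'rV[R]_n) A : measurable A ->
  lebesgue_rV n ((fun v => v + a) @^-1` A) = lebesgue_rV n A.
Proof.
elim: n a A => [|n IH] a A mA.
  by congr (dirac _ _); apply/seteqP; split => v /=; rewrite [v + a]thinmx0 [v]thinmx0.
rewrite /= /lebesgue_rV_step /pushforward.
pose a' : 'rV[R]_n := \row_i a ord0 (lift ord0 i).
pose tau (p : measurableTypeR R * 'rV[R]_n) : measurableTypeR R * 'rV[R]_n :=
  (p.1 + a ord0 ord0, p.2 + a').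
have mtau : measurable_fun setT tau.
  apply: measurable_fun_pair.
    by apply: measurable_funD => //; exact: measurable_fst.
  exact: (measurableT_comp (measurable_rV_shift a')).
rewrite (_ : _ @^-1` (_ @^-1` A) = tau @^-1` (@rV_cons R n @^-1` A)); last first.
  by apply/seteqP; split => p /=; rewrite rV_consD.
have := @product_measure_unique _ _ _ _ R lebesgue_measure (lebesgue_rV n)
  (measure_function_pushforward__canonical__measure_function_Measure
     (lebesgue_measure \x lebesgue_rV n)%E mtau).
move=> E; rewrite [RHS]E//; last first.
  by rewrite -[X in measurable X]setTI; exact: measurable_rV_cons.
move=> B C mB mC; rewrite /= /pushforward.
rewrite (_ : tau @^-1` _ = ((fun x : R => x + a ord0 ord0) @^-1` B) `*` ((fun x => x + a') @^-1` C))//.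
rewrite product_measure1E; first by congr (_ * _)%E; [exact: lebesgue_measure_shift|exact: IH].
- by rewrite -[X in measurable X]setTI; exact: measurable_funD.
- by rewrite -[X in measurable X]setTI; exact: measurable_rV_shift.
Qed.

Lemma ge0_integral_rV_shift (R : realType) n (a : 'rV[R]_n) (f : 'rV[R]_n -> \bar R) :
  measurable_fun setT f -> (forall x, 0 <= f x)%E ->
  (\int[lebesgue_rV n]_x f (x + a)%R = \int[lebesgue_rV n]_x f x)%E.
Proof.
move=> mf f0.
transitivity (\int[pushforward (lebesgue_rV n) (fun v : 'rV[R]_n => (v + a)%R)]_x f x)%E.
  by rewrite (ge0_integral_pushforward (measurable_rV_shift a)).
apply: eq_measure_integral => [|? A mA _]; first exact: measurable_rV_shift.
exact: lebesgue_rV_shift.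
Qed.

Lemma integral_rV_shift (R : realType) n (a : 'rV[R]_n) (f : 'rV[R]_n -> \bar R) :
  measurable_fun setT f ->
  (\int[lebesgue_rV n]_x f (x + a)%R = \int[lebesgue_rV n]_x f x)%E.
Proof.
move=> mf; rewrite integralE [RHS]integralE; congr (_ - _)%E.
  rewrite -(ge0_integral_rV_shift a (f := (f^\+)%E))//; last exact: measurable_funepos.
  by apply: eq_integral => x _; rewrite !funeposE.
rewrite -(ge0_integral_rV_shift a (f := (f^\-)%E))//; last exact: measurable_funeneg.
  by apply: eq_integral => x _; rewrite !funenegE.
Qed.

Lemma Rintegral_rV_shift (R : realType) n (a : 'rV[R]_n) (f : 'rV[R]_n -> R) :
  measurable_fun setT f ->
  \int[lebesgue_rV n]_x f (x + a) = \int[lebesgue_rV n]_x f x.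
Proof.
move=> mf; rewrite /Rintegral (integral_rV_shift a (f := fun x => (f x)%:E))//.
exact/measurable_EFinP.
Qed.

Lemma continuous_measurable_rV (R : realType) n (f : 'rV[R]_n -> R) :
  continuous f -> measurable_fun setT f.
Proof.
move=> cf; apply: (measurability _ (RGenOpens.measurableE R)).
move=> _ [_ [a [b ->] <-]]; rewrite setTI; apply: open_measurable_rV.
by apply: open_comp => //; exact: interval_open.
Qed.

Lemma compact_measurable_rV (R : realType) n (K : set 'rV[R]_n) :
  compact K -> measurable K.
Proof.
move=> cK; rewrite -[K]setCK; apply: measurableC; apply: open_measurable_rV.
by apply: closed_openC; apply: compact_closed => //; exact: norm_hausdorff.
Qed.

Lemma measurable_rV_box (R : realType) n (A : 'I_n -> set R) :
  (forall i, measurable (A i)) ->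
  measurable [set v : 'rV[R]_n | forall i, A i (v ord0 i)].
Proof.
move=> mA; rewrite (_ : mkset _ = \bigcap_(i in [set: 'I_n])
  (fun v : 'rV[R]_n => v ord0 i) @^-1` A i).
  apply: fin_bigcap_measurable => // i _.
  by rewrite -[X in measurable X]setTI; exact: measurable_coord.
by apply/seteqP; split => v /= Av i; [move=> _|]; exact: Av.
Qed.

Lemma rV_coord_le_norm (R : realType) n (v : 'rV[R]_n) i : `|v ord0 i| <= `|v|.
Proof.
rewrite [leRHS]mx_normrE; exact: (le_bigmax _ (fun j => `|v j.1 j.2|) (ord0, i)).
Qed.

Lemma compact_lebesgue_rV_lty (R : realType) n (K : set 'rV[R]_n) :
  compact K -> (lebesgue_rV n K < +oo)%E.
Proof.
move=> cK; have [B [_ KB]] := compact_bounded cK.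
have KB1 := KB (B + 1) _.
apply: (@le_lt_trans _ _ (lebesgue_rV n [set v | forall i, `[- (B + 1), B + 1]%classic (v ord0 i)])).
  apply: le_measure; rewrite ?inE; first exact: compact_measurable_rV.
    exact: (measurable_rV_box (A := fun=> `[- (B + 1), B + 1]%classic)).
  move=> v Kv i /=; rewrite in_itv /= -ler_norml.
  apply: le_trans (KB1 _ v Kv); last by rewrite ltrDl.
  exact: rV_coord_le_norm.
rewrite (@lebesgue_rV_box R n (fun=> `[- (B + 1), B + 1]%classic))//.
rewrite -ge0_fin_numE; last by apply: prode_ge0.
by apply: prode_fin_num => i _; rewrite lebesgue_measure_itv; case: ifP.
Qed.

(** The usual source of integrability below: the integrands are bounded and live on a set of finite
    measure. *)
Lemma integrable_bounded_supp d (T : measurableType d) (R : realType)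
  (mu : {measure set T -> \bar R}) (A : set T) (f : T -> R) (C : R) :
  measurable A -> (mu A < +oo)%E -> measurable_fun setT f ->
  (forall x, `|f x| <= C) -> (forall x, ~ A x -> f x = 0) ->
  mu.-integrable setT (EFin \o f).
Proof.
move=> mA muA mf fC f0.
have -> : EFin \o f = (EFin \o f) \_ A.
  apply/funext => x; rewrite patchE; case: ifPn => // /negP xA /=.
  by rewrite f0// => Ax; apply: xA; rewrite inE.
apply/(integrable_mkcond _ mA)/(measurable_bounded_integrable mA muA).
  exact: measurable_funTS.
by exists C; split; [exact: num_real|move=> M CM x Ax /=; rewrite (le_trans (fC x))// ltW].
Qed.

(** * Directional derivatives and smooth functions *)

(** Both difference quotients are the same function of [h], so derivability along [v] passes to the
    restriction to a line, and back, without any limit argument. *)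
Lemma derivable_line_growth (R : realType) (V : normedModType R) (f : V -> R) (x v : V) (t : R) :
  (fun h : R => h^-1 *: (((fun s : R => f (x + s *: v)) \o shift t) (h *: 1) - f (x + t *: v))) =
  (fun h : R => h^-1 *: ((f \o shift (x + t *: v)) (h *: v) - f (x + t *: v))).
Proof.
apply/funext => h /=; congr (_ *: (f _ - _)).
by rewrite [h *: 1]mulr1 scalerDl addrCA.
Qed.

Lemma is_derive_line (R : realType) (V : normedModType R) (f : V -> R) (x v : V) (t : R) :
  derivable f (x + t *: v) v ->
  is_derive t 1 (fun s : R => f (x + s *: v)) ('D_v f (x + t *: v)).
Proof.
move=> df; apply: DeriveDef; rewrite /derivable /derive derivable_line_growth //.
Qed.

Lemma is_derive_lineP (R : realType) (V : normedModType R) (f : V -> R) (x v : V) (l : R) :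
  is_derive (0 : R) 1 (fun s : R => f (x + s *: v)) l <-> is_derive x v f l.
Proof.
have E := derivable_line_growth f x v 0.
rewrite scale0r addr0 in E.
split => -[df dl]; apply: DeriveDef; move: df dl;
  by rewrite /derivable /derive /= scale0r addr0 E.
Qed.

(** Restriction to the line through [x] reduces this to the one-variable chain rule, so a derivative
    of [u] along the single direction [v] is enough. *)
Lemma is_derive_comp (R : realType) (V : normedModType R) (f : R -> R) (u : V -> R) x v (a b : R) :
  is_derive (u x) 1 f a -> is_derive x v u b -> is_derive x v (f \o u) (a * b).
Proof.
move=> df /is_derive_lineP du; apply/is_derive_lineP.
rewrite (_ : (fun s => _) = f \o (fun s => u (x + s *: v)))//.
apply: is_derive1_comp; rewrite scale0r addr0 //.
Qed.

Section Ck_closure.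
Context {R : realType} {n : nat}.
Implicit Types u v : 'rV[R]_n -> R.
Local Notation e i := (delta_mx ord0 i : 'rV[R]_n).

Lemma Ck_continuous k u : Ck k u -> continuous u.
Proof. by case: k => [|k] // []. Qed.

Lemma Ck_pred k u : Ck k.+1 u -> Ck k u.
Proof.
elim: k u => [|k IH] u [cu du] //; split => // i.
by have [? ?] := du i; split => //; exact: IH.
Qed.

Lemma Ck_cst k (c : R) : Ck k (cst c : 'rV[R]_n -> R).
Proof.
elim: k c => [|k IH] c; first exact: cst_continuous.
split=> [|i]; first exact: cst_continuous.
split=> [x|]; first exact: derivable_cst.
rewrite (_ : pderiv i _ = cst 0); first exact: IH.
by apply/funext => x; rewrite /pderiv derive_cst.
Qed.

Lemma pderivD i u v :
  (forall x, derivable u x (e i)) -> (forall x, derivable v x (e i)) ->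
  pderiv i (u \+ v) = pderiv i u \+ pderiv i v.
Proof. by move=> du dv; apply/funext => x; rewrite /pderiv deriveD. Qed.

Lemma pderivM i u v :
  (forall x, derivable u x (e i)) -> (forall x, derivable v x (e i)) ->
  pderiv i (u \* v) = (u \* pderiv i v) \+ (v \* pderiv i u).
Proof. by move=> du dv; apply/funext => x; rewrite /pderiv deriveM. Qed.

Lemma CkD k u v : Ck k u -> Ck k v -> Ck k (u \+ v).
Proof.
elim: k u v => [|k IH] u v.
  by move=> cu cv x; apply: continuousD; [exact: cu|exact: cv].
move=> [cu du] [cv dv]; split => [x|i].
  by apply: continuousD; [exact: cu|exact: cv].
have [d1 k1] := du i; have [d2 k2] := dv i; split.
  by move=> x; apply: derivableD.
by rewrite pderivD; [exact: IH|exact: d1|exact: d2].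
Qed.

Lemma CkM k u v : Ck k u -> Ck k v -> Ck k (u \* v).
Proof.
elim: k u v => [|k IH] u v.
  by move=> cu cv x; apply: continuousM; [exact: cu|exact: cv].
move=> Cu Cv; have [cu du] := Cu; have [cv dv] := Cv; split => [x|i].
  by apply: continuousM; [exact: cu|exact: cv].
have [d1 k1] := du i; have [d2 k2] := dv i; split.
  by move=> x; apply: derivableM.
rewrite pderivM; [|exact: d1|exact: d2].
by apply: CkD; apply: IH; [exact: Ck_pred|exact: k2|exact: Ck_pred|exact: k1].
Qed.

Lemma Ck_sum k (I : Type) (r : seq I) (f : I -> 'rV[R]_n -> R) :
  (forall i, Ck k (f i)) -> Ck k (fun x => \sum_(i <- r) f i x).
Proof.
move=> Cf; elim: r => [|i r IH].
  rewrite (_ : (fun x => _) = cst 0); first exact: Ck_cst.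
  by apply/funext => x; rewrite big_nil.
rewrite (_ : (fun x => _) = f i \+ (fun x => \sum_(i <- r) f i x)); first exact: CkD.
by apply/funext => x; rewrite big_cons.
Qed.

Lemma Ck_prod k (I : Type) (r : seq I) (f : I -> 'rV[R]_n -> R) :
  (forall i, Ck k (f i)) -> Ck k (fun x => \prod_(i <- r) f i x).
Proof.
move=> Cf; elim: r => [|i r IH].
  rewrite (_ : (fun x => _) = cst 1); first exact: Ck_cst.
  by apply/funext => x; rewrite big_nil.
rewrite (_ : (fun x => _) = f i \* (fun x => \prod_(i <- r) f i x)); first exact: CkM.
by apply/funext => x; rewrite big_cons.
Qed.

(** Regularity of [f] is asked only at the values of [u], because the outer function of interest,
    [sqrt_quot M], is controlled on the positive half-line only. *)
Lemma C1_comp (f : R -> R) u : Ck 1 u ->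
  (forall x, derivable f (u x) 1) -> (forall x, {for u x, continuous (derive1 f)}) ->
  Ck 1 (f \o u) /\
  forall i x, pderiv i (f \o u) x = derive1 f (u x) * pderiv i u x.
Proof.
move=> [cu du] df cdf.
have D i x : is_derive x (e i) (f \o u) (derive1 f (u x) * pderiv i u x).
  apply: is_derive_comp.
    by rewrite derive1E; exact: derivableP.
  by apply: derivableP; have [] := du i.
have P i x : pderiv i (f \o u) x = derive1 f (u x) * pderiv i u x.
  by rewrite /pderiv derive_val.
split; last exact: P.
split=> [x|i].
  apply: continuous_comp; first exact: cu.
  by apply: differentiable_continuous; apply/derivable1_diffP.
split=> [x|]; first by case: (D i x).
rewrite (_ : pderiv i _ = (derive1 f \o u) \* pderiv i u); last exact/funext.
move=> x; apply: continuousM; last by have [_] := du i; apply.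
by apply: continuous_comp; [exact: cu|exact: cdf].
Qed.

Lemma is_derive_coord (i j : 'I_n) x :
  is_derive x (e i) (fun v : 'rV[R]_n => v ord0 j) (i == j)%:R.
Proof.
apply/is_derive_lineP.
rewrite (_ : (fun s => _) = (fun s : R => x ord0 j + s * (i == j)%:R)); last first.
  by apply/funext => s; rewrite !mxE eqxx eq_sym.
apply: is_derive_eq.
by rewrite add0r mul1r scaler0 add0r [_%:A]mulr1.
Qed.

Lemma continuous_coord (j : 'I_n) : continuous (fun v : 'rV[R]_n => v ord0 j).
Proof. by move=> x; apply: differentiable_continuous; exact: differentiable_coord. Qed.

End Ck_closure.

(** * Smooth cutoff functions *)

Section bump.
Context {R : realType}.
Implicit Type p : {poly R}.

(* Functions p(1/x) e^(-1/x) glued to 0 on the left, a family stable under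
   derivation. *)
Definition flat p (x : R) : R := if 0 < x then p.[x^-1] * expR (- x^-1) else 0.

(** With y = 1/x, the derivative of p(y) e^(-y) in x is (p(y) - p'(y)) y^2 e^(-y). *)
Definition flat_deriv p : {poly R} := (p - p^`()) * 'X^2.

(** For a monomial this is y^(k+1) <= (k+1)! e^y, read off the exponential series; the coefficients
    are then summed. At y = 1/x the bound C / y becomes C x, which is what differentiability at 0
    requires. *)
Lemma horner_expRN_bound p :
  exists2 C : R, 0 <= C & forall y, 0 < y -> `|p.[y] * expR (- y)| <= C / y.
Proof.
have mono k : exists2 C : R, 0 <= C & forall y : R, 0 < y -> `|y ^+ k * expR (- y)| <= C / y.
  exists ((k.+1)`!%:R); first by rewrite ler0n.
  move=> y y0; rewrite ger0_norm; last by rewrite mulr_ge0 ?expR_ge0// exprn_ge0// ltW.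
  rewrite expRN ler_pdivrMr ?expR_gt0// mulrAC ler_pdivlMr//.
  rewrite -exprSr -ler_pdivrMl ?ltr0n ?fact_gt0// mulrC.
  by apply: le_trans (expR_ge1Dxn k (ltW y0)); rewrite lerDr.
elim/poly_ind: p => [|p c _]; first by exists 0 => // y y0; rewrite horner0 !mul0r normr0.
move: (p * 'X + c%:P) => {c}p {}.
suff H : forall m, exists2 C : R, 0 <= C &
    forall y, 0 < y -> `|(\sum_(i < m) p`_i * y ^+ i) * expR (- y)| <= C / y.
  have [C C0 HC] := H (size p); exists C => // y y0.
  by rewrite horner_coef; exact: HC.
elim=> [|m [C C0 HC]]; first by exists 0 => // y y0; rewrite big_ord0 !mul0r normr0.
have [C' C'0 HC'] := mono m.
exists (C + `|p`_m| * C'); first by rewrite addr_ge0// mulr_ge0.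
move=> y y0; rewrite big_ord_recr/= mulrDl mulrDl (le_trans (ler_normD _ _))//.
apply: lerD; first exact: HC.
by rewrite -mulrA normrM -mulrA; apply: ler_wpM2l => //; exact: HC'.
Qed.

Lemma flat_bound p : exists2 C : R, 0 <= C & forall x, `|flat p x| <= C * `|x|.
Proof.
have [C C0 HC] := horner_expRN_bound p; exists C => // x.
rewrite /flat; case: ifPn => x0; last by rewrite normr0 mulr_ge0.
by rewrite (gtr0_norm x0) -[x in leRHS]invrK; apply: HC; rewrite invr_gt0.
Qed.

Lemma is_derive_flat p (x : R) : is_derive x (1 : R) (flat p) (flat (flat_deriv p) x).
Proof.
have [x0|x0|->] := ltgtP x 0.
- rewrite [X in is_derive _ _ _ X]/flat ltNge (ltW x0)/=.
  apply: (near_eq_is_derive (f := cst 0)).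
  near=> y; rewrite /flat ltNge ltW//=; near: y.
  exact: lt_nbhsl.
- apply: (@near_eq_is_derive R R R (fun y : R => p.[y^-1] * expR (- y^-1))).
    by near=> y; rewrite /flat ifT//; near: y; exact: lt_nbhsr.
  rewrite /flat x0.
  have xn : x != 0 by rewrite gt_eqF.
  have dV : is_derive x 1 (fun y : R => y^-1) (- x ^- 2).
    by have := @is_deriveV R id x 1 1 xn (is_derive_id _ _); rewrite /= [_ *: 1]mulr1.
  have dp : is_derive x 1 (fun y : R => p.[y^-1]) (p^`().[x^-1] * - x ^- 2).
    exact: (is_derive1_comp (f := horner p) (g := GRing.inv)).
  have dE : is_derive x 1 (fun y : R => expR (- y^-1)) (expR (- x^-1) * x ^- 2).
    have dN : is_derive x 1 (fun y : R => - y^-1) (x ^- 2).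
      by rewrite -[X in is_derive _ _ _ X]opprK; exact: is_deriveN.
    exact: (is_derive1_comp (f := expR) (g := fun y => - y^-1)).
  apply: is_derive_eq.
  rewrite /flat_deriv hornerM hornerXn hornerD hornerN exprVn.
  rewrite /GRing.scale/=; ring.
- rewrite [X in is_derive _ _ _ X]/flat ltxx.
  have [C C0 HC] := flat_bound (p * 'X).
  have H : (fun h : R => h^-1 *: ((flat p \o shift 0) (h *: 1) - flat p 0)) @ 0^' --> (0 : R).
    apply/cvgrPdist_le => /= eps eps0.
    have C1 : 0 < C + 1 by rewrite ltr_wpDl.
    near=> h.
    rewrite sub0r normrN addr0 [flat p 0]/flat ltxx subr0 [h *: 1]mulr1.
    have hn : h != 0 by near: h; exact: nbhs_dnbhs_neq.
    (* Dividing by [h] multiplies the polynomial by ['X], so the difference quotient at 0 stays in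
       the family and is O(h). *)
    have -> : h^-1 *: flat p h = flat (p * 'X) h.
      rewrite /flat; case: ifPn => h0; last by rewrite scaler0.
      by rewrite hornerM hornerX /GRing.scale /=; ring.
    apply: le_trans (HC h) _.
    apply: (@le_trans _ _ ((C + 1) * `|h|)); first by rewrite ler_wpM2r// lerDl.
    rewrite -ler_pdivlMl//.
    by near: h; apply: dnbhs0_le; rewrite mulr_gt0// invr_gt0.
  apply: DeriveDef; first by apply/cvg_ex; exists 0.
  exact/cvg_lim.
Unshelve. all: by end_near. Qed.

Lemma continuous_flat p : continuous (flat p).
Proof.
move=> x; apply: differentiable_continuous; apply/derivable1_diffP.
by have [] := is_derive_flat p x.
Qed.

(** The polynomial varies in the induction: a partial derivative replaces [p] by [flat_deriv p], up
    to a constant factor. *)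
Lemma Ck_flat_coord n k p (c d : R) (j : 'I_n) :
  Ck k (fun v : 'rV[R]_n => flat p (c * v ord0 j + d)).
Proof.
have cont q : continuous (fun v : 'rV[R]_n => flat q (c * v ord0 j + d)).
  move=> x; apply: (@continuous_comp _ _ _ (fun v : 'rV[R]_n => c * v ord0 j + d) (flat q)).
    apply: continuousD; last exact: cst_continuous.
    by apply: continuousM; [exact: cst_continuous|exact: continuous_coord].
  exact: continuous_flat.
elim: k p => [|k IH] p //; split => // i.
have D x : is_derive x (delta_mx ord0 i) (fun v : 'rV[R]_n => flat p (c * v ord0 j + d))
    (flat (flat_deriv p) (c * x ord0 j + d) * (c * (i == j)%:R)).
  apply: (@is_derive_comp _ _ (flat p) (fun v : 'rV[R]_n => c * v ord0 j + d)).
    exact: is_derive_flat.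
  have := is_derive_coord i j x => dc.
  apply: is_derive_eq.
  by rewrite addr0.
split=> [x|]; first by case: (D x).
rewrite (_ : pderiv i _ = (fun v => flat (flat_deriv p) (c * v ord0 j + d)) \* cst (c * (i == j)%:R)).
  by apply: CkM => //; exact: Ck_cst.
by apply/funext => x; rewrite /pderiv derive_val.
Qed.

Lemma flat1_ge0 (x : R) : 0 <= flat 1 x.
Proof. by rewrite /flat; case: ifP => // _; rewrite hornerC mul1r expR_ge0. Qed.

Lemma flat1_le1 (x : R) : flat 1 x <= 1.
Proof.
rewrite /flat; case: ifPn => // x0; rewrite hornerC mul1r expR_le1 oppr_le0.
by rewrite invr_ge0 ltW.
Qed.

Lemma cvg_flat1 (x : R) : flat 1 (k.+1%:R * x) @[k --> \oo] --> ((0 < x)%R%:R : R).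
Proof.
rewrite /flat; have [x0|x0] := ltP 0 x; last first.
  rewrite (_ : (fun k => _) = cst 0); first exact: cvg_cst.
  by apply/funext => k; rewrite ltNge mulr_ge0_le0.
rewrite (_ : (fun k => _) = (fun k => expR (- (x^-1 * harmonic k)))); last first.
  by apply/funext => k; rewrite mulr_gt0// hornerC mul1r invfM mulrC.
rewrite [X in _ --> X](_ : _ = expR (- (x^-1 * 0))); last by rewrite mulr0 oppr0 expR0.
apply: continuous_cvg; first exact: continuous_expR.
apply: cvgN; apply: cvgM; first exact: cvg_cst.
exact: cvg_harmonic.
Qed.

End bump.

Section box_bump.
Context {R : realType} {n : nat}.
Implicit Types a b : 'rV[R]_n.

(** As [k] grows these functions tend pointwise to the indicator of the open box, while staying
    between 0 and 1 and vanishing off the closed box. Translates are again of this form. *)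
Definition box_bump a b (k : nat) (v : 'rV[R]_n) : R :=
  \prod_(j < n) (flat 1 (k.+1%:R * (v ord0 j - a ord0 j)) *
                 flat 1 (k.+1%:R * (b ord0 j - v ord0 j))).

Definition closed_box a b := [set v : 'rV[R]_n | forall j, `[a ord0 j, b ord0 j]%classic (v ord0 j)].

Lemma smooth_box_bump a b k : smooth (box_bump a b k).
Proof.
move=> m; apply: Ck_prod => j; apply: CkM.
  rewrite (_ : (fun v => _) = (fun v : 'rV[R]_n => flat 1 (k.+1%:R * v ord0 j + (- (k.+1%:R * a ord0 j))))).
    exact: Ck_flat_coord.
  by apply/funext => v; rewrite mulrBr.
rewrite (_ : (fun v => _) = (fun v : 'rV[R]_n => flat 1 (- k.+1%:R * v ord0 j + k.+1%:R * b ord0 j))).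
  exact: Ck_flat_coord.
by apply/funext => v; rewrite mulrBr addrC mulNr.
Qed.

Lemma box_bump_ge0 a b k v : 0 <= box_bump a b k v.
Proof. by apply: prodr_ge0 => j _; rewrite mulr_ge0// flat1_ge0. Qed.

Lemma box_bump_le1 a b k v : box_bump a b k v <= 1.
Proof.
apply: prodr_ile1 => j _; rewrite mulr_ge0 ?flat1_ge0//=.
by rewrite mulr_ile1 ?flat1_ge0 ?flat1_le1.
Qed.

Lemma cvg_box_bump a b v : box_bump a b k v @[k --> \oo] -->
  (\1_[set v : 'rV[R]_n | forall j, `]a ord0 j, b ord0 j[%classic (v ord0 j)] v : R).
Proof.
rewrite indicE [X in _ --> X](_ : _ = \prod_(j < n)
   ((0 < v ord0 j - a ord0 j)%R%:R * (0 < b ord0 j - v ord0 j)%R%:R)); last first.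
  have [vb|nvb] := pselect (forall j, `]a ord0 j, b ord0 j[%classic (v ord0 j)).
    rewrite mem_set// big1// => j _; have /= := vb j; rewrite in_itv/= => /andP[a1 b1].
    by rewrite !subr_gt0 a1 b1 mulr1.
  rewrite memNset//; move/existsNP : nvb => [j]; rewrite /= in_itv/= => /negP nj.
  by rewrite (bigD1 j)//= -natrM mulnb !subr_gt0 (negbTE nj) mul0r.
apply: (@cvg_big _ _ _ _ _ _ _ _ _ (fun j k => flat 1 (k.+1%:R * (v ord0 j - a ord0 j)) *
                 flat 1 (k.+1%:R * (b ord0 j - v ord0 j)))).
- by move=> [x y]; exact: mul_continuous.
- by move=> j _; apply: cvgM; exact: cvg_flat1.
Qed.

Lemma box_bump_supp a b k v :
  box_bump a b k v != 0 -> forall j, a ord0 j <= v ord0 j <= b ord0 j.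
Proof.
move=> /prodf_neq0 H j; have := H j isT; rewrite mulf_eq0 negb_or => /andP[].
rewrite /flat; case: ifP; rewrite ?eqxx// pmulr_rgt0 ?ltr0n// subr_gt0 => /ltW -> _.
by case: ifP; rewrite ?eqxx// pmulr_rgt0 ?ltr0n// subr_gt0 => /ltW ->.
Qed.

Lemma compact_closed_box a b : compact (closed_box a b).
Proof.
apply: (@rV_compact _ _ (fun j => `[a ord0 j, b ord0 j]%classic)) => j.
exact: segment_compact.
Qed.

Lemma box_bump_Cc_smooth (U : set 'rV[R]_n) a b k :
  closed_box a b `<=` U ->
  Cc_smooth U (box_bump a b k).
Proof.
move=> abU.
have cl : closure [set x | box_bump a b k x != 0] `<=`
    closed_box a b.
  rewrite closureE; apply: smallest_sub.
    by apply: compact_closed; [exact: norm_hausdorff|exact: compact_closed_box].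
  by move=> v /box_bump_supp H j /=; rewrite in_itv/=.
split; first exact: smooth_box_bump.
  exact: (subclosed_compact (@closed_closure _ _) (@compact_closed_box a b)).
exact: subset_trans abU.
Qed.

Lemma box_bump_shift a b k v s :
  box_bump a b k (v + s) = box_bump (a - s) (b - s) k v.
Proof.
by apply: eq_bigr => j _; rewrite !mxE; congr (flat _ (_ * _) * flat _ (_ * _)); ring.
Qed.

End box_bump.

Section supports.
Context {R : realType} {n : nat}.
Implicit Types u : 'rV[R]_n -> R.

Lemma pderiv_supp (K : set 'rV[R]_n) u i : closed K -> (forall x, ~ K x -> u x = 0) ->
  forall x, ~ K x -> pderiv i u x = 0.
Proof.
move=> cK u0 x Kx; rewrite /pderiv.
rewrite (@near_eq_derive _ _ _ u (cst 0)) ?derive_cst//.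
have : nbhs x (~` K) by apply: open_nbhs_nbhs; split => //; exact: closed_openC.
by apply: filterS => y; exact: u0.
Qed.

Lemma compact_supp_bounded (K : set 'rV[R]_n) u : compact K -> continuous u ->
  (forall x, ~ K x -> u x = 0) -> exists2 C : R, 0 <= C & forall x, `|u x| <= C.
Proof.
move=> cK cu u0.
have /compact_bounded[B [_ KB]] : compact (u @` K).
  by apply: continuous_compact => //; apply: continuous_subspaceT.
exists (`|B| + 1); first by rewrite addr_ge0.
move=> x; have [Kx|Kx] := pselect (K x).
  apply: (KB (`|B| + 1)); last by exists x.
  by rewrite (le_lt_trans (ler_norm B))// ltrDl.
by rewrite u0// normr0 addr_ge0.
Qed.

End supports.

(** * Measures determined by boxes and parametrized integrals *)

Section weighted_measure.
Context d (T : measurableType d) {R : realType} (mu : {measure set T -> \bar R}).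
Variables (f : T -> R) (mf : measurable_fun setT f) (f0 : forall x, (0 <= f x)%R).
Local Open Scope ereal_scope.

(** The measure with density [f]. The two proofs are arguments so that the measure structure can be
    attached to the term. *)
Definition weighted_measure of measurable_fun setT f & (forall x, (0 <= f x)%R) :=
  fun A : set T => \int[mu]_(x in A) (f x)%:E.

Local Notation nu := (weighted_measure mf f0).

Let nu0 : nu set0 = 0. Proof. exact: integral_set0. Qed.

Let nu_ge0 A : 0 <= nu A. Proof. by apply: integral_ge0 => x _; rewrite lee_fin. Qed.

Let nu_sigma_additive : semi_sigma_additive nu.
Proof.
by apply: semi_sigma_additive_nng_induced => [|x]; [exact/measurable_EFinP|rewrite lee_fin].
Qed.

HB.instance Definition _ := isMeasure.Build _ _ _ nu nu0 nu_ge0 nu_sigma_additive.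

Import HBNNSimple.

Let integral_weighted_nnsfun (h : {nnsfun T >-> R}) :
  \int[nu]_x (h x)%:E = \int[mu]_x ((h x)%:E * (f x)%:E).
Proof.
transitivity (\int[nu]_x (\sum_(y \in range h) (y * \1_(h @^-1` [set y]) x)%:E)).
  by apply: eq_integral => x _; rewrite /= fimfunE -fsumEFin.
rewrite ge0_integral_fsum//; last 2 first.
- by move=> r; apply/measurable_EFinP; apply: measurable_funM => //.
- by move=> r x _; exact: nnfun_muleindic_ge0.
transitivity (\sum_(y \in range h)
    \int[mu]_x ((y * \1_(h @^-1` [set y]) x)%:E * (f x)%:E)); last first.
  rewrite -ge0_integral_fsum//; last 2 first.
  - move=> r; apply: emeasurable_funM; last exact/measurable_EFinP.
    by apply/measurable_EFinP; exact: measurable_funM.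
  - by move=> r x _; rewrite mule_ge0 ?lee_fin//; exact: nnfun_muleindic_ge0.
  apply: eq_integral => x _; rewrite /= -ge0_mule_fsuml//; last first.
    by move=> r; exact: nnfun_muleindic_ge0.
  by rewrite fsumEFin// -fimfunE.
apply: eq_fsbigr => r _.
have [->|r0] := eqVneq r 0%R.
  under eq_integral do rewrite mul0r.
  under [RHS]eq_integral do rewrite mul0r mul0e.
  by rewrite !integral0.
have [r1|r1] := ltP r 0%R.
  have -> : h @^-1` [set r] = set0.
    by apply/seteqP; split => // x /= hx; move: r1; rewrite -hx ltNge fun_ge0.
  under eq_integral do rewrite indic0 mulr0.
  under [RHS]eq_integral do rewrite indic0 mulr0 mul0e.
  by rewrite !integral0.
have mA : measurable (h @^-1` [set r]) by [].
under eq_integral do rewrite EFinM.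
rewrite ge0_integralZl_EFin//; last exact/measurable_EFinP.
under [RHS]eq_integral do rewrite EFinM -muleA.
rewrite ge0_integralZl_EFin//; last 2 first.
- by move=> x _; rewrite mule_ge0// lee_fin.
- by apply: emeasurable_funM => //; exact/measurable_EFinP.
congr (_ * _); rewrite integral_indic// setIT.
transitivity (\int[mu]_(x in h @^-1` [set r]) (f x)%:E) => //.
rewrite [LHS]integral_mkcond; apply: eq_integral => x _.
by rewrite epatch_indic muleC.
Qed.

(** Indicators are the definition of the measure, simple functions follow by linearity, and the
    general case by monotone convergence on both sides. *)
Lemma integral_weighted_measure (g : T -> \bar R) :
  measurable_fun setT g -> (forall x, 0 <= g x) ->
  \int[nu]_x g x = \int[mu]_x (g x * (f x)%:E).
Proof.
move=> mg g0; pose h := nnsfun_approx measurableT mg.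
have hg x : (EFin \o h n) x @[n --> \oo] --> g x by exact: cvg_nnsfun_approx.
have hnd x : {homo (fun n => (h n x)%:E) : n m / (n <= m)%N >-> n <= m}.
  by move=> a b ab; rewrite lee_fin; exact/lefP/nd_nnsfun_approx.
have gE x : g x = lim ((h n x)%:E @[n --> \oo]) by apply/esym/cvg_lim; [|exact: hg].
transitivity (lim (\int[nu]_x (h n x)%:E @[n --> \oo])).
  under eq_integral do rewrite gE.
  apply: monotone_convergence => //.
  - by move=> n; exact/measurable_EFinP.
  - by move=> n x _; rewrite lee_fin.
transitivity (lim (\int[mu]_x ((h n x)%:E * (f x)%:E) @[n --> \oo])).
  by congr (limn _); apply/funext => n; exact: integral_weighted_nnsfun.
under [RHS]eq_integral => x _.
  rewrite (_ : g x * (f x)%:E = lim ((h n x)%:E * (f x)%:E @[n --> \oo])); last first.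
    apply/esym/cvg_lim => //.
    by apply: cvgeZr => //; exact: hg.
  over.
apply/esym/monotone_convergence => //.
- by move=> n; apply: emeasurable_funM; exact/measurable_EFinP.
- by move=> n x _; rewrite mule_ge0// lee_fin.
- by move=> x _ a b ab; rewrite lee_wpmul2r// ?lee_fin//; exact: hnd.
Qed.

End weighted_measure.

Section boxes.
Context {R : realType} {n : nat}.

Definition open_box (a b : 'rV[R]_n) : set 'rV[R]_n :=
  [set v | forall j, `]a ord0 j, b ord0 j[%classic (v ord0 j)].

Definition open_boxes : set (set 'rV[R]_n) := [set open_box p.1 p.2 | p in setT].

Lemma measurable_open_box a b : measurable (open_box a b).
Proof. by apply: (@measurable_rV_box _ _ (fun j => `]a ord0 j, b ord0 j[%classic)). Qed.

Lemma open_boxI a b a' b' : open_box a b `&` open_box a' b' =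
  open_box (\row_j Num.max (a ord0 j) (a' ord0 j)) (\row_j Num.min (b ord0 j) (b' ord0 j)).
Proof.
apply/seteqP; split => v /=.
  move=> [H H'] j; have := H j; have := H' j; rewrite /= !in_itv/= !mxE.
  by rewrite gt_max lt_min => /andP[-> ->] /andP[-> ->].
move=> H; split => j; have := H j; rewrite /= !in_itv/= !mxE gt_max lt_min.
  by move=> /andP[/andP[-> _] /andP[-> _]].
by move=> /andP[/andP[_ ->] /andP[_ ->]].
Qed.

Lemma open_boxes_setI : setI_closed open_boxes.
Proof.
by move=> _ _ [[a b] _ <-] [[a' b'] _ <-]; rewrite open_boxI; eexists (_, _).
Qed.

Lemma rV_norm_lt (v : 'rV[R]_n) (r : R) : 0 < r ->
  (`|v| < r) <-> (forall j, `|v ord0 j| < r).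
Proof.
move=> r0; split => [vr j|H]; first exact: le_lt_trans (rV_coord_le_norm _ _) vr.
rewrite [ltLHS]mx_normrE; apply: bigmax_lt => //= -[i j] _ /=.
by rewrite ord1; exact: H.
Qed.

Lemma cover_open_boxes :
  \bigcup_k open_box (const_mx (- k%:R)) (const_mx k%:R) = setT.
Proof.
apply/seteqP; split => // v _.
exists (Num.truncn `|v|).+1 => // j /=.
rewrite !mxE in_itv/= -ltr_norml (le_lt_trans (rV_coord_le_norm _ _))//.
exact: truncnS_gt.
Qed.

(** Coordinates generate the sigma-algebra, and the preimage of []a, b[] under one coordinate is a
    countable union of boxes whose other sides are []-k, k[]. *)
Lemma measurable_open_boxesE : (measurable : set (set 'rV[R]_n)) = <<s open_boxes >>.
Proof.
apply/seteqP; split; last first.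
  apply: smallest_sub; first exact: sigma_algebra_measurable.
  by move=> _ [[a b] _ <-]; exact: measurable_open_box.
apply: smallest_sub; first exact: smallest_sigma_algebra.
move=> A; rewrite -bigcup_seq => -[i _ /= [B mB <-]].
suff : measurable_fun [set: g_sigma_algebraType open_boxes]
    (fun v : g_sigma_algebraType open_boxes => (v : 'rV[R]_n) ord0 i : R).
  by move=> /(_ measurableT B mB).
apply: (measurability _ (RGenOpens.measurableE R)).
move=> _ [_ [a [b ->] <-]]; rewrite setTI.
rewrite (_ : _ @^-1` _ = \bigcup_k open_box
   (\row_j if j == i then a else (- k%:R)) (\row_j if j == i then b else k%:R)).
  apply: bigcup_measurable => k _; apply: sub_sigma_algebra.
  by eexists (_, _).
apply/seteqP; split => v.
  move=> /= vab; exists (Num.truncn `|v : 'rV[R]_n|).+1 => // j /=.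
  rewrite !mxE; case: eqVneq => [->//|_].
  rewrite in_itv/= -ltr_norml (le_lt_trans (rV_coord_le_norm _ _))//.
  exact: truncnS_gt.
by move=> [k _] /(_ i) /=; rewrite !mxE eqxx.
Qed.

(** Boxes are stable under intersection and generate the sigma-algebra, and the cubes of side []-k,
    k[] exhaust the space with finite measure. *)
Lemma measure_open_boxes_unique (m1 m2 : {measure set 'rV[R]_n -> \bar R}) :
  (forall a b, m1 (open_box a b) = m2 (open_box a b)) ->
  (forall a b, (m1 (open_box a b) < +oo)%E) ->
  forall A, measurable A -> m1 A = m2 A.
Proof.
move=> m12 m1oo; apply: (measure_unique open_boxes
  (fun k => open_box (const_mx (- k%:R)) (const_mx k%:R))).
- exact: measurable_open_boxesE.
- exact: open_boxes_setI.
- by move=> k; eexists (_, _).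
- exact: cover_open_boxes.
- by move=> _ [[a b] _ <-]; exact: m12.
- by move=> k; exact: m1oo.
Qed.

End boxes.

Section norm_ball.
Context {R : realType} {n : nat}.
Notation lam := (@lebesgue_rV R n).

Lemma compact_norm_le (N : R) : compact [set x : 'rV[R]_n | `|x| <= N].
Proof.
apply: bounded_closed_compact.
  exists N; split; first exact: num_real.
  by move=> M NM x /= xN; rewrite (le_trans xN)// ltW.
rewrite (_ : mkset _ = (@Num.norm _ _) @^-1` [set t | t <= N])//.
apply: closed_comp; last exact: closed_le.
by move=> x _; exact: norm_continuous.
Qed.

Lemma integrable_norm_supp (f : 'rV[R]_n -> R) (N C : R) :
  measurable_fun setT f -> (forall x, `|f x| <= C) -> (forall x, N < `|x| -> f x = 0) ->
  lam.-integrable setT (EFin \o f).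
Proof.
move=> mf fC f0; apply: (@integrable_bounded_supp _ _ _ _ [set x : 'rV[R]_n | `|x| <= N] _ C) => //.
- by apply: compact_measurable_rV; exact: compact_norm_le.
- by apply: compact_lebesgue_rV_lty; exact: compact_norm_le.
- by move=> x /negP; rewrite -ltNge; exact: f0.
Qed.

Section fubini.
Variables (f : R -> 'rV[R]_n -> R) (N C s : R).
Hypothesis mf : measurable_fun setT (fun p : measurableTypeR R * 'rV[R]_n => f p.1 p.2).
Hypothesis fC : forall t x, `|f t x| <= C.
Hypothesis f0 : forall t x, 0 <= t <= s -> N < `|x| -> f t x = 0.

(** [f t] is known to vanish far away only for [t] in [[0, s]]; the indicator yields a bounded
    function on the whole product that vanishes off a set of finite measure. *)
Let g (p : measurableTypeR R * 'rV[R]_n) : R := f p.1 p.2 * \1_(`[0, s]%classic) p.1.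

Let mg : measurable_fun setT g.
Proof.
apply: measurable_funM => //.
by apply: measurableT_comp; [exact: measurable_indic|exact: measurable_fst].
Qed.

Let ig : (@lebesgue_measure R \x lam)%E.-integrable setT (EFin \o g).
Proof.
have C0 : 0 <= C by rewrite (le_trans _ (fC 0 0)).
apply: (@integrable_bounded_supp _ _ R (@lebesgue_measure R \x lam)%E
  (`[0, s]%classic `*` [set x : 'rV[R]_n | `|x| <= N]) g C).
- apply: measurableX => //.
  by apply: compact_measurable_rV; exact: compact_norm_le.
- rewrite [ltLHS](_ : _ = (@lebesgue_measure R (`[0%R, s]%classic : set R) *
      lam [set x : 'rV[R]_n | (`|x| <= N)%R])%E); last first.
    apply: product_measure1E => //.
    by apply: compact_measurable_rV; exact: compact_norm_le.
  rewrite lte_mul_pinfty//.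
    by rewrite lebesgue_measure_itv; case: ifP.
  by apply: compact_lebesgue_rV_lty; exact: compact_norm_le.
- exact: mg.
- move=> p; rewrite /g normrM -[leRHS]mulr1 ler_pM// indicE normr_nat.
  by case: (_ \in _).
- move=> [t x] /= /not_andP[ts|/negP]; rewrite /g /=.
    by rewrite indicE memNset// mulr0.
  rewrite -ltNge => xN; rewrite indicE; case: (boolP (t \in _)); last by rewrite mulr0.
  by rewrite inE/= in_itv/= => ts; rewrite f0// mul0r.
Qed.

Let inner x : \int[lebesgue_measure]_(t in `[0, s]) f t x = \int[lebesgue_measure]_t g (t, x).
Proof.
rewrite Rintegral_mkcond; apply: eq_Rintegral => t _.
by rewrite patchE /g/= indicE; case: ifP; rewrite ?mulr1 ?mulr0.
Qed.

Lemma measurable_Rintegral_param :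
  measurable_fun setT (fun x => \int[lebesgue_measure]_(t in `[0, s]) f t x).
Proof.
under eq_fun do rewrite inner.
apply: measurableT_comp; first exact: fine_measurable.
exact: (measurable_fubini_G ig).
Qed.

Lemma Rintegral_param_bound x : 0 <= s ->
  `|\int[lebesgue_measure]_(t in `[0, s]) f t x| <= C * s.
Proof.
move=> s0.
have mft : measurable_fun `[0, s] (f ^~ x).
  apply: measurable_funTS.
  exact: (measurableT_comp mf (pair2_measurable x)).
have ls : (lebesgue_measure (`[0%R, s]%classic : set R) < +oo)%E.
  by rewrite lebesgue_measure_itv/=; case: ifP => // _; rewrite -EFinD ltry.
have ift : lebesgue_measure.-integrable `[0, s] (EFin \o (f ^~ x)).
  apply: measurable_bounded_integrable => //.
  by exists C; split; [exact: num_real|move=> M CM t _ /=; rewrite (le_trans (fC _ _))// ltW].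
rewrite (le_trans (le_normr_Rintegral _ ift))//.
apply: (@le_trans _ _ (\int[lebesgue_measure]_(t in `[0, s]) C)).
  apply: le_Rintegral => //; first exact: integrable_norm.
  apply: measurable_bounded_integrable => //.
  by exists `|C|; split; [exact: num_real|move=> M CM t _ /=; rewrite ltW].
rewrite Rintegral_cst//= lebesgue_measure_itv/= lte_fin.
move: s0; rewrite le_eqVlt => /predU1P[<-|s0]; first by rewrite ltxx mulr0.
by rewrite s0 -EFinD subr0.
Qed.

Let outer t : 0 <= t <= s -> (\int[lam]_x (f t x)%:E = (\int[lam]_x f t x)%:E)%E.
Proof.
move=> ts; rewrite /Rintegral fineK//; apply: integrable_fin_num => //.
apply: (@integrable_norm_supp _ N C) => [|x|x Nx]; [|exact: fC|exact: f0].
exact: (measurableT_comp mf (pair1_measurable t)).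
Qed.

Lemma Rfubini :
  \int[lebesgue_measure]_(t in `[0, s]) (\int[lam]_x f t x) =
  \int[lam]_x (\int[lebesgue_measure]_(t in `[0, s]) f t x).
Proof.
under [RHS]eq_Rintegral do rewrite inner.
rewrite [LHS]Rintegral_mkcond /Rintegral.
transitivity (fine (\int[lebesgue_measure]_t (\int[lam]_x (g (t, x))%:E))%E).
  congr fine; apply: eq_integral => t _; rewrite patchE.
  case: ifPn => [|ts].
    rewrite inE/= in_itv/= => ts; rewrite -/(Rintegral _ _ _) -outer//.
    by apply: eq_integral => x _; rewrite /g/= indicE mem_set ?mulr1.
  by rewrite integral0_eq// => x _; rewrite /g/= indicE (negbTE ts) mulr0.
rewrite (Fubini ig); congr fine.
(* The inner integral is finite for almost every [x] only, so its real and extended values are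
   identified almost everywhere. *)
apply: ae_eq_integral => //.
- exact: (measurable_fubini_G ig).
- apply/measurable_EFinP; apply: measurableT_comp; first exact: fine_measurable.
  exact: (measurable_fubini_G ig).
apply: filterS (ae_integrable2 ig) => x ix _.
by rewrite fineK//; exact: integrable_fin_num.
Qed.

Lemma Rfubini_integrable :
  lebesgue_measure.-integrable `[0, s] (EFin \o (fun t => \int[lam]_x f t x)).
Proof.
have := integrable_fubini_F ig => /(integrableS measurableT).
move=> /(_ (`[0, s]%classic : set R) (measurable_itv _) (subsetT _)).
apply: eq_integrable => // t; rewrite inE/= in_itv/= => ts.
by rewrite -outer//; apply: eq_integral => x _; rewrite /g/= indicE mem_set ?mulr1.
Qed.

End fubini.
End norm_ball.

Lemma lebesgue_segment_lty (R : realType) (a b : R) :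
  (lebesgue_measure (`[a, b]%classic : set R) < +oo)%E.
Proof. by rewrite lebesgue_measure_itv/=; case: ifP => // _; rewrite -EFinD ltry. Qed.

(** * Translations and averages along a coordinate axis *)

Section shift_along_axis.
Context {R : realType} {n : nat}.
Variable i : 'I_n.
Notation lam := (@lebesgue_rV R n).
Local Notation e := (delta_mx ord0 i : 'rV[R]_n).
Implicit Types (u h : 'rV[R]_n -> R).

Lemma norm_axis (r : R) : `|r *: e| <= `|r|.
Proof.
rewrite normrZ ler_piMr// [leLHS]mx_normrE; apply: bigmax_le => // -[j k] _ /=.
by rewrite mxE normr_nat; case: (_ && _).
Qed.

Lemma norm_shift_gt (N s r : R) (x : 'rV[R]_n) : 0 <= r <= s ->
  N + s < `|x| -> N < `|x + r *: e| /\ N < `|x - r *: e|.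
Proof.
move=> /andP[r0 rs] xN.
have rn : `|r *: e| <= s by rewrite (le_trans (norm_axis r))// ger0_norm.
split.
  have := ler_normB (x + r *: e) (r *: e); rewrite addrK => H.
  by rewrite -(ltrD2r s); apply: lt_le_trans xN _; rewrite (le_trans H)// lerD2l.
have := ler_normD (x - r *: e) (r *: e); rewrite subrK => H.
by rewrite -(ltrD2r s); apply: lt_le_trans xN _; rewrite (le_trans H)// lerD2l.
Qed.

Lemma measurable_line (b s : R) : measurable_fun setT
  (fun p : measurableTypeR R * 'rV[R]_n => (p.2 + (b * (s - p.1)) *: e : 'rV[R]_n)).
Proof.
apply: measurable_rVP => j; under eq_fun do rewrite !mxE.
apply: measurable_funD.
  exact: (measurableT_comp (measurable_coord j) measurable_snd).
apply: measurable_funM => //; apply: measurable_funM => //.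
by apply: measurable_funB => //; exact: measurable_fst.
Qed.

Definition C1_along u := (forall x, derivable u x e) /\ continuous (pderiv i u).

Lemma pderiv_shift u a x : pderiv i (fun y => u (y + a)) x = pderiv i u (x + a).
Proof.
rewrite /pderiv /derive (_ : (fun h : R => _) =
  (fun h : R => h^-1 *: ((u \o shift (x + a)) (h *: e) - u (x + a))))//.
by apply/funext => h /=; rewrite addrA.
Qed.

Lemma C1_along_FTC u x s : C1_along u -> 0 < s ->
  u (x + s *: e) - u x = \int[lebesgue_measure]_(t in `[0, s]) pderiv i u (x + t *: e).
Proof.
move=> [du cu] s0; rewrite /Rintegral.
have D t : is_derive t (1 : R) (fun r : R => u (x + r *: e)) (pderiv i u (x + t *: e)).
  exact: is_derive_line.
have cl : continuous (fun r : R => x + r *: e).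
  by move=> t; apply: cvgD; [exact: cvg_cst|exact: scalel_continuous].
have cF : continuous (fun r : R => u (x + r *: e)).
  by move=> t; apply: differentiable_continuous; apply/derivable1_diffP; case: (D t).
rewrite (@continuous_FTC2 R (fun t => pderiv i u (x + t *: e)) (fun r => u (x + r *: e)) 0 s)//.
- by rewrite scale0r addr0.
- apply: continuous_subspaceT => t.
  by apply: (@continuous_comp _ _ _ (fun r : R => x + r *: e) (pderiv i u)); [exact: cl|exact: cu].
- split=> [t _||].
  + by case: (D t).
  + by apply: cvg_at_right_filter; exact: cF.
  + by apply: cvg_at_left_filter; exact: cF.
- by move=> t _; rewrite derive1E derive_val.
Qed.

Lemma C1_along_FTC_rev u x s : C1_along u -> 0 < s ->
  u x - u (x - s *: e) =
  \int[lebesgue_measure]_(t in `[0, s]) pderiv i u (x - (s - t) *: e).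
Proof.
move=> Cu s0; have := C1_along_FTC (x - s *: e) Cu s0; rewrite subrK => ->.
by apply: eq_Rintegral => t _; rewrite scalerBl opprB addrA addrAC.
Qed.

Lemma measurable_comp_line u (b s : R) : measurable_fun setT u -> measurable_fun setT
  (fun p : measurableTypeR R * 'rV[R]_n => u (p.2 + (b * (s - p.1)) *: e)).
Proof. by move=> mu; apply: (measurableT_comp mu); exact: measurable_line. Qed.

(** The integral over the segment of length [s] issuing from [x] in the direction [b *: e], with [b]
    equal to 1 or -1. For [b = -1] the parameter [s - t] is the one given by the fundamental theorem
    of calculus started at [x - s *: e]. *)
Definition line_int (b s : R) u (x : 'rV[R]_n) : R :=
  \int[lebesgue_measure]_(t in `[0, s]) u (x + (b * (s - t)) *: e).

Lemma Rintegral_segment_near (g : R -> R) (A kappa s : R) : 0 <= s ->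
  lebesgue_measure.-integrable `[0, s] (EFin \o g) ->
  (forall t, 0 <= t <= s -> `|g t - A| <= kappa) ->
  `|\int[lebesgue_measure]_(t in `[0, s]) g t - s * A| <= kappa * s.
Proof.
move=> s0 ig gA.
have leb : fine (lebesgue_measure (`[0, s]%classic : set R)) = s.
  rewrite lebesgue_measure_itv/= lte_fin.
  by move: s0; rewrite le_eqVlt => /predU1P[<-|s0]; rewrite ?ltxx// s0 -EFinD subr0.
have ic (c : R) : lebesgue_measure.-integrable `[0, s] (EFin \o cst c).
  apply: measurable_bounded_integrable => //; first exact: lebesgue_segment_lty.
  by exists `|c|; split; [exact: num_real|move=> M CM t _ /=; rewrite ltW].
have cE (c : R) : \int[lebesgue_measure]_(t in `[0, s]) c = c * s.
  by rewrite Rintegral_cst// leb.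
rewrite [s * A]mulrC -(cE A) -RintegralB//; last exact: ic.
have igA : lebesgue_measure.-integrable `[0, s] (EFin \o (fun t => g t - A)).
  by apply: (integrableB _ ig (ic A)).
rewrite (le_trans (le_normr_Rintegral _ igA))// -cE.
apply: le_Rintegral => //.
- exact: integrable_norm.
- exact: (ic kappa).
Qed.

Section averages.
Variables (v : 'rV[R]_n -> R) (N D b s : R).
Hypotheses (mv : measurable_fun setT v) (vD : forall x, `|v x| <= D).
Hypothesis v0 : forall x, N < `|x| -> v x = 0.
Hypotheses (b1 : b = 1 \/ b = -1) (s0 : 0 <= s).

Lemma translate_supp t x : 0 <= t <= s -> N + s < `|x| ->
  v (x + (b * (s - t)) *: e) = 0.
Proof.
move=> /andP[t0 ts] xN; rewrite v0//.
have st : 0 <= s - t <= s by rewrite subr_ge0 ts gerBl.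
have [H1 H2] := norm_shift_gt st xN.
by case: b1 => ->; rewrite ?mul1r// mulN1r scaleNr.
Qed.

Lemma measurable_line_int : measurable_fun setT (line_int b s v).
Proof.
apply: (@measurable_Rintegral_param R n (fun t x => v (x + (b * (s - t)) *: e)) (N + s) D s).
- exact: measurable_comp_line.
- by move=> t x; exact: vD.
- exact: translate_supp.
Qed.

Lemma line_int_bound x : `|line_int b s v x| <= D * s.
Proof.
apply: (@Rintegral_param_bound R n (fun t x => v (x + (b * (s - t)) *: e)) D s) => //.
exact: measurable_comp_line.
Qed.

Lemma line_int_supp x : N + s < `|x| -> line_int b s v x = 0.
Proof.
move=> xN; rewrite /line_int (eq_Rintegral _ (g := cst 0)) ?Rintegral_cst ?mul0r//.
by move=> t; rewrite inE/= in_itv/= => ts; exact: translate_supp.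
Qed.

Lemma Rfubini_translates h (C : R) : measurable_fun setT h -> (forall x, `|h x| <= C) ->
  \int[lebesgue_measure]_(t in `[0, s])
     (\int[lam]_x (h x * v (x + (b * (s - t)) *: e))) =
  \int[lam]_x (h x * line_int b s v x).
Proof.
move=> mh hC.
rewrite (@Rfubini R n (fun t x => h x * v (x + (b * (s - t)) *: e)) (N + s) (C * D) s).
- apply: eq_Rintegral => x _; rewrite RintegralZl//.
  apply: measurable_bounded_integrable => //.
  + exact: lebesgue_segment_lty.
  + apply: measurable_funTS.
    exact: (measurableT_comp (measurable_comp_line b s mv) (pair2_measurable x)).
  + by exists D; split; [exact: num_real|move=> M CM t _ /=; rewrite (le_trans (vD _))// ltW].
- apply: measurable_funM; first exact: (measurableT_comp mh measurable_snd).
  exact: measurable_comp_line.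
- by move=> t x; rewrite normrM ler_pM.
- by move=> t x ts xN; rewrite translate_supp// mulr0.
Qed.

(** By Fubini, pairing [h] with [line_int] means integrating over [[0, s]] its pairings with
    translates of [v]. An error [kappa] on each of them gives [kappa * s]; when [kappa] is O(s), the
    total is O(s^2) and survives division by [s]. *)
Lemma Rintegral_line_int_near h (C A kappa : R) :
  measurable_fun setT h -> (forall x, `|h x| <= C) ->
  (forall r, 0 <= r <= s -> `|\int[lam]_x (h x * v (x + (b * r) *: e)) - A| <= kappa) ->
  `|\int[lam]_x (h x * line_int b s v x) - s * A| <= kappa * s.
Proof.
move=> mh hC H; rewrite -(Rfubini_translates mh hC).
apply: Rintegral_segment_near => //.
- apply: (@Rfubini_integrable R n (fun t x => h x * v (x + (b * (s - t)) *: e)) (N + s) (C * D) s).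
  + apply: measurable_funM; first exact: (measurableT_comp mh measurable_snd).
    exact: measurable_comp_line.
  + by move=> t x; rewrite normrM ler_pM.
  + by move=> t x ts xN; rewrite translate_supp// mulr0.
- by move=> t /andP[t0 ts]; apply: H; rewrite subr_ge0 ts gerBl.
Qed.

End averages.

Lemma C1_along_line_int u x s : C1_along u -> 0 < s ->
  u x - u (x - s *: e) = line_int (-1) s (pderiv i u) x.
Proof.
move=> Cu s0; rewrite (C1_along_FTC_rev x Cu s0); apply: eq_Rintegral => t _.
by rewrite mulN1r scaleNr.
Qed.

End shift_along_axis.

Section integrable_rV.
Context {R : realType} {n : nat}.
Notation lam := (@lebesgue_rV R n).

Lemma measurable_shift_rV (f : 'rV[R]_n -> R) a : measurable_fun setT f ->
  measurable_fun setT (fun x : 'rV[R]_n => f (x + a)).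
Proof. by move=> mf; apply: (measurableT_comp mf); exact: measurable_rV_shift. Qed.

Lemma RintegralN_rV (f : 'rV[R]_n -> R) : lam.-integrable setT (EFin \o f) ->
  \int[lam]_x (- f x) = - \int[lam]_x f x.
Proof.
move=> If; rewrite -mulN1r -RintegralZl//.
by apply: eq_Rintegral => x _; rewrite mulN1r.
Qed.

Lemma compact_norm_supp (K : set 'rV[R]_n) : compact K ->
  exists N : R, forall x, N < `|x| -> ~ K x.
Proof.
move=> /compact_bounded[B [_ KB]]; exists (B + 1) => x Bx Kx.
have : `|x| <= B + 1 by apply: KB => //; rewrite ltrDl.
by rewrite leNgt Bx.
Qed.

Lemma pderiv_norm_supp (N : R) (u : 'rV[R]_n -> R) i :
  (forall x, N < `|x| -> u x = 0) -> forall x, N < `|x| -> pderiv i u x = 0.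
Proof.
move=> u0 x Nx; apply: (@pderiv_supp _ _ [set x : 'rV[R]_n | `|x| <= N]).
- by apply: compact_closed; [exact: norm_hausdorff|exact: compact_norm_le].
- by move=> y /negP; rewrite -ltNge; exact: u0.
- by move=> /=; apply/negP; rewrite -ltNge.
Qed.

Lemma compact_open_dist (K U : set 'rV[R]_n) : compact K -> K `<=` U -> open U ->
  exists2 d : R, 0 < d & forall x, K x -> forall v, `|v - x| < d -> U v.
Proof.
move=> cK KU oU.
have NC : near_covering K by exact/compact_near_coveringP.
suff [d [dU d0]] : exists d : R, (K `<=` fun x => forall v, `|v - x| < d -> U v) /\ 0 < d.
  by exists d.
apply: (@filter_ex _ (0^'+ : set_system R)); apply: filterI; last exact: nbhs_right_gt.
have FF : Filter (0^'+ : set_system R) by exact: _.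
apply: (NC R _ (fun (d : R) (x : 'rV[R]_n) => forall v, `|v - x| < d -> U v) FF).
move=> x Kx; have /nbhs_ballP[d /= d0 dU] : nbhs x U.
  by apply: open_nbhs_nbhs; split => //; exact: KU.
have d20 : 0 < d / 2 by rewrite divr_gt0.
exists (ball x (d / 2), [set d' : R | d' < d / 2]).
  by split; [exact: nbhsx_ballx|exact: nbhs_right_lt].
move=> [x' d'] /= [xx' dd'] v vx'; apply: dU.
rewrite -ball_normE /= distrC in xx' *.
rewrite -(subrKA x') (le_lt_trans (ler_normD _ _))// [ltRHS]splitr ltrD//;
  rewrite distrC//; exact: lt_trans dd'.
Qed.

End integrable_rV.

(** * Increments of weakly differentiable functions *)

Section weak_derivative.
Context {R : realType} {n : nat}.
Notation lam := (@lebesgue_rV R n).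
Variables (i : 'I_n) (Phi Gam : 'rV[R]_n -> R) (N C : R) (U : set 'rV[R]_n).
Local Notation e := (delta_mx ord0 i : 'rV[R]_n).
Hypotheses (mPhi : measurable_fun setT Phi) (mGam : measurable_fun setT Gam).
Hypotheses (PhiC : forall x, `|Phi x| <= C) (GamC : forall x, `|Gam x| <= C).
Hypotheses (Phi0 : forall x, N < `|x| -> Phi x = 0).
Hypotheses (Gam0 : forall x, N < `|x| -> Gam x = 0).
Hypothesis weak : forall psi, Cc_smooth U psi ->
  \int[lam]_x (Phi x * pderiv i psi x) = - \int[lam]_x (Gam x * psi x).

Definition increment_defect (s : R) (x : 'rV[R]_n) : R :=
  Phi (x + s *: e) - Phi x - line_int i 1 s Gam x.

Let C0 : 0 <= C. Proof. by rewrite (le_trans _ (PhiC 0)). Qed.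

Lemma measurable_increment_defect s : 0 <= s -> measurable_fun setT (increment_defect s).
Proof.
move=> s0; apply: measurable_funB; last first.
  exact: (measurable_line_int i s mGam GamC Gam0 (or_introl erefl)).
by apply: measurable_funB => //; exact: measurable_shift_rV.
Qed.

Lemma increment_defect_bound s x : 0 <= s -> `|increment_defect s x| <= C + C + C * s.
Proof.
move=> s0; rewrite (le_trans (ler_normB _ _))//; apply: lerD.
  by rewrite (le_trans (ler_normB _ _))// lerD.
exact: line_int_bound.
Qed.

Lemma increment_defect_supp s x : 0 <= s -> N + s < `|x| -> increment_defect s x = 0.
Proof.
move=> s0 xN; rewrite /increment_defect (line_int_supp i Gam0 (or_introl erefl) xN).
have ss : 0 <= s <= s by rewrite s0 lexx.
have [H _] := norm_shift_gt i ss xN.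
by rewrite !Phi0 ?subrr ?subr0//; apply: le_lt_trans xN; rewrite lerDl.
Qed.

(* By Fubini, the defect tested against a bump is the weak derivative tested
   against the average of the translates of that bump. *)
Lemma increment_defect_bump (a b : 'rV[R]_n) k (s : R) : 0 < s ->
  (forall t v, 0 <= t <= s -> closed_box a b v -> U (v + t *: e)) ->
  \int[lam]_x (increment_defect s x * box_bump a b k x) = 0.
Proof.
move=> s0 abU; set psi := box_bump a b k.
have Cpsi : Ck 1 psi by exact: smooth_box_bump.
have cpsi : continuous psi by exact: Ck_continuous Cpsi.
have C1psi : C1_along i psi by have [_ /(_ i) []] := Cpsi.
have [P psiP] := compact_norm_supp (@compact_closed_box R n a b).
have psi0 x : P < `|x| -> psi x = 0.
  move=> /psiP xab; apply/eqP/negPn/negP => /box_bump_supp H; apply: xab => j /=.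
  by rewrite in_itv/=.
have dpsi0 := pderiv_norm_supp i psi0.
have psi1 x : `|psi x| <= 1 by rewrite ger0_norm ?box_bump_ge0// box_bump_le1.
have [B B0 dpsiB] : exists2 B : R, 0 <= B & forall x, `|pderiv i psi x| <= B.
  apply: (compact_supp_bounded (@compact_norm_le R n P)); first exact: C1psi.2.
  by move=> x /negP; rewrite -ltNge; exact: dpsi0.
have mpsi := continuous_measurable_rV cpsi.
have mdpsi := continuous_measurable_rV C1psi.2.
have I1 (f : 'rV[R]_n -> R) (E : R) : measurable_fun setT f -> (forall x, `|f x| <= E) ->
    lam.-integrable setT (EFin \o (fun x => f x * psi x)).
  move=> mf fE; apply: (@integrable_norm_supp _ _ _ P E).
  - exact: measurable_funM.
  - by move=> x; rewrite normrM -[leRHS]mulr1 ler_pM.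
  - by move=> x /psi0 ->; rewrite mulr0.
have mG : measurable_fun setT (line_int i 1 s Gam).
  exact: (measurable_line_int i s mGam GamC Gam0 (or_introl erefl)).
have GC x : `|line_int i 1 s Gam x| <= C * s by apply: line_int_bound => //; exact: ltW.
have mPs : measurable_fun setT (fun x : 'rV[R]_n => Phi (x + s *: e)) by exact: measurable_shift_rV.
transitivity (\int[lam]_x (Phi (x + s *: e) * psi x) - \int[lam]_x (Phi x * psi x)
   - \int[lam]_x (line_int i 1 s Gam x * psi x)).
  rewrite -RintegralB//; [|exact: (I1 _ C)|exact: (I1 _ C)].
  rewrite -RintegralB//; [|..|exact: (I1 _ (C * s))].
    by apply: eq_Rintegral => x _; rewrite /increment_defect; ring.
  rewrite [X in lam.-integrable _ X](_ : _ = EFin \o (fun x => (Phi (x + s *: e) - Phi x) * psi x)).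
    apply: (I1 _ (C + C)); first exact: measurable_funB.
    by move=> x; rewrite (le_trans (ler_normB _ _))// lerD.
  by apply/funext => x /=; rewrite mulrBl.
suff -> : \int[lam]_x (line_int i 1 s Gam x * psi x) =
    \int[lam]_x (Phi (x + s *: e) * psi x) - \int[lam]_x (Phi x * psi x) by rewrite subrr.
have mps (a0 : 'rV[R]_n) : measurable_fun setT (fun x : 'rV[R]_n => psi (x + a0))
  by exact: measurable_shift_rV.
have -> : \int[lam]_x (Phi (x + s *: e) * psi x) = \int[lam]_x (Phi x * psi (x - s *: e)).
  rewrite -[RHS](Rintegral_rV_shift (s *: e)); last exact: measurable_funM.
  by apply: eq_Rintegral => x _; rewrite addrK.
rewrite -RintegralB//; last 2 first.
- apply: (@integrable_norm_supp _ _ _ N C).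
  + exact: measurable_funM.
  + by move=> x; rewrite normrM -[leRHS]mulr1 ler_pM.
  + by move=> x /Phi0 ->; rewrite mul0r.
- exact: (I1 _ C).
transitivity (\int[lam]_x ((- Phi x) * line_int i (-1) s (pderiv i psi) x)); last first.
  by apply: eq_Rintegral => x _; rewrite -C1_along_line_int// -mulrBr; ring.
rewrite -(@Rfubini_translates R n i (pderiv i psi) P B (-1) s mdpsi dpsiB dpsi0
  (or_intror erefl) (fun x => - Phi x) C); last 2 first.
- exact: measurable_funN.
- by move=> x; rewrite normrN.
transitivity (\int[lam]_x (psi x * line_int i 1 s Gam x)).
  by apply: eq_Rintegral => x _; rewrite mulrC.
rewrite -(@Rfubini_translates R n i Gam N C 1 s mGam GamC Gam0
  (or_introl erefl) psi 1 mpsi psi1).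
apply: eq_Rintegral => t; rewrite inE/= in_itv/= => /andP[t0 ts].
set r := s - t; have r0 : 0 <= r <= s by rewrite subr_ge0 ts gerBl.
rewrite mul1r mulN1r scaleNr.
(* The translated bump is the bump of the translated box, which lies in [U], so it is admissible in
   the weak identity. *)
have Cpr : Cc_smooth U (fun x => psi (x - r *: e)).
  rewrite (_ : (fun x => _) = box_bump (a + r *: e) (b + r *: e) k); last first.
    by apply/funext => x; rewrite /psi box_bump_shift !opprK.
  apply: box_bump_Cc_smooth => v vab.
  rewrite -[v](subrK (r *: e)); apply: abU => // j /=.
  by have := vab j; rewrite /= !in_itv/= !mxE lerBrDr lerBlDr.
have W := weak Cpr.
rewrite (_ : pderiv i _ = (fun x => pderiv i psi (x - r *: e))) in W; last first.
  by apply/funext => x; exact: pderiv_shift.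
rewrite -[RHS]opprK -RintegralN_rV; last first.
  apply: (@integrable_norm_supp _ _ _ N (C * B)).
  + apply: measurable_funM; first exact: measurable_funN.
    exact: (measurable_shift_rV (- (r *: e)) mdpsi).
  + by move=> x; rewrite normrM normrN ler_pM.
  + by move=> x /Phi0 ->; rewrite oppr0 mul0r.
under [in RHS]eq_Rintegral do rewrite -mulNr opprK.
rewrite W opprK -[RHS](Rintegral_rV_shift (r *: e)); last exact: measurable_funM.
by apply: eq_Rintegral => x _; rewrite addrK mulrC.
Qed.

Local Notation D := increment_defect.

Let integrable_defect s (g : 'rV[R]_n -> R) (E : R) : 0 <= s -> measurable_fun setT g ->
  (forall x, `|g x| <= E) -> lam.-integrable setT (EFin \o (fun x => D s x * g x)).
Proof.
move=> s0 mg gE; apply: (@integrable_norm_supp _ _ _ (N + s) ((C + C + C * s) * E)).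
- by apply: measurable_funM => //; exact: measurable_increment_defect.
- by move=> x; rewrite normrM ler_pM// increment_defect_bound.
- by move=> x xN; rewrite increment_defect_supp// mul0r.
Qed.

(** Dominated convergence carries the bump identity to the indicator of the box, with the absolute
    value of the defect as majorant. *)
Lemma increment_defect_box (a b : 'rV[R]_n) (s : R) : 0 < s ->
  (forall t v, 0 <= t <= s -> closed_box a b v -> U (v + t *: e)) ->
  (\int[lam]_x (D s x * \1_(open_box a b) x)%:E = 0)%E.
Proof.
move=> s0 abU; have s0' := ltW s0.
have mb k : measurable_fun setT (box_bump a b k).
  exact: (continuous_measurable_rV (Ck_continuous (smooth_box_bump a b k 0))).
have b1 k x : `|box_bump a b k x| <= 1 by rewrite ger0_norm ?box_bump_ge0// box_bump_le1.
have mD := measurable_increment_defect s0'.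
have Z k : (\int[lam]_x (D s x * box_bump a b k x)%:E = 0)%E.
  have := increment_defect_bump k s0 abU; rewrite /Rintegral => E.
  have := integrable_fin_num measurableT (integrable_defect s0' (mb k) (b1 k)).
  by move=> /fineK <-; rewrite /= E.
have iabs : lam.-integrable setT (EFin \o (fun x => `|D s x|)).
  apply: (@integrable_norm_supp _ _ _ (N + s) (C + C + C * s)).
  - exact: measurableT_comp.
  - by move=> x; rewrite normr_id increment_defect_bound.
  - by move=> x xN; rewrite increment_defect_supp ?normr0.
have [] := @dominated_convergence _ _ _ lam setT measurableT
  (fun k x => (D s x * box_bump a b k x)%:E)
  (fun x => (D s x * \1_(open_box a b) x)%:E) (EFin \o (fun x => `|D s x|)).
- by move=> k; apply/measurable_EFinP; exact: measurable_funM.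
- apply/measurable_EFinP; apply: measurable_funM => //.
  by apply: measurable_indic; exact: measurable_open_box.
- apply: aeW => x _; apply: cvg_EFin; first exact: nearW.
  by apply: cvgM; [exact: cvg_cst|exact: cvg_box_bump].
- exact: iabs.
- apply: aeW => x k _; rewrite /= lee_fin normrM -[leRHS]mulr1 ler_pM//.
move=> _ _; rewrite (_ : [sequence _]_n = cst 0%E); last exact/funext.
by move=> /(cvg_unique _ (cvg_cst _)) <-.
Qed.

(** The defect has no sign, so its bound [E] is added to it on the cube [Q], which is the ball of
    the sup norm. The densities [(D s + E) 1_Q] and [E 1_Q] then define finite measures that agree
    on boxes, hence everywhere, so they are equal almost everywhere. *)
Lemma increment_defect_ball (x0 : 'rV[R]_n) (r s : R) : 0 < s ->
  (forall t v, 0 <= t <= s -> `|v - x0| <= r -> U (v + t *: e)) ->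
  {ae lam, forall x, `|x - x0| < r -> D s x = 0}.
Proof.
move=> s0 rU; have s0' := ltW s0.
have [r0|r0] := leP r 0.
  by apply: aeW => x xr; have := le_lt_trans (normr_ge0 _) xr; rewrite ltNge r0.
pose Q := open_box (x0 - const_mx r) (x0 + const_mx r).
have QP x : Q x <-> `|x - x0| < r.
  rewrite rV_norm_lt//; split=> H j; have := H j;
    by rewrite /= !mxE in_itv/= ltr_distl.
have mQ : measurable Q by exact: measurable_open_box.
pose E := C + C + C * s.
have E0 : 0 <= E by rewrite !addr_ge0// mulr_ge0.
have mQi : measurable_fun setT (\1_Q : 'rV[R]_n -> R) by exact: measurable_indic.
have i01 x : 0 <= (\1_Q x : R) <= 1 by rewrite indicE; case: (_ \in _); rewrite ?lexx ?ler01.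
pose g x := D s x * \1_Q x; pose h2 x := E * \1_Q x; pose h1 x := g x + h2 x.
have mD := measurable_increment_defect s0'.
have mg : measurable_fun setT g by exact: measurable_funM.
have mh2 : measurable_fun setT h2 by exact: measurable_funM.
have mh1 : measurable_fun setT h1 by exact: measurable_funD.
have h20 x : 0 <= h2 x by rewrite mulr_ge0//; case/andP: (i01 x).
have h10 x : 0 <= h1 x.
  rewrite /h1 /g /h2 -mulrDl mulr_ge0//.
  have := increment_defect_bound x s0'; rewrite ler_norml => /andP[H _].
  by rewrite -lerBlDr sub0r.
have i1 x : `|\1_Q x : R| <= 1 by rewrite ger0_norm; case/andP: (i01 x).
have ig : lam.-integrable setT (EFin \o g) by exact: (integrable_defect s0' mQi i1).
have ih2 : lam.-integrable setT (EFin \o h2).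
  apply: (@integrable_norm_supp _ _ _ (`|x0| + r) E) => //.
    by move=> x; rewrite /h2 normrM -[leRHS]mulr1 ler_pM// ger0_norm.
  move=> x xr; rewrite /h2 indicE memNset ?mulr0// => /QP.
  apply/negP; rewrite -leNgt -(lerD2l `|x0|) (le_trans (ltW xr))//.
  by rewrite -{1}[x](subrK x0) [x - x0 + x0]addrC ler_normD.
pose m1 := weighted_measure lam mh1 h10.
pose m2 := weighted_measure lam mh2 h20.
have ih1 : lam.-integrable setT (EFin \o h1).
  by rewrite (_ : EFin \o h1 = (EFin \o g) \+ (EFin \o h2))//; exact: integrableD.
have m12 A : measurable A -> m1 A = m2 A.
  apply: measure_open_boxes_unique => a b; last first.
    rewrite /= /m1 /weighted_measure.
    have : (\int[lam]_(x in open_box a b) (h1 x)%:E)%E \is a fin_num.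
      apply: integrable_fin_num; first exact: measurable_open_box.
      by apply: integrableS ih1 => //; exact: measurable_open_box.
    by rewrite fin_numE => /andP[_]; rewrite ltey.
  transitivity (\int[lam]_(x in open_box a b) (g x)%:E + \int[lam]_(x in open_box a b) (h2 x)%:E)%E.
    rewrite -integralD_EFin//; first exact: measurable_open_box.
      by apply: integrableS ig => //; exact: measurable_open_box.
    by apply: integrableS ih2 => //; exact: measurable_open_box.
  rewrite [X in (X + _)%E](_ : _ = 0%E) ?add0e//.
  rewrite integral_mkcond.
  (* Restricting to [Q] replaces the box by its intersection with [Q], again a box, whose closed
     version lies in the closed ball of radius [r]. *)
  rewrite -[RHS](increment_defect_box (a := \row_j Num.max (a ord0 j) ((x0 - const_mx r) ord0 j))
    (b := \row_j Num.min (b ord0 j) ((x0 + const_mx r) ord0 j)) s0).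
    apply: eq_integral => x _; rewrite -open_boxI -/Q.
    rewrite patchE /g indicI /=; rewrite [in RHS]indicE.
    by case: (_ \in _); rewrite ?mul1r ?mul0r ?mulr0.
  move=> t v ts vab; apply: rU => //.
  rewrite [leLHS]mx_normrE; apply: bigmax_le; first exact: ltW.
  move=> [k j] _ /=; rewrite ord1 !mxE ler_distl.
  have := vab j; rewrite /= in_itv/= !mxE ge_max le_min.
  by move=> /andP[/andP[_ ->] /andP[_ ->]].
have : ae_eq lam setT (EFin \o h1) (EFin \o h2).
  apply: integral_ae_eq => //; first exact/measurable_EFinP.
  by move=> A _ mA; exact: m12.
apply: filterS => x /(_ I) [] h12 xr.
have gx : g x = 0 by move: h12; rewrite /h1; lra.
by move: gx; rewrite /g indicE mem_set ?mulr1//; exact/QP.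
Qed.

Lemma increment_ae (K : set 'rV[R]_n) : compact K -> K `<=` U -> open U ->
  exists2 d : R, 0 < d & forall s, 0 < s <= d -> {ae lam, forall x, K x -> D s x = 0}.
Proof.
move=> cK KU oU.
have NC : near_covering K by exact/compact_near_coveringP.
have [d d0 dU] := compact_open_dist cK KU oU.
exists (d / 4); first by rewrite divr_gt0.
move=> s /andP[s0 sd].
(* Compactness is used with the filter of almost everywhere true properties; the premise [y = x]
   ties the point carried by the filter to the point being covered. *)
have H : \forall y \near almost_everywhere lam, K `<=` (fun x => y = x -> D s y = 0).
  have FF : Filter (almost_everywhere lam) by exact: _.
  apply: (NC _ _ (fun y x => y = x -> D s y = 0) FF) => x Kx.
  have Hx : {ae lam, forall y, `|y - x| < d / 4 -> D s y = 0}.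
    apply: increment_defect_ball => // t v /andP[t0 ts] vx; apply: (dU x) => //.
    rewrite addrAC (le_lt_trans (ler_normD _ _))//.
    have := norm_axis i t; rewrite (ger0_norm t0) => tn.
    by lra.
  exists (ball x (d / 4), [set y | `|y - x| < d / 4 -> D s y = 0]).
    by split; [apply: nbhsx_ballx; rewrite divr_gt0|exact: Hx].
  move=> [x' y] /= [xx' Hy] yx'; apply: Hy; rewrite yx'.
  by move: xx'; rewrite -ball_normE /= distrC.
by apply: filterS H => y Hy Ky; exact: Hy Ky erefl.
Qed.

End weak_derivative.

(** * Integration by parts against an exponential weight *)

Section exp_estimates.
Context {R : realType}.
Implicit Types a b c : R.

(** The tangent inequality e^(y-x) >= 1 + y - x gives e^x - e^y <= e^x (x - y); exchanging the two
    points gives the absolute value. *)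
Lemma expR_lipschitz a b c : `|a| <= c -> `|b| <= c ->
  `|expR a - expR b| <= expR c * `|a - b|.
Proof.
have H (x y : R) : `|x| <= c -> expR x - expR y <= expR c * `|x - y|.
  move=> xc; apply: (@le_trans _ _ (expR x * (x - y))).
    have := expR_ge1Dx (y - x); rewrite expRD expRN => h.
    have e0 := expR_gt0 x; rewrite -(ler_pM2l e0) mulrCA divff ?gt_eqF// mulr1 in h.
    by nra.
  rewrite (le_trans (ler_wpM2l (expR_ge0 x) (ler_norm (x - y))))//.
  by rewrite ler_wpM2r// ler_expR (le_trans (ler_norm _)).
move=> ac bc; rewrite ler_norml; apply/andP; split; last exact: H.
by rewrite lerNl opprB distrC; exact: H.
Qed.

(** The quantity e^(-g) - 1 + g is nonnegative, and it is at most g (1 - e^(-g)) because (1 + g)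
    e^(-g) <= 1. The factor 1 - e^(-g) is itself O(g). *)
Lemma expR_second_order g c : `|g| <= c -> `|1 - expR (- g) - g| <= expR c * g ^+ 2.
Proof.
move=> gc; have h1 := expR_ge1Dx (- g); have h2 := expR_ge1Dx g.
have e0 := expR_gt0 (- g).
have h3 : expR (- g) - 1 + g <= `|g| * `|1 - expR (- g)|.
  rewrite -normrM; apply: le_trans (ler_norm _).
  have : (1 + g) * expR (- g) <= 1.
    by rewrite -[leRHS](expR0) -[in leRHS](subrr g) expRD ler_pM2r.
  by nra.
have h4 : `|1 - expR (- g)| <= expR c * `|g|.
  rewrite -{1}expR0; have := @expR_lipschitz 0 (- g) c.
  by rewrite normr0 normrN sub0r opprK => ->//; exact: le_trans gc.
rewrite ler0_norm; last by lra.
apply: (@le_trans _ _ (expR (- g) - 1 + g)); first by lra.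
apply: (le_trans h3); rewrite -real_normK ?num_real// expr2 mulrA [_ * `|g|]mulrC.
by rewrite ler_wpM2l.
Qed.

End exp_estimates.

Section integration_by_parts.
Context {R : realType} {n : nat}.
Notation lam := (@lebesgue_rV R n).

Lemma Rintegral_ae_bound (f : 'rV[R]_n -> R) (P c : R) : 0 <= c ->
  measurable_fun setT f -> lam.-integrable setT (EFin \o f) ->
  (forall x, P < `|x| -> f x = 0) -> {ae lam, forall x, `|f x| <= c} ->
  `|\int[lam]_x f x| <= c * fine (lam [set x : 'rV[R]_n | `|x| <= P]).
Proof.
move=> c0 mf If f0 fc; set S := mkset _.
have mS : measurable S by apply: compact_measurable_rV; exact: compact_norm_le.
have lS : (lam S < +oo)%E by apply: compact_lebesgue_rV_lty; exact: compact_norm_le.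
rewrite (le_trans (le_normr_Rintegral _ If))// -lee_fin.
rewrite [leLHS](_ : _ = \int[lam]_x (`|f x|)%:E)%E; last first.
  by rewrite /Rintegral fineK//; apply: integrable_fin_num => //; exact: integrable_norm.
apply: (@le_trans _ _ (\int[lam]_x (c * \1_S x)%:E)%E).
  apply: ae_ge0_le_integral => //.
  - by apply/measurable_EFinP; exact: measurableT_comp.
  - by move=> x _; rewrite lee_fin mulr_ge0.
  - apply/measurable_EFinP; apply: measurable_funM => //; exact: measurable_indic.
  apply: filterS fc => x fxc _; rewrite lee_fin indicE.
  have [Sx|Sx] := pselect (S x); first by rewrite mem_set// mulr1.
  by rewrite memNset// mulr0 f0 ?normr0// ltNge; apply/negP.
under eq_integral do rewrite EFinM.
rewrite ge0_integralZl_EFin//; last by apply/measurable_EFinP; exact: measurable_indic.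
by rewrite integral_indic// setIT EFinM fineK// ge0_fin_numE.
Qed.

Variables (i : 'I_n) (Phi Gam : 'rV[R]_n -> R) (N C : R) (U : set 'rV[R]_n).
Local Notation e := (delta_mx ord0 i : 'rV[R]_n).
Hypotheses (mPhi : measurable_fun setT Phi) (mGam : measurable_fun setT Gam).
Hypotheses (PhiC : forall x, `|Phi x| <= C) (GamC : forall x, `|Gam x| <= C).
Hypotheses (Phi0 : forall x, N < `|x| -> Phi x = 0).
Hypotheses (Gam0 : forall x, N < `|x| -> Gam x = 0).
Hypothesis weak : forall psi, Cc_smooth U psi ->
  \int[lam]_x (Phi x * pderiv i psi x) = - \int[lam]_x (Gam x * psi x).

(* Both sides are compared with difference quotients of step s: one side by
   translation invariance, the other by a second order expansion of
   e^(- (phi (x + s e) - phi x)). The error is O(s). *)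
Lemma weighted_integration_by_parts (K : set 'rV[R]_n) (w : 'rV[R]_n -> R) :
  open U -> compact K -> K `<=` U -> continuous w -> C1_along i w ->
  (forall x, ~ K x -> w x = 0) ->
  \int[lam]_x (expR (- Phi x) * pderiv i w x) =
  \int[lam]_x (w x * expR (- Phi x) * Gam x).
Proof.
move=> oU cK KU cw Cw w0.
have C0 : 0 <= C by rewrite (le_trans _ (PhiC 0)).
have dw0 : forall x, ~ K x -> pderiv i w x = 0.
  by apply: pderiv_supp => //; apply: compact_closed => //; exact: norm_hausdorff.
have [W W0 wW] := compact_supp_bounded cK cw w0.
have [L L0 dwL] := compact_supp_bounded cK Cw.2 dw0.
have [N1 KN1] := compact_norm_supp cK.
have mw := continuous_measurable_rV cw; have mdw := continuous_measurable_rV Cw.2.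
have [d d0 dK] := increment_ae mPhi mGam PhiC GamC Phi0 Gam0 weak cK KU oU.
pose E x := expR (- Phi x); pose F x := w x * E x.
pose A := \int[lam]_x (E x * pderiv i w x).
pose B := \int[lam]_x (F x * Gam x).
pose EC := expR C.
have EC0 : 0 <= EC by exact: expR_ge0.
have EE x : `|E x| <= EC.
  by rewrite ger0_norm ?expR_ge0// ler_expR (le_trans (ler_norm _))// normrN.
have mE : measurable_fun setT E.
  by apply: measurableT_comp; [exact: measurable_expR|exact: measurable_funN].
have mF : measurable_fun setT F by exact: measurable_funM.
have FC x : `|F x| <= W * EC by rewrite normrM ler_pM.
(* The radius is enlarged by 1 so that translating by a step at most 1 keeps the support of [w]
   inside. *)
pose V := fine (lam [set x : 'rV[R]_n | `|x| <= N1 + 1]).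
have V0 : 0 <= V by exact: fine_ge0.
have out x r : 0 <= r <= 1 -> N1 + 1 < `|x| -> ~ K x /\ ~ K (x + r *: e).
  move=> r1 xN; split; apply: KN1; first by apply: le_lt_trans xN; rewrite lerDl.
  by have [] := norm_shift_gt i r1 xN.
have w_lip x r : 0 < r -> `|w (x + r *: e) - w x| <= L * r.
  move=> r0; have := C1_along_line_int (x + r *: e) Cw r0; rewrite addrK => ->.
  by apply: line_int_bound => //; exact: ltW.
have Phi_lip r : 0 < r <= d -> {ae lam, forall x, K x ->
    Phi (x + r *: e) - Phi x = line_int i 1 r Gam x}.
  move=> rd; apply: filterS (dK r rd) => x Dx Kx.
  by apply/eqP; rewrite -subr_eq0; apply/eqP/Dx.
have E_lip r : 0 < r <= d -> {ae lam, forall x, K x ->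
    `|E (x + r *: e) - E x| <= EC * (C * r)}.
  move=> /[dup] rd /andP[r0 _]; apply: filterS (Phi_lip r rd) => x Px Kx.
  have /(_ C) := @expR_lipschitz R (- Phi (x + r *: e)) (- Phi x).
  rewrite !normrN => /(_ (PhiC _) (PhiC _)) /le_trans; apply.
  rewrite ler_wpM2l// (_ : - _ - - _ = - (Phi (x + r *: e) - Phi x)); last by ring.
  by rewrite normrN Px// line_int_bound// ltW.
have mEr (r : R) : measurable_fun setT (fun x : 'rV[R]_n => E (x + r *: e)).
  exact: measurable_shift_rV.
have Int (f : 'rV[R]_n -> R) (Q : R) : measurable_fun setT f -> (forall x, `|f x| <= Q) ->
    (forall x, N1 + 1 < `|x| -> f x = 0) -> lam.-integrable setT (EFin \o f).
  exact: integrable_norm_supp.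
have outK x : N1 + 1 < `|x| -> ~ K x by move=> /(out x 0); rewrite lexx ler01 => /(_ isT)[].
pose c1 := L * (EC * C) * V.
(* The common quantity is the integral of [E] against the backward increment of [w]. Shifting the
   variable in each translate leaves an increment of [E], which is O(s) almost everywhere on [K]. *)
have S1 s : 0 < s <= Num.min d 1 ->
    `|\int[lam]_x (E x * line_int i (-1) s (pderiv i w) x) - s * A| <= c1 * s * s.
  rewrite le_min => /andP[s0 /andP[sd s1]].
  apply: (@Rintegral_line_int_near R n i (pderiv i w) N1 L (-1) s mdw dwL) => //.
  - by move=> x /KN1; exact: dw0.
  - by right.
  - exact: ltW.
  move=> r; rewrite le_eqVlt => /andP[/predU1P[<-|r0] rs].
    rewrite mulr0 scale0r; under eq_Rintegral do rewrite addr0.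
    by rewrite subrr normr0 !mulr_ge0// ltW.
  rewrite mulN1r scaleNr -(Rintegral_rV_shift (r *: e)); last first.
    by apply: measurable_funM => //; exact: (measurable_shift_rV (- (r *: e)) mdw).
  rewrite (@eq_Rintegral _ _ _ lam setT (fun x : 'rV[R]_n => E (x + r *: e) * pderiv i w x)); last first.
    by move=> x _; rewrite addrK.
  rewrite /A -RintegralB//; last 2 first.
  - apply: (Int _ (EC * L)); first exact: measurable_funM.
      by move=> x; rewrite normrM ler_pM.
    by move=> x /outK /dw0 ->; rewrite mulr0.
  - apply: (Int _ (EC * L)); first exact: measurable_funM.
      by move=> x; rewrite normrM ler_pM.
    by move=> x /outK /dw0 ->; rewrite mulr0.
  rewrite (@eq_Rintegral _ _ _ lam setT
      (fun x : 'rV[R]_n => (E (x + r *: e) - E x) * pderiv i w x)); last first.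
    by move=> x _; rewrite mulrBl.
  rewrite (_ : c1 * s = L * (EC * (C * s)) * V); last by rewrite /c1; ring.
  apply: Rintegral_ae_bound.
  - by rewrite !mulr_ge0// ltW.
  - by apply: measurable_funM => //; exact: measurable_funB.
  - apply: (Int _ ((EC + EC) * L)).
    + by apply: measurable_funM => //; exact: measurable_funB.
    + by move=> x; rewrite normrM ler_pM// (le_trans (ler_normB _ _))// lerD.
    + by move=> x /outK /dw0 ->; rewrite mulr0.
  - by move=> x /outK /dw0 ->; rewrite mulr0.
  have rd : 0 < r <= d by rewrite r0 (le_trans rs).
  apply: filterS (E_lip r rd) => x Ex.
  have [Kx|Kx] := pselect (K x); last first.
    by rewrite dw0// mulr0 normr0 !mulr_ge0// ltW.
  rewrite normrM mulrC ler_pM//.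
  by rewrite (le_trans (Ex Kx))// !ler_wpM2l.
pose c2 := W * EC * (EC * C ^+ 2) * V.
(* The same quantity with the translation moved onto [E]: almost everywhere on [K], the shifted
   weight is [E x * expR (- g)], where [g] is the integral of [Gam] along the segment, and
   [1 - expR (- g)] is replaced by [g] with an error O(s^2). *)
have S2 s : 0 < s <= Num.min d 1 ->
    `|\int[lam]_x (E x * line_int i (-1) s (pderiv i w) x)
      - \int[lam]_x (F x * line_int i 1 s Gam x)| <= c2 * s * s.
  rewrite le_min => /andP[s0 /andP[sd s1]].
  have s01 : 0 <= s <= 1 by rewrite (ltW s0).
  have mws : measurable_fun setT (fun x : 'rV[R]_n => w (x - s *: e)).
    exact: (measurable_shift_rV (- (s *: e)) mw).
  have mG := measurable_line_int i s mGam GamC Gam0 (or_introl erefl).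
  have GC x : `|line_int i 1 s Gam x| <= C * s by apply: line_int_bound => //; exact: ltW.
  have -> : \int[lam]_x (E x * line_int i (-1) s (pderiv i w) x) =
      \int[lam]_x (E x * w x) - \int[lam]_x (E (x + s *: e) * w x).
    rewrite (@eq_Rintegral _ _ _ lam setT
      (fun x : 'rV[R]_n => E x * w x - E x * w (x - s *: e))); last first.
      by move=> x _; rewrite -C1_along_line_int// mulrBr.
    rewrite RintegralB//; last 2 first.
    - apply: (Int _ (EC * W)); first exact: measurable_funM.
        by move=> x; rewrite normrM ler_pM.
      by move=> x /outK /w0 ->; rewrite mulr0.
    - apply: (Int _ (EC * W)); first exact: measurable_funM.
        by move=> x; rewrite normrM ler_pM.
      move=> x xN; rewrite w0 ?mulr0//; apply: KN1.
      by have [] := norm_shift_gt i s01 xN.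
    congr (_ - _); rewrite -(Rintegral_rV_shift (s *: e)); last exact: measurable_funM.
    by apply: eq_Rintegral => x _; rewrite addrK.
  have I1 (g : 'rV[R]_n -> R) (Q : R) : measurable_fun setT g -> (forall x, `|g x| <= Q) ->
      lam.-integrable setT (EFin \o (fun x => g x * w x)).
    move=> mg gQ; apply: (Int _ (Q * W)); first exact: measurable_funM.
      by move=> x; rewrite normrM ler_pM.
    by move=> x /outK /w0 ->; rewrite mulr0.
  have E1 x : `|E x - E (x + s *: e)| <= EC + EC by rewrite (le_trans (ler_normB _ _))// lerD.
  have E2 x : `|E x * line_int i 1 s Gam x| <= EC * (C * s) by rewrite normrM ler_pM.
  have mE1 : measurable_fun setT (fun x => E x - E (x + s *: e)) by exact: measurable_funB.
  have mE2 : measurable_fun setT (fun x => E x * line_int i 1 s Gam x) by exact: measurable_funM.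
  have mE3 : measurable_fun setT (fun x => E x - E (x + s *: e) - E x * line_int i 1 s Gam x).
    exact: measurable_funB.
  have E3 x : `|E x - E (x + s *: e) - E x * line_int i 1 s Gam x| <= EC + EC + EC * (C * s).
    by rewrite (le_trans (ler_normB _ _))// lerD.
  rewrite -RintegralB//; [|exact: (I1 _ EC)|exact: (I1 _ EC)].
  rewrite (@eq_Rintegral _ _ _ lam setT (fun x : 'rV[R]_n => (E x - E (x + s *: e)) * w x)); last first.
    by move=> x _; rewrite mulrBl.
  rewrite [X in _ - X](@eq_Rintegral _ _ _ lam setT
      (fun x : 'rV[R]_n => (E x * line_int i 1 s Gam x) * w x)); last first.
    by move=> x _; rewrite /F; ring.
  rewrite -RintegralB//; [|exact: (I1 _ (EC + EC))|exact: (I1 _ (EC * (C * s)))].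
  rewrite (@eq_Rintegral _ _ _ lam setT
      (fun x : 'rV[R]_n => (E x - E (x + s *: e) - E x * line_int i 1 s Gam x) * w x)); last first.
    by move=> x _; rewrite [in RHS]mulrBl.
  rewrite (_ : c2 * s * s = EC * (EC * (C * s) ^+ 2) * W * V); last by rewrite /c2; ring.
  apply: Rintegral_ae_bound.
  - by rewrite !mulr_ge0// ltW.
  - exact: measurable_funM.
  - exact: (I1 _ (EC + EC + EC * (C * s))).
  - by move=> x /outK /w0 ->; rewrite mulr0.
  have rd : 0 < s <= d by rewrite s0.
  apply: filterS (Phi_lip s rd) => x Px.
  have [Kx|Kx] := pselect (K x); last first.
    by rewrite w0// mulr0 normr0 !mulr_ge0// ltW.
  rewrite normrM ler_pM//.
  have -> : E (x + s *: e) = E x * expR (- line_int i 1 s Gam x).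
    by rewrite -Px// /E -expRD; congr expR; ring.
  set g := line_int i 1 s Gam x.
  rewrite (_ : _ - _ = E x * (1 - expR (- g) - g)); last by ring.
  rewrite normrM ler_pM//.
  have gC : `|g| <= C by rewrite (le_trans (GC x))// ler_piMr.
  rewrite (le_trans (expR_second_order gC))// ler_wpM2l//.
  have Cs0 : 0 <= C * s by exact: le_trans (normr_ge0 _) (GC x).
  rewrite -real_normK ?num_real//; apply: lerXn2r; rewrite ?nnegrE//.
  exact: GC.
pose c3 := (L * EC + W * (EC * C)) * C * V.
(* After a shift, the error comes from the increment of [F = w * E], to which both factors
   contribute O(s). *)
have S3 s : 0 < s <= Num.min d 1 ->
    `|\int[lam]_x (F x * line_int i 1 s Gam x) - s * B| <= c3 * s * s.
  rewrite le_min => /andP[s0 /andP[sd s1]].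
  apply: (@Rintegral_line_int_near R n i Gam N C 1 s mGam GamC Gam0 _ _ F (W * EC)) => //.
  - by left.
  - exact: ltW.
  move=> r; rewrite le_eqVlt => /andP[/predU1P[<-|r0] rs].
    rewrite mulr0 scale0r; under eq_Rintegral do rewrite addr0.
    by rewrite subrr normr0 !mulr_ge0// ?addr_ge0// ?mulr_ge0// ltW.
  have r01 : 0 <= r <= 1 by rewrite (ltW r0) (le_trans rs).
  have mGr : measurable_fun setT (fun x : 'rV[R]_n => Gam (x + r *: e)) by exact: measurable_shift_rV.
  have mFr : measurable_fun setT (fun x : 'rV[R]_n => F (x + r *: e)) by exact: measurable_shift_rV.
  rewrite mul1r /B -[X in _ - X](Rintegral_rV_shift (r *: e)); last exact: measurable_funM.
  rewrite -RintegralB//; last 2 first.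
  - apply: (Int _ (W * EC * C)); first exact: measurable_funM.
      by move=> x; rewrite normrM ler_pM.
    by move=> x /outK /w0; rewrite /F => ->; rewrite !mul0r.
  - apply: (Int _ (W * EC * C)); first exact: measurable_funM.
      by move=> x; rewrite normrM ler_pM.
    by move=> x /(out x r r01) [_ /w0]; rewrite /F => ->; rewrite !mul0r.
  rewrite (@eq_Rintegral _ _ _ lam setT
      (fun x : 'rV[R]_n => (F x - F (x + r *: e)) * Gam (x + r *: e))); last first.
    by move=> x _; rewrite mulrBl.
  rewrite (_ : c3 * s = ((L * s) * EC + W * (EC * (C * s))) * C * V); last by rewrite /c3; ring.
  apply: Rintegral_ae_bound.
  - by rewrite !mulr_ge0// ?addr_ge0// !mulr_ge0// ltW.
  - by apply: measurable_funM => //; exact: measurable_funB.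
  - apply: (Int _ ((W * EC + W * EC) * C)).
    + by apply: measurable_funM => //; exact: measurable_funB.
    + by move=> x; rewrite normrM ler_pM// (le_trans (ler_normB _ _))// lerD.
    + by move=> x /(out x r r01) [/w0 h1 /w0 h2]; rewrite /F h1 h2 !mul0r subrr mul0r.
  - by move=> x /(out x r r01) [/w0 h1 /w0 h2]; rewrite /F h1 h2 !mul0r subrr mul0r.
  have rd : 0 < r <= d by rewrite r0 (le_trans rs).
  apply: filterS (E_lip r rd) => x Ex.
  rewrite normrM ler_pM//.
  rewrite (_ : F x - F (x + r *: e) = - ((w (x + r *: e) - w x) * E (x + r *: e)
     + w x * (E (x + r *: e) - E x))); last by rewrite /F; ring.
  rewrite normrN (le_trans (ler_normD _ _))// lerD//.
    by rewrite normrM ler_pM// (le_trans (w_lip _ _ r0))// ler_wpM2l.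
  have [Kx|Kx] := pselect (K x); last first.
    by rewrite w0// mul0r normr0 !mulr_ge0// ltW.
  by rewrite normrM ler_pM// (le_trans (Ex Kx))// !ler_wpM2l.
suff : `|A - B| <= 0 by rewrite normr_le0 subr_eq0 => /eqP.
apply/ler_addgt0Pr => eps eps0; rewrite add0r.
pose c := c1 + c2 + c3 + 1.
have c0 : 0 < c.
  by rewrite ltr_wpDl// !addr_ge0// !(mulr_ge0, addr_ge0)// exprn_ge0.
(* The three estimates add up to [s * |A - B| <= c * s^2]; dividing by [s] and taking [s <= eps / c]
   leaves at most [eps]. *)
pose s := Num.min (Num.min d 1) (eps / c).
have s0 : 0 < s by rewrite !lt_min d0 ltr01 divr_gt0.
have sd : 0 < s <= Num.min d 1 by rewrite s0 ge_min lexx.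
have sABc : s * `|A - B| <= c * s * s.
  rewrite -{1}(gtr0_norm s0) -normrM mulrBr.
  have := S1 s sd; have := S2 s sd; have := S3 s sd.
  move: (s * A) (s * B) (\int[lam]_x (E x * _ x)) (\int[lam]_x (F x * line_int i 1 s Gam x)).
  move=> sA sB X Y; rewrite !ler_norml => /andP[? ?] /andP[? ?] /andP[? ?].
  have ss : 0 <= s * s by rewrite mulr_ge0// ltW.
  have cs : c * s * s = c1 * s * s + c2 * s * s + c3 * s * s + s * s.
    by rewrite /c; ring.
  by apply/andP; split; rewrite cs; lra.
rewrite [c * s * s]mulrC ler_pM2l// in sABc.
rewrite (le_trans sABc)// mulrC -ler_pdivlMr//.
by rewrite ge_min lexx orbT.
Qed.

End integration_by_parts.

(** * N-functions *)

Section N_functions.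
Context {R : realType}.
Variables (M : R -> R) (c : R).
Hypotheses (NM : N_function M) (CM : C1_pos M).
Hypothesis MD : forall x, 0 < x -> M (2 * x) <= c * M x.
Hypothesis Mmono : {in `]0, +oo[ &, {homo (fun l : R => M l / l ^+ 2) : x y / x <= y}}.

Lemma N_function_ge0 x : 0 <= x -> 0 <= M x.
Proof. by case: NM => _ _ + _ _; apply. Qed.

Lemma N_function_cvg0 : M x @[x --> 0^'+] --> M 0.
Proof. by case: NM => /continuous_within_itvcyP[]. Qed.

Lemma N_function0 : M 0 = 0.
Proof.
have H : M x @[x --> 0^'+] --> (0 : R).
  have [_ _ _ Mx0 _] := NM.
  have : (M x / x) * x @[x --> 0^'+] --> (0 * 0 : R).
    by apply: cvgM => //; exact/cvg_at_right_filter/cvg_id.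
  rewrite mulr0; apply: cvg_trans; apply: near_eq_cvg; near=> x.
  by rewrite divfK// gt_eqF.
exact: (cvg_unique _ N_function_cvg0 H).
Unshelve. all: by end_near. Qed.

Lemma N_function_convex x y t : 0 <= x -> 0 <= y -> 0 <= t <= 1 ->
  M (t * x + (1 - t) * y) <= t * M x + (1 - t) * M y.
Proof.
move=> x0 y0 /andP[t0 t1]; have [_ cvx _ _ _] := NM.
have := cvx (Itv01 t0 t1) x y.
by apply; rewrite inE /= in_itv/= ?x0 ?y0.
Qed.

Lemma N_function_quot_le x y : 0 < x -> x <= y -> M x / x ^+ 2 <= M y / y ^+ 2.
Proof.
move=> x0 xy; apply: Mmono => //; rewrite in_itv/= ?x0//.
by rewrite (lt_le_trans x0).
Qed.

(** Monotonicity of M(l)/l^2 between [t * x] and [x] gives the square of [t], where convexity alone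
    would give [t]. *)
Lemma N_function_scale t x : 0 <= t <= 1 -> 0 <= x -> M (t * x) <= t ^+ 2 * M x.
Proof.
move=> /andP[]; rewrite le_eqVlt => /predU1P[<- _ _|t0 t1].
  by rewrite mul0r N_function0 expr0n mul0r.
rewrite le_eqVlt => /predU1P[<-|x0]; first by rewrite mulr0 N_function0 mulr0.
have tx0 : 0 < t * x by rewrite mulr_gt0.
have txx : t * x <= x by rewrite ler_piMl// ltW.
have := N_function_quot_le tx0 txx.
rewrite ler_pdivrMr ?exprn_gt0// => /le_trans; apply.
rewrite (_ : _ * (t * x) ^+ 2 = t ^+ 2 * M x)//.
by field; rewrite gt_eqF.
Qed.

Lemma N_function_le x y : 0 <= x -> x <= y -> M x <= M y.
Proof.
rewrite le_eqVlt => /predU1P[<- y0|x0 xy]; first by rewrite N_function0 N_function_ge0.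
have y0 : 0 < y by exact: lt_le_trans xy.
have t01 : 0 <= x / y <= 1.
  by apply/andP; split; [rewrite divr_ge0 ?ltW|rewrite ler_pdivrMr// mul1r].
have := N_function_scale t01 (ltW y0); rewrite divfK ?gt_eqF// => /le_trans; apply.
case/andP: t01 => t0 t1.
by rewrite ler_piMl ?N_function_ge0 ?(ltW y0)// exprn_ile1.
Qed.

Lemma N_function_double x : 0 <= x -> M (2 * x) <= c * M x.
Proof.
rewrite le_eqVlt => /predU1P[<-|]; last exact: MD.
by rewrite mulr0 N_function0 mulr0.
Qed.

Hypothesis c1 : 1 <= c.
Let c0 : 0 <= c. Proof. exact: le_trans c1. Qed.

Lemma N_function_mult A : 0 <= A -> exists2 CA : R, 0 <= CA &
  forall x, 0 <= x -> M (A * x) <= CA * M x.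
Proof.
move=> A0; have H k x : 0 <= x -> M (2 ^+ k * x) <= c ^+ k * M x.
  move=> x0; elim: k => [|k IH]; first by rewrite !expr0 !mul1r.
  rewrite !exprS -!mulrA (le_trans (N_function_double _))//.
    by rewrite mulr_ge0// exprn_ge0.
  by rewrite ler_wpM2l.
(* This [k] satisfies |A| < k < 2^k, so [k] doublings suffice. *)
pose k := (Num.truncn `|A|).+1.
exists (c ^+ k); first by rewrite exprn_ge0.
move=> x x0; apply: le_trans (H k x x0); apply: N_function_le; first by rewrite mulr_ge0.
rewrite ler_wpM2r// (le_trans (ler_norm A))// (le_trans (ltW (truncnS_gt _)))//.
by rewrite -natrX ler_nat ltnW// ltn_expl.
Qed.

Lemma N_function_add x y : 0 <= x -> 0 <= y -> M (x + y) <= c * (M x + M y).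
Proof.
have H a b : 0 <= a -> 0 <= b -> a <= b -> M (a + b) <= c * (M a + M b).
  move=> a0 b0 ab; apply: (@le_trans _ _ (M (2 * b))).
    by apply: N_function_le; [rewrite addr_ge0|rewrite mulrDl mul1r lerD2r].
  rewrite (le_trans (N_function_double b0))// ler_wpM2l// lerDr.
  exact: N_function_ge0.
move=> x0 y0; have [xy|/ltW yx] := leP x y; first exact: H.
by rewrite addrC [M x + _]addrC; exact: H.
Qed.

Lemma N_function_sum (I : Type) (r : seq I) (x : I -> R) : (forall i, 0 <= x i) ->
  M (\sum_(i <- r) x i) <= c ^+ size r * \sum_(i <- r) M (x i).
Proof.
move=> x0; elim: r => [|i r IH]; first by rewrite !big_nil N_function0 mulr0.
rewrite !big_cons (le_trans (N_function_add _ _))//; first exact: sumr_ge0.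
rewrite exprS -mulrA ler_wpM2l// mulrDr lerD//.
by rewrite ler_peMl ?N_function_ge0// exprn_ege1.
Qed.

(** Right difference quotients are nonnegative since [M] is nondecreasing. By convexity they are at
    most the slope of the chord from [l] to [2 * l], which the doubling inequality controls. *)
Lemma N_function_derive_bounds l : 0 < l ->
  0 <= derive1 M l /\ l * derive1 M l <= c * M l.
Proof.
move=> l0; have dM := CM.1 l l0.
have cv : h^-1 * (M (h + l) - M l) @[h --> 0^'+] --> derive1 M l.
  apply: cvg_dnbhs_at_right; move: dM.
  rewrite /derivable (_ : (fun h => _) = (fun h => h^-1 *: (M (h + l) - M l)))//.
  by apply/funext => h /=; rewrite [h *: 1]mulr1.
split.
  apply: (ler_cvg_to (cvg_cst (0 : R)) cv); near=> h.
  have h0 : 0 < h by near: h; exact: nbhs_right_gt.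
  rewrite mulr_ge0 ?invr_ge0 ?(ltW h0)// subr_ge0 N_function_le ?(ltW l0)//.
  by rewrite lerDr ltW.
suff : derive1 M l <= l^-1 * (M (2 * l) - M l).
  rewrite ler_pdivlMl// => /le_trans; apply.
  have := N_function_ge0 (ltW l0); have := MD l0; lra.
apply: (ler_cvg_to cv (cvg_cst _)); near=> h.
have h0 : 0 < h by near: h; exact: nbhs_right_gt.
have hl : h <= l by near: h; exact: nbhs_right_le.
(* The point [h + l] is the combination of [l] and [2 * l] with weights [1 - h / l] and [h / l]. *)
have t01 : 0 <= 1 - h / l <= 1.
  by rewrite subr_ge0 ler_pdivrMr// mul1r hl gerBl divr_ge0// ltW.
have l2 : 0 <= 2 * l by rewrite mulr_ge0// ltW.
have := N_function_convex (ltW l0) l2 t01.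
rewrite (_ : _ + _ * (2 * l) = h + l); last by field; rewrite gt_eqF.
rewrite ler_pdivrMl// => H.
rewrite (_ : h * _ = h / l * (M (2 * l) - M l)); last by rewrite mulrA.
by move: H; set q := h / l; lra.
Unshelve. all: by end_near. Qed.

(** If a^2 <= eta l^2, the first term on the right suffices. Otherwise l <= a / sqrt eta, so
    M(l)/l^2 is at most its value at a / sqrt eta, and the doubling inequality removes the factor 1
    / sqrt eta. *)
Lemma N_function_young eta : 0 < eta -> exists2 Ce : R, 0 <= Ce &
  forall l a, 0 < l -> 0 <= a -> M l / l ^+ 2 * a ^+ 2 <= eta * M l + Ce * M a.
Proof.
move=> eta0; have [|Ce Ce0 HCe] := @N_function_mult (Num.sqrt eta)^-1.
  by rewrite invr_ge0 sqrtr_ge0.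
exists (eta * Ce); first by rewrite mulr_ge0// ltW.
move=> l a l0 a0; have sq0 : 0 < Num.sqrt eta by rewrite sqrtr_gt0.
have sqE : Num.sqrt eta ^+ 2 = eta by rewrite sqr_sqrtr// ltW.
have [al|al] := leP (a ^+ 2) (eta * l ^+ 2).
  rewrite (@le_trans _ _ (eta * M l))//; last first.
    by rewrite lerDl !mulr_ge0 ?N_function_ge0// ltW.
  rewrite mulrAC ler_pdivrMr ?exprn_gt0// mulrAC [leRHS]mulrC.
  by rewrite ler_wpM2l ?N_function_ge0// ltW.
have lb : l <= (Num.sqrt eta)^-1 * a.
  rewrite ler_pdivlMl// -(@ler_pXn2r _ 2)// ?nnegrE ?mulr_ge0// 1?ltW//.
  by rewrite exprMn sqE.
have b0 : 0 < (Num.sqrt eta)^-1 * a by exact: lt_le_trans lb.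
have an0 : a != 0.
  by apply: contraTneq b0 => ->; rewrite mulr0 ltxx.
rewrite (@le_trans _ _ (eta * Ce * M a))//; last first.
  by rewrite lerDr mulr_ge0 ?N_function_ge0// ltW.
rewrite (le_trans (ler_wpM2r (sqr_ge0 a) (N_function_quot_le l0 lb)))//.
rewrite (_ : _ * a ^+ 2 = eta * M ((Num.sqrt eta)^-1 * a)); last first.
  by rewrite -[X in _ = X * _]sqE; field; rewrite an0 gt_eqF.
by rewrite -mulrA ler_wpM2l ?HCe// ltW.
Qed.

(** The function [G] of the overview: its value at l^2 is M(l)/l^2 for l > 0. Taking the square as
    variable lets it be composed with the squared gradient, which is smooth. *)
Definition sqrt_quot (t : R) : R := M (Num.sqrt t) / t.

Definition sqrt_quot' (t : R) : R :=
  (Num.sqrt t * derive1 M (Num.sqrt t) - 2 * M (Num.sqrt t)) / (2 * t ^+ 2).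

Lemma is_derive_sqrt_quot (t : R) : 0 < t -> is_derive t (1 : R) sqrt_quot (sqrt_quot' t).
Proof.
move=> t0; have s0 : 0 < Num.sqrt t by rewrite sqrtr_gt0.
have dM : is_derive (Num.sqrt t) (1 : R) M (derive1 M (Num.sqrt t)).
  by rewrite derive1E; apply: derivableP; exact: CM.1.
have dS := is_derive1_sqrt t0.
have dMS := is_derive1_comp dM dS.
have tn : t != 0 by rewrite gt_eqF.
have dV : is_derive t (1 : R) (fun y : R => y^-1) (- t ^- 2).
  by have := @is_deriveV R id t 1 1 tn (is_derive_id _ _); rewrite /= [_ *: 1]mulr1.
have := is_deriveM dMS dV; set df := (X in is_derive _ _ _ X).
suff -> : sqrt_quot' t = df by [].
rewrite /df /sqrt_quot' /GRing.scale/=.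
have tE : t = Num.sqrt t ^+ 2 by rewrite sqr_sqrtr// ltW.
move: s0 tE; set s := Num.sqrt t => s0 tE; rewrite tE.
by field; rewrite gt_eqF.
Qed.

Lemma continuous_sqrt_quot' (t : R) : 0 < t -> {for t, continuous (derive1 sqrt_quot)}.
Proof.
move=> t0; have s0 : 0 < Num.sqrt t by rewrite sqrtr_gt0.
have E y : 0 < y -> derive1 sqrt_quot y = sqrt_quot' y.
  by move=> y0; rewrite derive1E; case: (is_derive_sqrt_quot y0).
rewrite /prop_for /continuous_at E//.
apply: (@cvg_trans _ (sqrt_quot' @ t)).
  by apply: near_eq_cvg; near=> y; rewrite E//; near: y; exact: lt_nbhsr.
have cs : Num.sqrt x @[x --> t] --> Num.sqrt t by exact: sqrt_continuous.
have dM : derivable M (Num.sqrt t) 1 by exact: CM.1.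
have cM : M x @[x --> Num.sqrt t] --> M (Num.sqrt t).
  by apply: differentiable_continuous; exact/derivable1_diffP.
have cM' : derive1 M x @[x --> Num.sqrt t] --> derive1 M (Num.sqrt t).
  by apply: CM.2; rewrite in_itv/= s0.
have cMs : M (Num.sqrt x) @[x --> t] --> M (Num.sqrt t) by exact: (cvg_comp _ _ cs cM).
have cMs' : derive1 M (Num.sqrt x) @[x --> t] --> derive1 M (Num.sqrt t).
  exact: (cvg_comp _ _ cs cM').
have c1' := cvgB (cvgM cs cMs') (cvgM (cvg_cst (2 : R)) cMs).
have c2' : (2 * x ^+ 2)^-1 @[x --> t] --> (2 * t ^+ 2)^-1.
  apply: cvgV; first by rewrite mulf_neq0// expf_neq0// gt_eqF.
  by apply: cvgM; [exact: cvg_cst|exact: exprn_continuous].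
by have := cvgM (c1' _ _ _ _) c2'; apply.
Unshelve. all: by end_near. Qed.

Lemma sqrt_quot_ge0 t : 0 <= t -> 0 <= sqrt_quot t.
Proof. by move=> t0; rewrite divr_ge0// N_function_ge0// sqrtr_ge0. Qed.

(** With l = sqrt t, the product 2 t G'(t) equals (l M'(l) - 2 M(l)) / t, where l M'(l) lies between
    0 and c M(l). *)
Lemma sqrt_quot'_bound t : 0 < t -> `|2 * t * sqrt_quot' t| <= (c + 2) * sqrt_quot t.
Proof.
move=> t0; have s0 : 0 < Num.sqrt t by rewrite sqrtr_gt0.
have [d0 dc] := N_function_derive_bounds s0.
have M0 := N_function_ge0 (ltW s0).
rewrite (_ : 2 * t * _ = (Num.sqrt t * derive1 M (Num.sqrt t) - 2 * M (Num.sqrt t)) / t); last first.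
  by rewrite /sqrt_quot'; field; rewrite gt_eqF.
rewrite /sqrt_quot mulrA normrM (gtr0_norm (_ : 0 < t^-1)) ?invr_gt0//.
rewrite ler_wpM2r ?invr_ge0 ?(ltW t0)//.
rewrite ler_norml; have := mulr_ge0 (ltW s0) d0.
have := mulr_ge0 c0 M0.
by move=> *; apply/andP; split; lra.
Qed.

(** Since M(l)/l^2 is nondecreasing, replacing the squared gradient by its regularization inside [G]
    can only increase the left side of the energy estimate. *)
Lemma N_function_le_sqrt_quot x t : 0 <= x -> x ^+ 2 <= t ->
  M x <= sqrt_quot t * x ^+ 2.
Proof.
rewrite le_eqVlt => /predU1P[<- _|x0 xt]; first by rewrite N_function0 expr0n mulr0.
have x20 : 0 < x ^+ 2 by rewrite exprn_gt0.
have t0 : 0 < t by exact: lt_le_trans xt.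
have xs : x <= Num.sqrt t.
  by rewrite -(@ler_pXn2r _ 2)// ?nnegrE ?sqrtr_ge0 ?(ltW x0)// sqr_sqrtr// ltW.
rewrite -ler_pdivrMr// (le_trans (N_function_quot_le x0 xs))// /sqrt_quot.
by rewrite sqr_sqrtr// ltW.
Qed.

End N_functions.

(** * Localization near a compact set *)

Section localization.
Context {R : realType} {n : nat}.
Notation lam := (@lebesgue_rV R n).
Implicit Types (Omega K U : set 'rV[R]_n) (phi : 'rV[R]_n -> R).

(** The open neighbourhood leaves room for small translates of points of [K]; the compact one, a sum
    of [K] and a closed ball, is where the local bounds on [phi] and its gradient are taken. *)
Lemma compact_nbhd K Omega : compact K -> K `<=` Omega -> open Omega ->
  exists U K', [/\ open U, compact K', K `<=` U, U `<=` K' & K' `<=` Omega].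
Proof.
move=> cK KO oO; have [d d0 dO] := compact_open_dist cK KO oO.
have d20 : 0 < d / 2 by rewrite divr_gt0.
exists (\bigcup_(y in K) ball y (d / 2)).
exists ((fun p : 'rV[R]_n * 'rV[R]_n => p.1 + p.2) @`
  (K `*` [set x : 'rV[R]_n | `|x| <= d / 2])).
split.
- by apply: bigcup_open => y _; exact: ball_open.
- apply: continuous_compact.
    apply: continuous_subspaceT => p; apply: cvgD; [exact: cvg_fst|exact: cvg_snd].
  by apply: compact_setX => //; exact: compact_norm_le.
- by move=> x Kx; exists x => //; exact: ballxx.
- move=> x [y Ky]; rewrite -ball_normE /= => yx.
  exists (y, x - y); last by rewrite /= addrC subrK.
  by split => //=; rewrite distrC ltW.
- move=> _ [[y z] [/= Ky zd] <-]; apply: (dO y) => //.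
  rewrite addrC addKr (le_lt_trans zd)// ltr_pdivrMr// ltr_pMr// ltr1n//.
Qed.

(* Truncation turns bounds that hold almost everywhere into pointwise ones. *)
Definition clamp (C y : R) : R := Num.max (- C) (Num.min C y).

Lemma clamp_bound C y : 0 <= C -> `|clamp C y| <= C.
Proof.
move=> C0; rewrite ler_norml /clamp le_max lexx/= ge_max ge_min lexx/= andbT.
by rewrite (le_trans _ C0)// oppr_le0.
Qed.

Lemma clamp_id C y : `|y| <= C -> clamp C y = y.
Proof. by rewrite ler_norml /clamp => /andP[h1 h2]; rewrite (min_idPr h2) (max_idPr h1). Qed.

Lemma measurable_clamp C (f : 'rV[R]_n -> R) : measurable_fun setT f ->
  measurable_fun setT (fun x => clamp C (f x)).
Proof.
by move=> mf; apply: measurable_maxr => //; exact: measurable_minr.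
Qed.

Lemma measurable_restrict_compact K Omega (f : 'rV[R]_n -> R) : open Omega -> compact K ->
  K `<=` Omega -> measurable_fun Omega f -> measurable_fun setT (f \_ K).
Proof.
move=> oO cK KO mf; apply/(measurable_restrictT f (compact_measurable_rV cK)).
by apply: measurable_funS mf => //; exact: open_measurable_rV.
Qed.

(** Outside compact sets nothing bounds [phi], and inside them the bounds hold almost everywhere
    only. Truncating on [K'] gives globally bounded measurable stand-ins [E] and [Gam], which agree
    with the weight and the weak derivatives almost everywhere on [K]. The weak identity persists on
    the open set [U] between [K] and [K']. *)
Lemma local_integration_by_parts Omega phi (dphi : 'rV[R]_n -> 'rV[R]_n) K :
  open Omega -> W1infty_loc Omega phi dphi -> compact K -> K `<=` Omega ->
  exists (E : 'rV[R]_n -> R) (Gam : 'I_n -> 'rV[R]_n -> R) (B : R),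
  [/\ measurable_fun setT E /\ (forall x, 0 <= E x <= B),
      forall i, measurable_fun setT (Gam i) /\ (forall x, `|Gam i x| <= B),
      {ae lam, forall x, K x -> expR (- phi x) = E x},
      forall i, {ae lam, forall x, K x -> dphi x ord0 i = Gam i x} &
      forall i w, continuous w -> C1_along i w -> (forall x, ~ K x -> w x = 0) ->
        \int[lam]_x (E x * pderiv i w x) = \int[lam]_x (w x * E x * Gam i x)].
Proof.
move=> oO [[mphi Lphi] Ldphi weak] cK KO.
have [U [K' [oU cK' KU UK' K'O]]] := compact_nbhd cK KO oO.
have [C0 hC0] := Lphi K' cK' K'O.
have /choice[C1 hC1] : forall i, exists C : R,
    {ae lam, forall x, K' x -> `|dphi x ord0 i| <= C}.
  by move=> i; have [_ /(_ K' cK' K'O)] := Ldphi i.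
pose C := `|C0| + \sum_i `|C1 i|.
have Cge0 : 0 <= C by rewrite addr_ge0// sumr_ge0.
have C0C : C0 <= C by rewrite (le_trans (ler_norm C0))// lerDl sumr_ge0.
have C1C i : C1 i <= C.
  rewrite (le_trans (ler_norm _))// /C (bigD1 i)//= addrCA lerDl addr_ge0//.
  by rewrite sumr_ge0.
pose Phi x := clamp C ((phi \_ K') x).
pose Gam i x := clamp C (((fun y => dphi y ord0 i) \_ K') x).
have mPhi : measurable_fun setT Phi.
  by apply: measurable_clamp; exact: (@measurable_restrict_compact _ Omega).
have mGam i : measurable_fun setT (Gam i).
  apply: measurable_clamp; apply: (@measurable_restrict_compact _ Omega) => //.
  by have [] := Ldphi i.
have PhiC x : `|Phi x| <= C by exact: clamp_bound.
have GamC i x : `|Gam i x| <= C by exact: clamp_bound.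
have c00 : clamp C 0 = 0 by rewrite clamp_id// normr0.
have Phi0' x : ~ K' x -> Phi x = 0 by move=> Kx; rewrite /Phi patchE memNset.
have Gam0' i x : ~ K' x -> Gam i x = 0 by move=> Kx; rewrite /Gam patchE memNset.
have [N KN] := compact_norm_supp cK'.
have aePhi : {ae lam, forall x, K' x -> phi x = Phi x}.
  apply: filterS hC0 => x h Kx; rewrite /Phi patchE mem_set// clamp_id//.
  exact: le_trans (h Kx) C0C.
have aeGam i : {ae lam, forall x, K' x -> dphi x ord0 i = Gam i x}.
  apply: filterS (hC1 i) => x h Kx; rewrite /Gam patchE mem_set// clamp_id//.
  exact: le_trans (h Kx) (C1C i).
have weak' i psi : Cc_smooth U psi ->
    \int[lam]_x (Phi x * pderiv i psi x) = - \int[lam]_x (Gam i x * psi x).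
  move=> [spsi cpsi psiU].
  have psi0 x : ~ K' x -> psi x = 0.
    move=> Kx; apply/eqP/negPn/negP => px; apply: Kx; apply: UK'; apply: psiU.
    exact: subset_closure.
  have cl : closed K' by apply: compact_closed => //; exact: norm_hausdorff.
  have dpsi0 := pderiv_supp i cl psi0.
  have Opsi : Cc_smooth Omega psi by split => // x /psiU /UK' /K'O.
  have mpsi := continuous_measurable_rV (Ck_continuous (spsi 0)).
  have mdpsi : measurable_fun setT (pderiv i psi).
    by apply: continuous_measurable_rV; have [_ /(_ i) []] := spsi 1.
  have mO := open_measurable_rV oO.
  (* The factor [h] vanishes off [K'], so an integral over [Omega] becomes one over the whole space
     with [f] replaced by its truncation. *)
  have conv (f g h : 'rV[R]_n -> R) : measurable_fun Omega f -> measurable_fun setT g ->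
      measurable_fun setT h -> (forall x, ~ K' x -> h x = 0) ->
      {ae lam, forall x, K' x -> f x = g x} ->
      (\int[lam]_(x in Omega) (f x * h x)%:E = \int[lam]_x (g x * h x)%:E)%E.
    move=> mf mg mh h0 fg; rewrite integral_mkcond.
    apply: ae_eq_integral => //.
    - apply/(measurable_restrictT _ mO); apply/measurable_EFinP.
      by apply: measurable_funM => //; exact: measurable_funTS.
    - by apply/measurable_EFinP; exact: measurable_funM.
    - apply: filterS fg => x fg _; rewrite patchE.
      have [Kx|Kx] := pselect (K' x).
        by rewrite mem_set ?fg//; exact: K'O.
      by rewrite h0// !mulr0; case: ifP.
  have := weak psi Opsi i.
  rewrite (conv phi Phi)//.
  rewrite (conv (fun x => dphi x ord0 i) (Gam i))//; last by have [] := Ldphi i.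
  by rewrite /Rintegral => ->; rewrite fineN.
exists (fun x => expR (- Phi x)), Gam, (expR C); split.
- split; first by apply: measurableT_comp; [exact: measurable_expR|exact: measurable_funN].
  move=> x; rewrite expR_ge0 ler_expR/= (le_trans (ler_norm _))// normrN//.
- move=> i; split => // x; rewrite (le_trans (GamC i x))//.
  by rewrite (le_trans _ (expR_ge1Dx C))// lerDr.
- by apply: filterS aePhi => x h Kx; rewrite h//; exact/UK'/KU.
- by move=> i; apply: filterS (aeGam i) => x h Kx; rewrite h//; exact/UK'/KU.
- move=> i w cw Cw w0.
  apply: (@weighted_integration_by_parts _ _ i Phi (Gam i) N C U _ _ _ _ _ _ _ K) => //.
  + by move=> x /KN; exact: Phi0'.
  + by move=> x /KN; exact: Gam0'.
  + exact: weak'.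
Qed.

(** The density describes [mu] only on subsets of [Omega], so the comparison with the weighted
    Lebesgue measure is made there, using the density extended by 0. *)
Lemma integral_density_on Omega (mu : {measure set 'rV[R]_n -> \bar R}) (f g : 'rV[R]_n -> R) :
  open Omega -> density_on Omega mu g -> measurable_fun Omega g -> (forall x, 0 <= g x) ->
  measurable_fun Omega f -> (forall x, 0 <= f x) ->
  (\int[mu]_(x in Omega) (f x)%:E = \int[lam]_(x in Omega) (f x * g x)%:E)%E.
Proof.
move=> oO dg mg g0 mf f0; have mO := open_measurable_rV oO.
have mG : measurable_fun setT (g \_ Omega) by exact/(measurable_restrictT _ mO).
have G0 x : 0 <= (g \_ Omega) x by rewrite patchE; case: ifP.
pose nu := weighted_measure lam mG G0.
have -> : (\int[mu]_(x in Omega) (f x)%:E = \int[nu]_(x in Omega) (f x)%:E)%E.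
  apply: eq_measure_integral => A mA AO; rewrite dg//.
  rewrite /= /weighted_measure; apply: eq_integral => x; rewrite inE => /AO Ox.
  by rewrite patchE mem_set.
rewrite integral_mkcond integral_weighted_measure.
- rewrite [RHS]integral_mkcond; apply: eq_integral => x _; rewrite !patchE.
  by case: ifP => //; rewrite mul0e.
- by apply/(measurable_restrictT _ mO); exact/measurable_EFinP.
- by move=> x; rewrite patchE; case: ifP => // _; rewrite lee_fin.
Qed.

End localization.

(** * The regularized gradient inequality *)

Section euclidean_norm.
Context {R : realType}.

Lemma enorm_ge0 m n (A : 'M[R]_(m, n)) : 0 <= enorm A.
Proof. exact: sqrtr_ge0. Qed.

Lemma enorm_sqr m n (A : 'M[R]_(m, n)) : enorm A ^+ 2 = \sum_i \sum_j A i j ^+ 2.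
Proof.
by rewrite sqr_sqrtr//; do 2 (apply: sumr_ge0 => ? _); exact: sqr_ge0.
Qed.

Lemma enorm_sqr_row n (v : 'rV[R]_n) : enorm v ^+ 2 = \sum_j v ord0 j ^+ 2.
Proof. by rewrite enorm_sqr big_ord_recl big_ord0 addr0. Qed.

Lemma coord_le_enorm m n (A : 'M[R]_(m, n)) i j : `|A i j| <= enorm A.
Proof.
rewrite -(@ler_pXn2r _ 2)// ?nnegrE ?enorm_ge0// real_normK ?num_real// enorm_sqr.
rewrite (bigD1 i)//= (bigD1 j)//= -addrA lerDl addr_ge0//.
  by apply: sumr_ge0 => ? _; exact: sqr_ge0.
by do 2 (apply: sumr_ge0 => ? _); exact: sqr_ge0.
Qed.

Lemma enorm_row_le_sum n (v : 'rV[R]_n) : enorm v <= \sum_j `|v ord0 j|.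
Proof.
have S0 : 0 <= \sum_j `|v ord0 j| by exact: sumr_ge0.
rewrite -(@ler_pXn2r _ 2)// ?nnegrE ?enorm_ge0// enorm_sqr_row expr2 mulr_suml.
apply: ler_sum => j _; rewrite -real_normK ?num_real// expr2 ler_wpM2l//.
by rewrite (bigD1 j)//= lerDl sumr_ge0.
Qed.

Lemma enormZ m n (t : R) (A : 'M[R]_(m, n)) : enorm (t *: A) = `|t| * enorm A.
Proof.
apply/eqP; rewrite -(@eqrXn2 _ 2)// ?enorm_ge0// ?mulr_ge0 ?enorm_ge0//.
rewrite exprMn real_normK ?num_real// !enorm_sqr mulr_sumr; apply/eqP.
apply: eq_bigr => i _; rewrite mulr_sumr; apply: eq_bigr => j _.
by rewrite mxE exprMn.
Qed.

Lemma continuous_sumr (T : topologicalType) (I : Type) (r : seq I) (f : I -> T -> R) :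
  (forall i, continuous (f i)) -> continuous (fun x => \sum_(i <- r) f i x).
Proof.
move=> cf x; elim: r => [|i r IH].
  by under eq_fun do rewrite big_nil; exact: cst_continuous.
by under eq_fun do rewrite big_cons; apply: continuousD; [exact: cf|exact: IH].
Qed.

Lemma continuous_enorm (T : topologicalType) m n (F : T -> 'M[R]_(m, n)) :
  (forall i j, continuous (fun x => F x i j)) -> continuous (fun x => enorm (F x)).
Proof.
move=> cF x; apply: (@continuous_comp _ _ _ (fun x => \sum_i \sum_j F x i j ^+ 2) Num.sqrt);
  last exact: sqrt_continuous.
apply: continuous_sumr => i; apply: continuous_sumr => j {}x;
  apply: (@continuous_comp _ _ _ (fun x => F x i j) (fun y => y ^+ 2));
  [exact: cF|exact: exprn_continuous].
Qed.

Lemma measurable_enorm d (T : measurableType d) (D : set T) m n (F : T -> 'M[R]_(m, n)) :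
  (forall i j, measurable_fun D (fun x => F x i j)) -> measurable_fun D (fun x => enorm (F x)).
Proof.
move=> mF.
have ms : measurable_fun [set: R] (@Num.sqrt R).
  by apply: continuous_measurable_fun; exact: sqrt_continuous.
apply: (measurableT_comp ms).
apply: measurable_sum => i; apply: measurable_sum => j.
exact: measurable_funX.
Qed.

End euclidean_norm.

Section test_functions.
Context {R : realType} {n : nat}.
Implicit Types (Omega : set 'rV[R]_n) (u : 'rV[R]_n -> R).

Lemma Cc_smooth_out Omega u x : Cc_smooth Omega u -> ~ closure [set x | u x != 0] x -> u x = 0.
Proof.
by move=> _ xu; apply/eqP/negPn/negP => ux; apply: xu; exact: subset_closure.
Qed.

Lemma Cc_smooth_sub Omega u v : Cc_smooth Omega u -> smooth v ->
  (forall x, ~ closure [set x | u x != 0] x -> v x = 0) -> Cc_smooth Omega v.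
Proof.
move=> [su cu uO] sv v0.
have sub : closure [set x | v x != 0] `<=` closure [set x | u x != 0].
  rewrite [X in X `<=` _]closureE; apply: smallest_sub; first exact: closed_closure.
  move=> x /= vx; apply: contrapT => /v0 vx0.
  by rewrite vx0 eqxx in vx.
split => //; last exact: subset_trans uO.
exact: (subclosed_compact (@closed_closure _ _) cu).
Qed.

Lemma Cc_smooth_pderiv Omega u i : Cc_smooth Omega u -> Cc_smooth Omega (pderiv i u).
Proof.
move=> Cu; have [su cu uO] := Cu; apply: (Cc_smooth_sub Cu).
  by move=> k; have [_ /(_ i) []] := su k.+1.
apply: pderiv_supp; first exact: closed_closure.
by move=> x; exact: Cc_smooth_out Cu.
Qed.

Lemma Cc_smooth_scale Omega u t : Cc_smooth Omega u -> Cc_smooth Omega (fun x => t * u x).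
Proof.
move=> Cu; have [su cu uO] := Cu; apply: (Cc_smooth_sub Cu).
  by move=> k; apply: CkM; [exact: Ck_cst|exact: su].
by move=> x /(Cc_smooth_out Cu) ->; rewrite mulr0.
Qed.

Lemma pderiv_scale u t i : (forall x, derivable u x (delta_mx ord0 i)) ->
  pderiv i (fun x => t * u x) = (fun x => t * pderiv i u x).
Proof.
move=> du; rewrite (pderivM (u := cst t)); [|by move=> x; exact: derivable_cst|exact: du].
by apply/funext => x /=; rewrite /pderiv derive_cst mulr0 addr0.
Qed.

Lemma smooth_derivable u i x : smooth u -> derivable u x (delta_mx ord0 i).
Proof. by move=> su; have [_ /(_ i) []] := su 1. Qed.

Lemma smooth_pderiv u i : smooth u -> smooth (pderiv i u).
Proof. by move=> su k; have [_ /(_ i) []] := su k.+1. Qed.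

Lemma smooth_continuous u : smooth u -> continuous u.
Proof. by move=> su; exact: (su 0). Qed.

Lemma continuous_enorm_grad u : smooth u -> continuous (fun x => enorm (grad u x)).
Proof.
move=> su; apply: continuous_enorm => i j.
rewrite (_ : (fun x => _) = pderiv j u); last by apply/funext => x; rewrite mxE.
exact/smooth_continuous/smooth_pderiv.
Qed.

Lemma continuous_enorm_hess u : smooth u -> continuous (fun x => enorm (hess u x)).
Proof.
move=> su; apply: continuous_enorm => i j.
rewrite (_ : (fun x => _) = pderiv i (pderiv j u)); last by apply/funext => x; rewrite mxE.
exact/smooth_continuous/smooth_pderiv/smooth_pderiv.
Qed.

Lemma grad_scale u t x : smooth u -> grad (fun x => t * u x) x = t *: grad u x.
Proof.
move=> su; apply/rowP => j; rewrite !mxE pderiv_scale// => y; exact: smooth_derivable.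
Qed.

Lemma hess_scale u t x : smooth u -> hess (fun x => t * u x) x = t *: hess u x.
Proof.
move=> su; apply/matrixP => i j; rewrite !mxE.
rewrite pderiv_scale; last by move=> y; exact: smooth_derivable.
by rewrite pderiv_scale// => y; apply: smooth_derivable; exact: smooth_pderiv.
Qed.

(** The gradient of [pderiv i u] is the [i]-th column of [hess u]. *)
Lemma enorm_grad_pderiv_le u i x : enorm (grad (pderiv i u) x) <= enorm (hess u x).
Proof.
rewrite -(@ler_pXn2r _ 2)// ?nnegrE ?enorm_ge0// enorm_sqr_row enorm_sqr.
apply: ler_sum => j _; rewrite mxE (bigD1 i)//= mxE lerDl.
by apply: sumr_ge0 => k _; exact: sqr_ge0.
Qed.

End test_functions.

Section regularized_field.
Context {R : realType} {n : nat}.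
Variables (M : R -> R) (c : R).
Hypotheses (NM : N_function M) (CM : C1_pos M).
Hypothesis MD : forall x, 0 < x -> M (2 * x) <= c * M x.
Hypothesis Mmono : {in `]0, +oo[ &, {homo (fun l : R => M l / l ^+ 2) : x y / x <= y}}.
Hypothesis c1 : 1 <= c.
Variables (u : 'rV[R]_n -> R) (eps : R).
Hypotheses (su : smooth u) (eps0 : 0 < eps).
Local Notation e i := (delta_mx ord0 i : 'rV[R]_n).
Local Notation G := (sqrt_quot M).

Definition grad_sqr_reg (x : 'rV[R]_n) : R := enorm (grad u x) ^+ 2 + eps ^+ 2.
Local Notation T := grad_sqr_reg.

Lemma grad_sqr_regE : T = (fun x => \sum_j (pderiv j u x * pderiv j u x)) \+ cst (eps ^+ 2).
Proof.
apply/funext => x; rewrite /T enorm_sqr_row /=; congr (_ + _).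
by apply: eq_bigr => j _; rewrite mxE expr2.
Qed.

Lemma grad_sqr_reg_gt0 x : 0 < T x.
Proof. by rewrite /T ltr_wpDl ?sqr_ge0// exprn_gt0. Qed.

Lemma grad_sqr_le_reg x : enorm (grad u x) ^+ 2 <= T x.
Proof. by rewrite /T lerDl sqr_ge0. Qed.

Lemma C1_grad_sqr_reg : Ck 1 T.
Proof.
rewrite grad_sqr_regE; apply: CkD; last exact: Ck_cst.
by apply: Ck_sum => j; apply: CkM; exact: smooth_pderiv.
Qed.

Lemma pderiv_grad_sqr_reg i x :
  pderiv i T x = \sum_j 2 * (pderiv j u x * pderiv i (pderiv j u) x).
Proof.
have D j : is_derive x (e i) (pderiv j u \* pderiv j u)
    (2 * (pderiv j u x * pderiv i (pderiv j u) x)).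
  have du : is_derive x (e i) (pderiv j u) (pderiv i (pderiv j u) x).
    by apply: derivableP; apply: smooth_derivable; exact: smooth_pderiv.
  have := is_deriveM du du; rewrite /GRing.scale/=.
  rewrite (_ : _ + _ = 2 * (pderiv j u x * pderiv i (pderiv j u) x))//.
  by ring.
have DS := is_derive_sum D.
rewrite grad_sqr_regE /pderiv.
have dC : is_derive x (e i) (cst (eps ^+ 2) : 'rV[R]_n -> R) 0 by exact: is_derive_cst.
have := is_deriveD DS dC; rewrite addr0 => H.
rewrite -[RHS](@derive_val _ _ _ _ _ _ _ H); congr ('D_ _ _ x).
by apply/funext => y /=; rewrite fctE fct_sumE.
Qed.

Lemma pderiv_grad_sqr_reg_bound i x :
  `|pderiv i T x| <= 2 * n%:R * enorm (grad u x) * enorm (hess u x).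
Proof.
rewrite pderiv_grad_sqr_reg (le_trans (ler_norm_sum _ _ _))//.
apply: (@le_trans _ _ (\sum_(j < n) 2 * (enorm (grad u x) * enorm (hess u x)))).
  apply: ler_sum => j _; rewrite normrM ger0_norm// ler_pM2l// normrM ler_pM//.
    by have := coord_le_enorm (grad u x) ord0 j; rewrite mxE.
  by have := coord_le_enorm (hess u x) i j; rewrite mxE.
by rewrite sumr_const card_ord -mulr_natr le_eqVlt; apply/orP; left; apply/eqP; ring.
Qed.

(* eps keeps G(T) of class C^1 at the critical points of u. *)
Definition reg_field i : 'rV[R]_n -> R := (G \o T) \* pderiv i u.

Let compT : Ck 1 (G \o T) /\
  forall i x, pderiv i (G \o T) x = derive1 G (T x) * pderiv i T x.
Proof.
apply: C1_comp; first exact: C1_grad_sqr_reg.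
- by move=> x; case: (is_derive_sqrt_quot CM (grad_sqr_reg_gt0 x)).
- by move=> x; apply: continuous_sqrt_quot' => //; exact: grad_sqr_reg_gt0.
Qed.

Lemma C1_reg_field i : Ck 1 (reg_field i).
Proof. by apply: CkM; [exact: compT.1|exact: smooth_pderiv]. Qed.

Lemma C1_reg_weight : Ck 1 (G \o T).
Proof. exact: compT.1. Qed.

(** The product rule gives G(T) times a second derivative, which accounts for the 1, plus G'(T)
    times derivatives of T and u. The latter is at most n (2 |grad u|^2 |G'(T)|) |hess u|, and |grad
    u|^2 <= T brings in the bound (c + 2) G(T) on 2 T |G'(T)|. *)
Lemma pderiv_reg_field_bound i x :
  `|pderiv i (reg_field i) x| <= ((c + 2) * n%:R + 1) * G (T x) * enorm (hess u x).
Proof.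
have T0 := grad_sqr_reg_gt0 x; have G0 := sqrt_quot_ge0 NM (ltW T0).
have hii : `|pderiv i (pderiv i u) x| <= enorm (hess u x).
  by have := coord_le_enorm (hess u x) i i; rewrite mxE.
have pi : `|pderiv i u x| <= enorm (grad u x).
  by have := coord_le_enorm (grad u x) ord0 i; rewrite mxE.
have h0 := enorm_ge0 (hess u x); have p0 := enorm_ge0 (grad u x).
rewrite /reg_field pderivM; last 2 first.
- by have [_ /(_ i) []] := compT.1.
- by move=> y; apply: smooth_derivable; exact: smooth_pderiv.
rewrite /= compT.2 (le_trans (ler_normD _ _))// mulrDl mulrDl addrC lerD//; last first.
  by rewrite mul1r normrM ger0_norm// ler_wpM2l.
have dG : derive1 G (T x) = sqrt_quot' M (T x).
  by rewrite derive1E; case: (is_derive_sqrt_quot CM T0).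
rewrite dG; set g' := sqrt_quot' M (T x).
have gb : 2 * T x * `|g'| <= (c + 2) * G (T x).
  have := sqrt_quot'_bound NM CM MD Mmono c1 T0.
  by rewrite normrM (gtr0_norm (_ : 0 < 2 * T x)) ?mulr_gt0.
move: g' gb => g' gb {dG}; rewrite !normrM.
apply: (@le_trans _ _ (enorm (grad u x) * (`|g'| * (2 * n%:R * enorm (grad u x) * enorm (hess u x))))).
  by rewrite ler_pM// ?mulr_ge0// ler_wpM2l// ?pderiv_grad_sqr_reg_bound.
rewrite (_ : _ * _ = (2 * enorm (grad u x) ^+ 2 * `|g'|) * (n%:R * enorm (hess u x))); last by ring.
rewrite (_ : _ * _ * enorm _ = ((c + 2) * G (T x)) * (n%:R * enorm (hess u x))); last by ring.
rewrite ler_wpM2r ?mulr_ge0// (le_trans _ gb)// ler_wpM2r// ler_pM2l//.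
exact: grad_sqr_le_reg.
Qed.

End regularized_field.

Lemma continuous_mulr (R : realType) (T : topologicalType) (f g : T -> R) :
  continuous f -> continuous g -> continuous (fun x => f x * g x).
Proof. by move=> cf cg x; exact: (continuousM (cf x) (cg x)). Qed.

Section finite_sums.
Context d (T : measurableType d) (R : realType) (mu : {measure set T -> \bar R}).
Variables (D : set T) (mD : measurable D).

Lemma integrable_sumr (I : Type) (r : seq I) (f : I -> T -> R) :
  (forall i, mu.-integrable D (EFin \o f i)) ->
  mu.-integrable D (EFin \o (fun x => \sum_(i <- r) f i x)).
Proof.
move=> If; rewrite (_ : EFin \o _ = fun x => (\sum_(j <- r) (EFin \o f j) x)%E).
  exact: integrable_sum.
by apply/funext => x /=; rewrite sumEFin.
Qed.

Lemma Rintegral_sumr (I : Type) (r : seq I) (f : I -> T -> R) :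
  (forall i, mu.-integrable D (EFin \o f i)) ->
  \int[mu]_(x in D) (\sum_(i <- r) f i x) = \sum_(i <- r) \int[mu]_(x in D) f i x.
Proof.
move=> If; elim: r => [|i r IH].
  rewrite big_nil; under eq_Rintegral do rewrite big_nil.
  by rewrite Rintegral_cst// mul0r.
rewrite big_cons -IH -RintegralD//; last exact: integrable_sumr.
by apply: eq_Rintegral => x _; rewrite big_cons.
Qed.

End finite_sums.

Section regularized_inequality.
Context {R : realType} {n : nat}.
Notation lam := (@lebesgue_rV R n).

(** Exchanges an integrand built from [phi] and [dphi] on [Omega] for its globally measurable
    stand-in. *)
Lemma integral_lebesgue_local (Omega K : set 'rV[R]_n) (F F' : 'rV[R]_n -> R) :
  open Omega -> measurable_fun Omega F -> measurable_fun setT F' -> K `<=` Omega ->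
  {ae lam, forall x, K x -> F x = F' x} ->
  (forall x, ~ K x -> F x = 0) -> (forall x, ~ K x -> F' x = 0) ->
  (\int[lam]_(x in Omega) (F x)%:E = \int[lam]_x (F' x)%:E)%E.
Proof.
move=> oO mF mF' KO FF' F0 F'0; have mO := open_measurable_rV oO.
rewrite integral_mkcond; apply: ae_eq_integral => //.
- by apply/(measurable_restrictT _ mO); exact/measurable_EFinP.
- exact/measurable_EFinP.
- apply: filterS FF' => x FFx _; rewrite patchE.
  have [Kx|Kx] := pselect (K x); first by rewrite mem_set ?FFx//; exact: KO.
  by rewrite F0// F'0//; case: ifP.
Qed.

Variables (Omega : set 'rV[R]_n) (mu : {measure set 'rV[R]_n -> \bar R}).
Variables (phi : 'rV[R]_n -> R) (dphi : 'rV[R]_n -> 'rV[R]_n).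
Hypotheses (oO : open Omega) (Wphi : W1infty_loc Omega phi dphi).
Hypothesis dens : density_on Omega mu (fun x => expR (- phi x)).
Variables (M : R -> R) (c : R).
Hypotheses (NM : N_function M) (CM : C1_pos M).
Hypothesis MD : forall x, 0 < x -> M (2 * x) <= c * M x.
Hypothesis Mmono : {in `]0, +oo[ &, {homo (fun l : R => M l / l ^+ 2) : x y / x <= y}}.
Hypothesis c1 : 1 <= c.
Local Notation G := (sqrt_quot M).

Lemma measurable_expRN_phi : measurable_fun Omega (fun x => expR (- phi x)).
Proof.
have [[mphi _] _ _] := Wphi.
by apply: measurableT_comp; [exact: measurable_expR|exact: measurable_funN].
Qed.

Lemma measurable_enorm_dphi : measurable_fun Omega (fun x => enorm (dphi x)).
Proof.
have [_ mdphi _] := Wphi.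
by apply: measurable_enorm => i j; rewrite ord1; have [] := mdphi j.
Qed.

(** The left integrand is the sum over [i] of [V i * pderiv i u], where [V i] is the regularized
    field. Integrating [u * V i] by parts leaves [u] times the derivative of [V i], and [u * V i]
    times the weak derivative of [phi]. *)
Lemma regularized_gradient_le (u : 'rV[R]_n -> R) (eps : R) :
  Cc_smooth Omega u -> 0 < eps ->
  (\int[mu]_(x in Omega) (G (grad_sqr_reg u eps x) * enorm (grad u x) ^+ 2)%:E <=
   \int[mu]_(x in Omega) (n%:R * (G (grad_sqr_reg u eps x) * `|u x| *
      (((c + 2) * n%:R + 1) * enorm (hess u x) + enorm (grad u x) * enorm (dphi x))))%:E)%E.
Proof.
move=> Cu eps0; have [su cK KO] := Cu; set K := closure _ in cK KO.
have u0 x : ~ K x -> u x = 0 by exact: Cc_smooth_out Cu.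
have clK : closed K by exact: closed_closure.
have du0 i := pderiv_supp i clK u0.
have gu0 x : ~ K x -> enorm (grad u x) = 0.
  move=> Kx; apply/eqP; rewrite -sqrf_eq0 enorm_sqr_row big1// => j _.
  by rewrite mxE du0// expr0n.
set T := grad_sqr_reg u eps; pose A := (c + 2) * n%:R + 1.
have A0 : 0 <= A by rewrite addr_ge0// mulr_ge0// addr_ge0// (le_trans _ c1).
have [E [Gam [B [[mE EB] mGam aeE aeGam ibp]]]] := local_integration_by_parts oO Wphi cK KO.
have B0 : 0 <= B by have /andP[] := EB 0; exact: le_trans.
have E0 x : 0 <= E x by have /andP[] := EB x.
have EB' x : `|E x| <= B by rewrite ger0_norm//; have /andP[] := EB x.
have cu := smooth_continuous su.
have cT : continuous (G \o T) := Ck_continuous (C1_reg_weight CM su eps0).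
have G0 x : 0 <= G (T x) by apply: sqrt_quot_ge0 => //; exact/ltW/grad_sqr_reg_gt0.
have cg := continuous_enorm_grad su; have ch := continuous_enorm_hess su.
have cabs : continuous (fun x => `|u x|).
  by move=> x; apply: (continuous_comp (cu x)); exact: norm_continuous.
have mdK := compact_measurable_rV cK; have lK := compact_lebesgue_rV_lty cK.
have Int (f h : 'rV[R]_n -> R) (Q : R) : continuous f -> (forall x, ~ K x -> f x = 0) ->
    measurable_fun setT h -> (forall x, `|h x| <= Q) ->
    lam.-integrable setT (EFin \o (fun x => f x * h x)).
  move=> cf f0 mh hQ; have [W W0 fW] := compact_supp_bounded cK cf f0.
  apply: (@integrable_bounded_supp _ _ _ _ K _ (W * Q)) => //.
  - by apply: measurable_funM => //; exact: continuous_measurable_rV.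
  - by move=> x; rewrite normrM ler_pM.
  - by move=> x /f0 ->; rewrite mul0r.
(* Bounded measurable stand-in for [dphi], equal to it almost everywhere on [K]. *)
pose Gv x : 'rV[R]_n := \row_i Gam i x.
pose f1 x := G (T x) * enorm (grad u x) ^+ 2.
pose b x := G (T x) * `|u x| * (A * enorm (hess u x)).
pose b' x := G (T x) * `|u x| * enorm (grad u x).
have cf1 : continuous f1.
  apply: continuous_mulr; first exact: cT.
  rewrite (_ : (fun x => _ ^+ 2) = fun x => enorm (grad u x) * enorm (grad u x)).
    exact: continuous_mulr.
  by apply/funext => x; rewrite expr2.
have cGu : continuous (fun x : 'rV[R]_n => G (T x) * `|u x|) by exact: continuous_mulr.
have cb : continuous b.
  apply: continuous_mulr => //; apply: (continuous_mulr (f := fun=> A)) => // x; exact: cst_continuous.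
have cb' : continuous b' by exact: continuous_mulr.
have b0 x : ~ K x -> b x = 0 by move=> Kx; rewrite /b u0// normr0 mulr0 mul0r.
have b'0 x : ~ K x -> b' x = 0 by move=> Kx; rewrite /b' u0// normr0 mulr0 mul0r.
have f10 x : ~ K x -> f1 x = 0 by move=> Kx; rewrite /f1 gu0// expr0n mulr0.
have mGv : measurable_fun setT (fun x => enorm (Gv x)).
  apply: measurable_enorm => i j; under eq_fun do rewrite mxE.
  by have [] := mGam j.
have GvB x : enorm (Gv x) <= n%:R * B.
  rewrite (le_trans (enorm_row_le_sum _))//.
  apply: (@le_trans _ _ (\sum_(j < n) B)); last by rewrite ?/f2 sumr_const card_ord ?mulr_natl.
  by apply: ler_sum => j _; rewrite mxE; have [_] := mGam j.
have GvB' x : `|enorm (Gv x) * E x| <= n%:R * B * B.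
  by rewrite normrM ler_pM// ger0_norm ?enorm_ge0.
have mGE : measurable_fun setT (fun x => enorm (Gv x) * E x) by exact: measurable_funM.
pose f2 x := n%:R * (b x * E x + b' x * (enorm (Gv x) * E x)).
have Ib : lam.-integrable setT (EFin \o (fun x => b x * E x)) by exact: (Int b E B).
have Ib' : lam.-integrable setT (EFin \o (fun x => b' x * (enorm (Gv x) * E x))).
  exact: (Int b' _ (n%:R * B * B)).
have Ibb : lam.-integrable setT
    (EFin \o (fun x => b x * E x + b' x * (enorm (Gv x) * E x))).
  exact: (integrableD _ Ib Ib').
have mf2 : measurable_fun setT f2.
  by apply: measurable_funM => //; apply/measurable_EFinP; exact: measurable_int Ibb.
have lhsE : (\int[mu]_(x in Omega) (f1 x)%:E = \int[lam]_x (f1 x * E x)%:E)%E.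
  rewrite (integral_density_on oO dens measurable_expRN_phi)//; last 2 first.
  - by apply: measurable_funTS; exact: continuous_measurable_rV.
  - by move=> x; rewrite mulr_ge0// sqr_ge0.
  apply: (integral_lebesgue_local (K := K)) => //.
  - apply: measurable_funM; last exact: measurable_expRN_phi.
    by apply: measurable_funTS; exact: continuous_measurable_rV.
  - by apply: measurable_funM => //; exact: continuous_measurable_rV.
  - by apply: filterS aeE => x Ex Kx; rewrite Ex.
  - by move=> x Kx; rewrite f10// mul0r.
  - by move=> x Kx; rewrite f10// mul0r.
have rhsE : (\int[mu]_(x in Omega) (n%:R * (G (T x) * `|u x| *
      (A * enorm (hess u x) + enorm (grad u x) * enorm (dphi x))))%:E =
    \int[lam]_x (f2 x)%:E)%E.
  have mr : measurable_fun Omega (fun x => n%:R * (G (T x) * `|u x| *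
      (A * enorm (hess u x) + enorm (grad u x) * enorm (dphi x)))).
    apply: measurable_funM => //; apply: measurable_funM.
      by apply: measurable_funTS; exact: continuous_measurable_rV.
    apply: measurable_funD.
      apply: measurable_funM => //.
      by apply: measurable_funTS; exact: continuous_measurable_rV.
    apply: measurable_funM; last exact: measurable_enorm_dphi.
    by apply: measurable_funTS; exact: continuous_measurable_rV.
  rewrite (integral_density_on oO dens measurable_expRN_phi)//; last first.
    move=> x; rewrite mulr_ge0//; apply: mulr_ge0; first exact: mulr_ge0.
    by apply: addr_ge0; apply: mulr_ge0 => //; exact: enorm_ge0.
  apply: (integral_lebesgue_local (K := K)) => //.
  - by apply: measurable_funM => //; exact: measurable_expRN_phi.
  - have aeG : {ae lam, forall x, K x -> forall i, dphi x ord0 i = Gam i x}.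
      have : {ae lam, forall x, forall i : 'I_n, K x -> dphi x ord0 i = Gam i x}.
        exact: filter_forall.
      by apply: filterS => x H Kx i; exact: H.
    apply: filterS2 aeE aeG => x Ex Gx Kx; rewrite Ex// /f2 /b /b'.
    have -> : dphi x = Gv x by apply/rowP => j; rewrite mxE Gx.
    by ring.
  - by move=> x Kx; rewrite u0// normr0 mulr0 mul0r mulr0 mul0r.
  - by move=> x Kx; rewrite /f2 b0// b'0// !mul0r addr0 mulr0.
rewrite -/T -/A lhsE rhsE.
have If1 : lam.-integrable setT (EFin \o (fun x => f1 x * E x)) by exact: (Int f1 E B).
have If2 : lam.-integrable setT (EFin \o f2) by exact: (integrableZl _ _ Ibb).
suff : \int[lam]_x (f1 x * E x) <= \int[lam]_x (f2 x).
  rewrite -lee_fin /Rintegral !fineK//; exact: integrable_fin_num.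
pose V i := reg_field M u eps i.
have C1V i : Ck 1 (V i) by exact: C1_reg_field.
have cV i : continuous (V i) by exact: Ck_continuous (C1V i).
have cdV i : continuous (pderiv i (V i)) by have [_ /(_ i) []] := C1V i.
have dV i x : derivable (V i) x (delta_mx ord0 i) by have [_ /(_ i) []] := C1V i.
have cdu i : continuous (pderiv i u) by exact/smooth_continuous/smooth_pderiv.
have V0 i x : ~ K x -> V i x = 0 by move=> Kx; rewrite /V /reg_field /= du0// mulr0.
have cuV i : continuous (fun x : 'rV[R]_n => u x * V i x) by exact: continuous_mulr.
have cuDV i : continuous (fun x : 'rV[R]_n => u x * pderiv i (V i) x) by exact: continuous_mulr.
have mEG i : measurable_fun setT (fun x => E x * Gam i x).
  by apply: measurable_funM => //; have [] := mGam i.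
have EGB i x : `|E x * Gam i x| <= B * B.
  by rewrite normrM ler_pM//; have [_] := mGam i.
have Ip i : lam.-integrable setT (EFin \o (fun x => V i x * pderiv i u x * E x)).
  apply: (Int _ E B) => //; last by move=> x Kx; rewrite V0// mul0r.
  exact: continuous_mulr.
have Iq i : lam.-integrable setT (EFin \o (fun x => u x * pderiv i (V i) x * E x)).
  by apply: (Int _ E B) => // x Kx; rewrite u0// mul0r.
have Ir i : lam.-integrable setT (EFin \o (fun x => u x * V i x * (E x * Gam i x))).
  by apply: (Int _ _ (B * B)) => // x Kx; rewrite u0// mul0r.
have Irq i : lam.-integrable setT (EFin \o (fun x =>
    u x * V i x * (E x * Gam i x) - u x * pderiv i (V i) x * E x)).
  exact: (integrableB _ (Ir i) (Iq i)).
(* The integration by parts formula for the C^1 function [u * V i], which vanishes off [K], after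
   expanding its derivative. *)
have pE i : \int[lam]_x (V i x * pderiv i u x * E x) =
    \int[lam]_x (u x * V i x * (E x * Gam i x) - u x * pderiv i (V i) x * E x).
  rewrite RintegralB//; apply/eqP; rewrite eq_sym subr_eq eq_sym -RintegralD//; apply/eqP.
  have C1uV : Ck 1 (u \* V i) by apply: CkM; [exact: su|exact: C1V].
  have := ibp i (u \* V i) (cuV i) _ _.
  rewrite pderivM; [|by have [_ /(_ i) []] := su 1%N|exact: dV].
  move=> H; transitivity (\int[lam]_x (E x * ((u \* pderiv i (V i)) \+ (V i \* pderiv i u)) x)).
    by apply: eq_Rintegral => x _ /=; ring.
  rewrite H; first by apply: eq_Rintegral => x _ /=; rewrite mulrA.
    by have [_ /(_ i) []] := C1uV.
  by move=> x Kx /=; rewrite u0// mul0r.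
rewrite (@eq_Rintegral _ _ _ lam setT (fun x => \sum_i (V i x * pderiv i u x * E x))); last first.
  move=> x _; rewrite /f1 enorm_sqr_row mulr_sumr mulr_suml; apply: eq_bigr => j _.
  by rewrite /V /reg_field /= mxE expr2 mulrA.
rewrite Rintegral_sumr// (eq_bigr _ (fun i _ => pE i)) -Rintegral_sumr//.
apply: le_Rintegral => //.
  exact: integrable_sumr.
(* All indices admit the same bound, hence the factor [n] in [f2]. *)
move=> x _; apply: (@le_trans _ _ (\sum_(i < n) (b x * E x + b' x * (enorm (Gv x) * E x)))); last first.
  by rewrite ?/f2 sumr_const card_ord ?mulr_natl.
apply: ler_sum => i _; rewrite addrC lerD//.
  rewrite -mulNr ler_wpM2r// (le_trans (ler_norm _))// normrN normrM.
  have -> : b x = `|u x| * (A * G (T x) * enorm (hess u x)) by rewrite /b; ring.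
  apply: ler_wpM2l => //.
  exact: (pderiv_reg_field_bound NM CM MD Mmono c1 su eps0 i x).
rewrite (le_trans (ler_norm _))// 2!normrM [`|E x * _|]normrM (ger0_norm (E0 x)) [E x * _]mulrC.
apply: ler_pM => //; first by rewrite mulr_ge0.
  have -> : b' x = `|u x| * (G (T x) * enorm (grad u x)) by rewrite /b'; ring.
  apply: ler_wpM2l => //.
  have -> : V i x = G (T x) * pderiv i u x by [].
  rewrite normrM (ger0_norm (G0 x)); apply: ler_wpM2l => //.
  by have := coord_le_enorm (grad u x) ord0 i; rewrite mxE.
rewrite ler_wpM2r//.
by have := coord_le_enorm (Gv x) ord0 i; rewrite mxE.
Qed.

End regularized_inequality.

Section pointwise_estimates.
Context {R : realType}.
Variables (M : R -> R) (c : R).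
Hypotheses (NM : N_function M).
Hypothesis MD : forall x, 0 < x -> M (2 * x) <= c * M x.
Hypothesis Mmono : {in `]0, +oo[ &, {homo (fun l : R => M l / l ^+ 2) : x y / x <= y}}.
Hypothesis c1 : 1 <= c.

(** [M] is continuous within the half-line only; composing with the absolute value gives a function
    continuous on the whole line, to which measurability and composition lemmas apply. *)
Lemma continuous_N_function_norm : continuous (fun x : R => M `|x|).
Proof.
move=> x; have [/subspace_continuousP cM _ _ _ _] := NM.
have x0 : (`[0, +oo[%classic : set R) `|x| by rewrite /= in_itv /= normr_ge0.
apply: (cvg_comp (fun y : R => `|y|) M _ (cM _ x0)) => P wP.
have H : nbhs x (fun y : R => (`[0, +oo[%classic : set R) `|y| -> P `|y|) :=
  @norm_continuous R R^o x _ wP.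
suff : nbhs x (fun y : R => P `|y|) by [].
apply: filterS H => y; apply.
by rewrite /= in_itv /= normr_ge0.
Qed.

(** The products are rewritten as (A w / theta) (theta h) and (w / (delta theta)) (d delta theta g).
    Each is split by a b <= (a^2 + b^2) / 2, then by the Young inequality at l = sqrt T, where sqrt
    T <= g + eps. Two products account for the factor 2 in front of [eta]. *)
Lemma sqrt_quot_young (eta Ce A CA Cd g eps theta delta w h d : R) :
  0 <= A -> 0 <= eta -> 0 <= Ce ->
  (forall l a, 0 < l -> 0 <= a -> M l / l ^+ 2 * a ^+ 2 <= eta * M l + Ce * M a) ->
  (forall x, 0 <= x -> M (A * x) <= CA * M x) ->
  (forall x, 0 <= x -> M (delta^-1 * x) <= Cd * M x) ->
  0 < theta -> 0 < delta -> 0 < eps -> 0 <= g -> 0 <= w -> 0 <= h -> 0 <= d ->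
  sqrt_quot M (g ^+ 2 + eps ^+ 2) * w * (A * h + g * d) <=
  2 * eta * c * (M g + M eps) +
  Ce / 2 * ((CA + Cd) * M (w / theta) + M (theta * h) + M (d * (delta * theta * g))).
Proof.
move=> A0 eta0 Ce0 young HCA HCd theta0 delta0 eps0 g0 w0 h0 d0.
set T := g ^+ 2 + eps ^+ 2.
have T0 : 0 < T by rewrite ltr_wpDl ?sqr_ge0// exprn_gt0.
have l0 : 0 < Num.sqrt T by rewrite sqrtr_gt0.
have Tle : M (Num.sqrt T) <= c * (M g + M eps).
  apply: (le_trans _ (N_function_add NM MD Mmono c1 g0 (ltW eps0))).
  apply: (N_function_le NM Mmono (ltW l0)).
  have ge0 : 0 <= g + eps by rewrite addr_ge0// ltW.
  rewrite -[leRHS]ger0_norm// -sqrtr_sqr ler_wsqrtr// /T sqrrD lerD2r lerDl.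
  by rewrite mulrn_wge0// mulr_ge0// ltW.
have half a b : 0 <= a -> 0 <= b -> sqrt_quot M T * (a * b) <=
    eta * M (Num.sqrt T) + Ce / 2 * (M a + M b).
  move=> a0 b0; have := young _ _ l0 a0; have := young _ _ l0 b0.
  rewrite sqr_sqrtr ?(ltW T0)// -/(sqrt_quot M T) => Hb Ha.
  have ab : a * b <= (a ^+ 2 + b ^+ 2) / 2 by have := sqr_ge0 (a - b); lra.
  have := ler_wpM2l (sqrt_quot_ge0 NM (ltW T0)) ab.
  lra.
have w1 : 0 <= w / theta by rewrite divr_ge0// ltW.
have H1 := half _ _ (mulr_ge0 A0 w1) (mulr_ge0 (ltW theta0) h0).
have dw : 0 <= delta^-1 * (w / theta) by rewrite mulr_ge0// invr_ge0 ltW.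
have dg : 0 <= d * (delta * theta * g) by rewrite !mulr_ge0// ltW.
have H2 := half _ _ dw dg.
have E1 : A * (w / theta) * (theta * h) = w * (A * h).
  by field; rewrite gt_eqF.
have E2 : delta^-1 * (w / theta) * (d * (delta * theta * g)) = w * (g * d).
  by field; rewrite !gt_eqF.
rewrite E1 in H1; rewrite E2 in H2.
have H3 := ler_wpM2l Ce0 (HCA _ w1); have H4 := ler_wpM2l Ce0 (HCd _ w1).
have H5 := ler_wpM2l eta0 Tle.
have -> : sqrt_quot M T * w * (A * h + g * d) =
  sqrt_quot M T * (w * (A * h)) + sqrt_quot M T * (w * (g * d)) by ring.
lra.
Qed.

End pointwise_estimates.

(** * Modular and norm inequalities *)

Section gradient_modular.
Context {R : realType} {n : nat}.
Variables (Omega : set 'rV[R]_n) (mu : {measure set 'rV[R]_n -> \bar R}).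
Variables (phi : 'rV[R]_n -> R) (dphi : 'rV[R]_n -> 'rV[R]_n).
Hypotheses (oO : open Omega) (Wphi : W1infty_loc Omega phi dphi).
Hypothesis dens : density_on Omega mu (fun x => expR (- phi x)).
Hypothesis radon : radon_on Omega mu.
Variables (M : R -> R) (c : R).
Hypotheses (NM : N_function M) (CM : C1_pos M).
Hypothesis MD : forall x, 0 < x -> M (2 * x) <= c * M x.
Hypothesis Mmono : {in `]0, +oo[ &, {homo (fun l : R => M l / l ^+ 2) : x y / x <= y}}.
Hypothesis c1 : 1 <= c.
Local Notation J f := (\int[mu]_(x in Omega) f x).
Local Notation I f := (mu.-integrable Omega (EFin \o f)).

Let mO : measurable Omega := open_measurable_rV oO.

Lemma integrable_compact_supp (K : set 'rV[R]_n) (f : 'rV[R]_n -> R) :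
  compact K -> K `<=` Omega -> continuous f -> (forall x, ~ K x -> f x = 0) -> I f.
Proof.
move=> cK KO cf f0; have [C C0 fC] := compact_supp_bounded cK cf f0.
apply: (@integrableS _ _ _ mu setT Omega) => //.
exact: integrable_bounded_supp (compact_measurable_rV cK) (radon.1 K cK KO)
  (continuous_measurable_rV cf) fC f0.
Qed.

Lemma integrable_modular u (f : 'rV[R]_n -> R) : Cc_smooth Omega u -> continuous f ->
  (forall x, 0 <= f x) -> (forall x, ~ closure [set x | u x != 0] x -> f x = 0) ->
  I (fun x => M (f x)).
Proof.
move=> [su cK KO] cf f0 fK.
rewrite (_ : (fun x => M (f x)) = fun x => M `|f x|); last first.
  by apply/funext => x; rewrite ger0_norm.
apply: (integrable_compact_supp cK KO).
  move=> x; apply: (@continuous_comp _ _ _ f (fun r => M `|r|)); first exact: cf.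
  exact: (continuous_N_function_norm NM).
by move=> x /fK ->; rewrite normr0 (N_function0 NM).
Qed.

Lemma Cc_smooth_pderiv_out u i x : Cc_smooth Omega u ->
  ~ closure [set x | u x != 0] x -> pderiv i u x = 0.
Proof.
move=> Cu; apply: pderiv_supp; first exact: closed_closure.
by move=> y; exact: Cc_smooth_out Cu.
Qed.

Lemma enorm_grad_out u x : Cc_smooth Omega u ->
  ~ closure [set x | u x != 0] x -> enorm (grad u x) = 0.
Proof.
move=> Cu Kx; apply/eqP; rewrite -sqrf_eq0 enorm_sqr_row big1// => j _.
by rewrite mxE Cc_smooth_pderiv_out// expr0n.
Qed.

Lemma enorm_hess_out u x : Cc_smooth Omega u ->
  ~ closure [set x | u x != 0] x -> enorm (hess u x) = 0.
Proof.
move=> Cu Kx; apply/eqP; rewrite -sqrf_eq0 enorm_sqr big1// => i _; rewrite big1// => j _.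
rewrite mxE (_ : pderiv i _ x = 0) ?expr0n//.
apply: (pderiv_supp (K := closure [set x | u x != 0])) Kx; first exact: closed_closure.
by move=> y; exact: Cc_smooth_pderiv_out.
Qed.

Lemma integrable_modular_grad u : Cc_smooth Omega u -> I (fun x => M (enorm (grad u x))).
Proof.
move=> Cu; have [su _ _] := Cu; apply: (integrable_modular Cu).
- exact: continuous_enorm_grad.
- by move=> x; exact: enorm_ge0.
- by move=> x; exact: enorm_grad_out.
Qed.

Lemma integrable_modular_hess u t : 0 <= t -> Cc_smooth Omega u ->
  I (fun x => M (t * enorm (hess u x))).
Proof.
move=> t0 Cu; have [su _ _] := Cu; apply: (integrable_modular Cu).
- apply: (continuous_mulr (f := fun=> t)); first by move=> x; exact: cst_continuous.
  exact: continuous_enorm_hess.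
- by move=> x; rewrite mulr_ge0// enorm_ge0.
- by move=> x Kx; rewrite enorm_hess_out// mulr0.
Qed.

Lemma integrable_modular_abs u t : 0 <= t -> Cc_smooth Omega u ->
  I (fun x => M (`|u x| / t)).
Proof.
move=> t0 Cu; have [su _ _] := Cu; apply: (integrable_modular Cu).
- apply: (continuous_mulr (g := fun=> t^-1)); last by move=> x; exact: cst_continuous.
  move=> x; apply: (@continuous_comp _ _ _ u (fun r => `|r|)).
    exact: smooth_continuous.
  exact: norm_continuous.
- by move=> x; rewrite divr_ge0.
- by move=> x Kx; rewrite (Cc_smooth_out Cu Kx) normr0 mul0r.
Qed.

Lemma measurable_modular (f : 'rV[R]_n -> R) : measurable_fun Omega f ->
  (forall x, 0 <= f x) -> measurable_fun Omega (fun x => M (f x)).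
Proof.
move=> mf f0; rewrite (_ : (fun x => M (f x)) = (fun r => M `|r|) \o f).
  apply: measurableT_comp mf; apply: continuous_measurable_fun.
  exact: (continuous_N_function_norm NM).
by apply/funext => x /=; rewrite ger0_norm.
Qed.

Variables K1 K2 : R.
Hypothesis hardy : forall u, Cc_smooth Omega u ->
  (\int[mu]_(x in Omega) (M (enorm (dphi x) * `|u x|))%:E
     <= K1%:E * \int[mu]_(x in Omega) (M (enorm (grad u x)))%:E
      + K2%:E * \int[mu]_(x in Omega) (M `|u x|)%:E)%E.

(** The right side of the assumed inequality is finite by compactness of the support, which makes
    the left side integrable although [dphi] is merely measurable. The constants may be negative;
    their absolute values allow monotone estimates later. *)
Lemma hardy_integrable u : Cc_smooth Omega u ->
  I (fun x => M (enorm (dphi x) * `|u x|)) /\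
  J (fun x => M (enorm (dphi x) * `|u x|)) <=
    `|K1| * J (fun x => M (enorm (grad u x))) + `|K2| * J (fun x => M `|u x|).
Proof.
move=> Cu; have [su _ _] := Cu.
have Ig := integrable_modular_grad Cu.
have Iu : I (fun x => M `|u x|).
  have := integrable_modular_abs ler01 Cu.
  by under eq_fun do rewrite divr1.
have J0 (f : 'rV[R]_n -> R) : (forall x, 0 <= f x) -> 0 <= J (fun x => M (f x)).
  by move=> f0; apply: Rintegral_ge0 => x _; exact: N_function_ge0.
have bound : (\int[mu]_(x in Omega) (M (enorm (dphi x) * `|u x|))%:E <=
  (`|K1| * J (fun x => M (enorm (grad u x))) + `|K2| * J (fun x => M `|u x|))%:E)%E.
  apply: (le_trans (hardy Cu)).
  have fi (f : 'rV[R]_n -> R) : I f ->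
      (\int[mu]_(x in Omega) (f x)%:E = (J f)%:E)%E.
    by move=> If; rewrite /Rintegral fineK//; exact: integrable_fin_num.
  rewrite (fi _ Ig) (fi _ Iu) -!EFinM -EFinD lee_fin lerD//; apply: ler_wpM2r.
  - by apply: J0 => x; exact: enorm_ge0.
  - exact: ler_norm.
  - by apply: J0.
  - exact: ler_norm.
have Id : I (fun x => M (enorm (dphi x) * `|u x|)).
  apply/integrableP; split.
    apply/measurable_EFinP.
    apply: (measurable_modular (f := fun x => enorm (dphi x) * `|u x|)).
      apply: measurable_funM; first exact: (measurable_enorm_dphi Wphi).
      have mu' := measurable_funTS (D := Omega) (continuous_measurable_rV (smooth_continuous su)).
      exact: (measurableT_comp (@normr_measurable R setT) mu').
    by move=> x; rewrite mulr_ge0// enorm_ge0.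
  under eq_integral => x _.
    rewrite /= ger0_norm; last by rewrite N_function_ge0// mulr_ge0// enorm_ge0.
    over.
  by apply: le_lt_trans bound _; rewrite ltry.
split => //; rewrite -lee_fin {1}/Rintegral fineK//; exact: integrable_fin_num.
Qed.

Lemma gradient_modular_le : exists C1 C2 : R, [/\ 0 < C1, 0 < C2 &
  forall (theta : R) u, 0 < theta <= 1 -> Cc_smooth Omega u ->
  J (fun x => M (enorm (grad u x))) <=
    C1 * J (fun x => M (theta * enorm (hess u x))) + C2 * J (fun x => M (`|u x| / theta))].
Proof.
have c0 : 0 < c by exact: lt_le_trans c1.
pose A : R := (c + 2) * n%:R + 1.
have A0 : 0 <= A by rewrite addr_ge0// mulr_ge0// addr_ge0// ltW.
(* Chosen so that [n * (2 * eta * c)] is at most 1/4; [n.+1] avoids dividing by 0 in dimension 0. *)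
pose eta : R := (8 * (n.+1%:R * c))^-1.
have eta0 : 0 < eta by rewrite invr_gt0 !mulr_gt0// ltr0n.
have [Ce Ce0 young] := N_function_young NM MD Mmono c1 eta0.
have [CA CA0 HCA] := N_function_mult NM MD Mmono c1 A0.
pose kap : R := c ^+ size (index_enum 'I_n).
have kap0 : 0 <= kap by rewrite exprn_ge0// ltW.
(* [q * delta ^+ 2] will be the coefficient of the gradient modular coming from [K2]; [delta] brings
   it below 1/4. [Cd] depends on [delta] but does not enter [q], so the choice is not circular. *)
pose q : R := n%:R * (Ce / 2) * kap * (n%:R * `|K2|).
have q0 : 0 <= q by rewrite !mulr_ge0// divr_ge0.
pose delta : R := (4 * (q + 1))^-1.
have q1 : 0 < q + 1 by rewrite ltr_wpDl.
have delta0 : 0 < delta by rewrite invr_gt0 mulr_gt0.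
have deltaq : q * delta <= 4^-1.
  by rewrite /delta invfM mulrCA ler_piMr// ler_pdivrMr// mul1r lerDl.
have delta1 : delta <= 1.
  rewrite /delta invf_le1 ?mulr_gt0//; lra.
have di0 : 0 <= delta^-1 by rewrite invr_ge0 ltW.
have [Cd Cd0 HCd] := N_function_mult NM MD Mmono c1 di0.
pose D1 : R := n%:R * (Ce / 2) * (1 + kap * (n%:R * `|K1|)).
pose D2 : R := n%:R * (Ce / 2) * (CA + Cd).
have D10 : 0 <= D1.
  by rewrite mulr_ge0 ?mulr_ge0 ?divr_ge0// addr_ge0// !mulr_ge0.
have D20 : 0 <= D2 by rewrite mulr_ge0 ?mulr_ge0 ?divr_ge0// addr_ge0.
(* Absorbing half of the gradient modular doubles the constants; adding 1 makes them positive. *)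
exists (2 * D1 + 1), (2 * D2 + 1); split; [lra|lra|].
move=> theta u /andP[th0 th1] Cu; have [su cK KO] := Cu; set K := closure _ in cK KO.
have Ig := integrable_modular_grad Cu.
have Ih := integrable_modular_hess (ltW th0) Cu.
have Iu := integrable_modular_abs (ltW th0) Cu.
set X := J (fun x => M (enorm (grad u x))).
set H := J (fun x => M (theta * enorm (hess u x))).
set N := J (fun x => M (`|u x| / theta)).
have J0 (f : 'rV[R]_n -> R) : (forall x, 0 <= f x) -> 0 <= J f.
  by move=> f0; apply: Rintegral_ge0.
have X0 : 0 <= X by apply: J0 => x; rewrite N_function_ge0// enorm_ge0.
have H0 : 0 <= H.
  by apply: J0 => x; rewrite N_function_ge0// mulr_ge0 ?enorm_ge0// ltW.
have N0 : 0 <= N by apply: J0 => x; rewrite N_function_ge0// divr_ge0// ltW.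
have dt0 : 0 <= delta * theta by rewrite mulr_ge0// ltW.
have dt1 : delta * theta <= delta by rewrite ler_piMr// ltW.
(* Since [delta <= 1], the gradient of [w i] is at most [theta * enorm (hess u)]. Since
   [theta <= 1], [w i] itself is at most [delta] times the gradient of [u], so that its modular
   gains [delta ^+ 2]. *)
pose w (i : 'I_n) := fun x => delta * theta * pderiv i u x.
have Cw i : Cc_smooth Omega (w i) by apply: Cc_smooth_scale; exact: Cc_smooth_pderiv.
have wE i x : `|w i x| = delta * theta * `|pderiv i u x|.
  by rewrite normrM ger0_norm.
pose f5 i := fun x => M (enorm (dphi x) * `|w i x|).
have If5 i : I (f5 i) by have [] := hardy_integrable (Cw i).
have Jf5 i : J (f5 i) <= `|K1| * H + `|K2| * (delta ^+ 2 * X).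
  have [_ le5] := hardy_integrable (Cw i); apply: (le_trans le5).
  have [swi _ _] := Cw i; have sdi := smooth_pderiv i su.
  apply: lerD; apply: ler_wpM2l => //.
    apply: le_Rintegral => //; first exact: (integrable_modular_grad (Cw i)).
    move=> x _; apply: (N_function_le NM Mmono); first exact: enorm_ge0.
    rewrite (grad_scale _ _ sdi) enormZ ger0_norm//.
    apply: ler_pM => //; [exact: enorm_ge0|by rewrite ler_piMl// ltW|].
    exact: enorm_grad_pderiv_le.
  have Iwi : I (fun x => M `|w i x|).
    by have := integrable_modular_abs ler01 (Cw i); under eq_fun do rewrite divr1.
  have -> : delta ^+ 2 * X = J (fun x => delta ^+ 2 * M (enorm (grad u x))).
    by rewrite RintegralZl.
  apply: le_Rintegral => //; first exact: (integrableZl _ _ Ig).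
  move=> x _; apply: (@le_trans _ _ (delta ^+ 2 * M `|pderiv i u x|)).
    apply: (@le_trans _ _ (M (delta * `|pderiv i u x|))).
      by apply: (N_function_le NM Mmono) => //; rewrite wE ler_wpM2r.
    by apply: (N_function_scale NM Mmono) => //; rewrite delta1 ltW.
  apply: ler_wpM2l; first exact: sqr_ge0.
  apply: (N_function_le NM Mmono) => //.
  by have := coord_le_enorm (grad u x) ord0 i; rewrite mxE.
(* The measure of the support, finite because [mu] is Radon; it carries the regularization error
   [M eps * m]. *)
pose m := J (\1_K : 'rV[R]_n -> R).
have m0 : 0 <= m by apply: J0.
have IK : I (\1_K : 'rV[R]_n -> R).
  apply: (@integrableS _ _ _ mu setT Omega) => //.
  apply: (@integrable_bounded_supp _ _ _ mu K _ 1) => //.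
  - exact: compact_measurable_rV.
  - exact: radon.1 K cK KO.
  - by apply: measurable_indic; exact: compact_measurable_rV.
  - by move=> x; rewrite indicE; case: (_ \in _); rewrite ?normr1 ?normr0.
  - by move=> x Kx; rewrite indicE memNset.
have IZ (k : R) (f : 'rV[R]_n -> R) : I f -> I (fun x => k * f x).
  by move=> If; exact: (integrableZl _ _ If).
have ID (f g : 'rV[R]_n -> R) : I f -> I g -> I (fun x => f x + g x).
  by move=> If If'; exact: (integrableD _ If If').
have JZ (k : R) (f : 'rV[R]_n -> R) : I f -> J (fun x => k * f x) = k * J f.
  by move=> If; rewrite RintegralZl.
have JD (f g : 'rV[R]_n -> R) : I f -> I g -> J (fun x => f x + g x) = J f + J g.
  by move=> If If'; rewrite RintegralD.
have step eps : 0 < eps -> X <= n%:R * (2 * eta * c * (X + M eps * m) +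
    Ce / 2 * ((CA + Cd) * N + H + kap * \sum_i J (f5 i))).
  move=> eps0.
  pose F1 x := M (enorm (grad u x)) + M eps * (\1_K x : R).
  pose F2 x := (CA + Cd) * M (`|u x| / theta) + M (theta * enorm (hess u x)) +
    kap * \sum_i f5 i x.
  pose F x := n%:R * (2 * eta * c * F1 x + Ce / 2 * F2 x).
  have IF1 : I F1 by apply: (ID _ _ Ig); exact: IZ.
  have I5 : I (fun x => \sum_i f5 i x) by exact: integrable_sumr.
  have IF2' : I (fun x => (CA + Cd) * M (`|u x| / theta) + M (theta * enorm (hess u x))).
    by apply: (ID _ _ _ Ih); exact: IZ.
  have IF2 : I F2 by apply: (ID _ _ IF2'); exact: IZ.
  have IF3 : I (fun x => 2 * eta * c * F1 x + Ce / 2 * F2 x) by apply: (ID); exact: IZ.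
  have IF : I F by exact: IZ.
  have -> : n%:R * (2 * eta * c * (X + M eps * m) +
    Ce / 2 * ((CA + Cd) * N + H + kap * \sum_i J (f5 i))) = J F.
    rewrite /F JZ// JD; [|exact: IZ|exact: IZ].
    rewrite JZ// JZ// /F1 JD//; last exact: IZ.
    rewrite JZ// /F2 JD//; last exact: IZ.
    rewrite JD//; last exact: IZ.
    by rewrite JZ// JZ// Rintegral_sumr.
  have fi (f : 'rV[R]_n -> R) : I f -> (\int[mu]_(x in Omega) (f x)%:E = (J f)%:E)%E.
    by move=> If; rewrite /Rintegral fineK//; exact: integrable_fin_num.
  rewrite -lee_fin -(fi _ Ig) -(fi _ IF).
  have T0 x : 0 < grad_sqr_reg u eps x by exact: grad_sqr_reg_gt0.
  have G0 x : 0 <= sqrt_quot M (grad_sqr_reg u eps x).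
    by apply: (sqrt_quot_ge0 NM); exact/ltW.
  have cT : continuous (sqrt_quot M \o grad_sqr_reg u eps) :=
    Ck_continuous (C1_reg_weight CM su eps0).
  have cg := continuous_enorm_grad su; have ch := continuous_enorm_hess su.
  have mg := measurable_funTS (D := Omega) (continuous_measurable_rV cg).
  have mh := measurable_funTS (D := Omega) (continuous_measurable_rV ch).
  have mT := measurable_funTS (D := Omega) (continuous_measurable_rV cT).
  have mu' := measurable_funTS (D := Omega) (continuous_measurable_rV (smooth_continuous su)).
  have md := measurable_enorm_dphi Wphi.
  apply: (@le_trans _ _ (\int[mu]_(x in Omega)
      (sqrt_quot M (grad_sqr_reg u eps x) * enorm (grad u x) ^+ 2)%:E)%E).
    apply: ge0_le_integral => //.
    - by move=> x _; rewrite lee_fin N_function_ge0// enorm_ge0.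
    - exact: measurable_int Ig.
    - by apply/measurable_EFinP; apply: measurable_funM => //; exact: measurable_funX.
    - move=> x _; rewrite lee_fin.
      by apply: (N_function_le_sqrt_quot NM Mmono); [exact: enorm_ge0|exact: grad_sqr_le_reg].
  apply: (le_trans (regularized_gradient_le oO Wphi dens NM CM MD Mmono c1 Cu eps0)).
  have r0 x : 0 <= n%:R * (sqrt_quot M (grad_sqr_reg u eps x) * `|u x| *
      (((c + 2) * n%:R + 1) * enorm (hess u x) + enorm (grad u x) * enorm (dphi x))).
    rewrite mulr_ge0//; apply: mulr_ge0; first exact: mulr_ge0.
    by apply: addr_ge0; apply: mulr_ge0 => //; exact: enorm_ge0.
  apply: ge0_le_integral => //.
  - by move=> x _; rewrite lee_fin.
  - apply/measurable_EFinP; apply: measurable_funM => //.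
    apply: measurable_funM; first apply: measurable_funM => //.
      exact: (measurableT_comp (@normr_measurable R setT) mu').
    by apply: measurable_funD; apply: measurable_funM.
  - exact: measurable_int IF.
  - move=> x _; rewrite lee_fin /F; apply: ler_wpM2l => //.
    have MN y : 0 <= y -> 0 <= M y := N_function_ge0 NM (x := y).
    have f50 i : 0 <= f5 i x by rewrite MN// mulr_ge0// enorm_ge0.
    have s50 : 0 <= \sum_i f5 i x by exact: sumr_ge0.
    have u0 : 0 <= `|u x| / theta by rewrite divr_ge0// ltW.
    have h0 : 0 <= theta * enorm (hess u x) by rewrite mulr_ge0 ?enorm_ge0// ltW.
    (* Off the support the left side vanishes with [u], so the constant [M eps] is charged on [K]
       only and not on [Omega], whose measure may be infinite. *)
    have [Kx|Kx] := pselect (K x); last first.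
      rewrite (Cc_smooth_out Cu Kx) normr0 mulr0 mul0r.
      have e20 : 0 <= 2 * eta * c by rewrite !mulr_ge0// ltW.
      have F10 : 0 <= F1 x.
        by rewrite /F1 indicE memNset// mulr0 addr0 MN// enorm_ge0.
      have F20 : 0 <= F2 x.
        rewrite /F2; apply: addr_ge0; last exact: mulr_ge0.
        by apply: addr_ge0; [apply: mulr_ge0; [exact: addr_ge0|exact: MN]|exact: MN].
      by rewrite addr_ge0// mulr_ge0// divr_ge0.
    have := sqrt_quot_young NM MD Mmono c1 A0 (ltW eta0) Ce0 young HCA HCd th0 delta0 eps0
      (enorm_ge0 (grad u x)) (normr_ge0 (u x)) (enorm_ge0 (hess u x)) (enorm_ge0 (dphi x)).
    move/le_trans; apply; rewrite /F1 indicE mem_set// mulr1 lerD2l.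
    apply: ler_wpM2l; first by rewrite divr_ge0.
    (* The assumed inequality applies to scalar functions, so the length of the gradient is bounded
       by the sum of its components and [M] of the sum is split at the cost of [kap]. *)
    rewrite lerD2l; apply: (@le_trans _ _ (M (\sum_i enorm (dphi x) * `|w i x|))).
      apply: (N_function_le NM Mmono).
        by rewrite mulr_ge0 ?enorm_ge0// mulr_ge0// enorm_ge0.
      rewrite -mulr_sumr; apply: ler_wpM2l; first exact: enorm_ge0.
      apply: (le_trans (ler_wpM2l dt0 (enorm_row_le_sum (grad u x)))).
      rewrite mulr_sumr; apply: ler_sum => i _; rewrite wE.
      by apply: ler_wpM2l => //; rewrite mxE.
    apply: (N_function_sum NM MD Mmono c1) => i.
    by rewrite mulr_ge0// enorm_ge0.
have sum5 : \sum_i J (f5 i) <= n%:R * (`|K1| * H + `|K2| * (delta ^+ 2 * X)).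
  apply: (le_trans (ler_sum _ (fun i _ => Jf5 i))).
  by rewrite sumr_const card_ord mulr_natl.
(* Two contributions of at most a quarter of [X] each are moved to the left; [X] is a real number,
   so this is allowed. *)
have step' eps : 0 < eps -> X <= 2 * D1 * H + 2 * D2 * N + M eps * m / 2.
  move=> eps0; have Me0 := mulr_ge0 (N_function_ge0 NM (ltW eps0)) m0.
  have a1 : n%:R * (2 * eta * c) <= 4^-1.
    have n1 : 0 < n.+1%:R :> R by rewrite ltr0n.
    have -> : n%:R * (2 * eta * c) = n%:R / n.+1%:R / 4.
      by rewrite /eta; field; rewrite !gt_eqF.
    by rewrite -[leRHS]mul1r ler_wpM2r ?invr_ge0// ler_pdivrMr// mul1r ler_nat.
  have a2 : q * delta ^+ 2 <= 4^-1.
    by rewrite expr2 mulrA (le_trans _ deltaq)// ler_piMr// mulr_ge0// ltW.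
  have b1 := ler_wpM2r (addr_ge0 X0 Me0) a1.
  have b2 := ler_wpM2r X0 a2.
  have k0 : 0 <= n%:R * (Ce / 2) * kap by rewrite !mulr_ge0// divr_ge0.
  have b3 := ler_wpM2l k0 sum5.
  have := step _ eps0; move: b1 b2 b3; rewrite /q /D1 /D2.
  set S := \sum_i _; move: (M eps * m) => Z.
  lra.
(* The constants do not depend on [eps], and [M eps] tends to [M 0 = 0]. *)
apply/ler_addgt0Pr => e e0.
have [eps eps0 He] : exists2 eps, 0 < eps & M eps * m / 2 <= e.
  have em : 0 < e / (m + 1) by rewrite divr_gt0// ltr_wpDl.
  have := N_function_cvg0 NM; rewrite (N_function0 NM) => /cvgr_lt /(_ _ em) near_e.
  have [eps [eps0 He]] : exists eps, 0 < eps /\ M eps < e / (m + 1).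
    exact: (@filter_ex _ (0 : R)^'+ _ _ (filterI (nbhs_right_gt 0) near_e)).
  exists eps => //; rewrite ltr_pdivlMr ?ltr_wpDl// in He.
  have := N_function_ge0 NM (ltW eps0) ; have := mulr_ge0 (N_function_ge0 NM (ltW eps0)) m0.
  lra.
have := step' _ eps0; lra.
Qed.

End gradient_modular.

(** * Luxemburg norms *)

Section luxemburg.
Context d (T : measurableType d) (R : realType) (mu : {measure set T -> \bar R}).
Variables (D : set T) (mD : measurable D) (M : R -> R).
Hypothesis NM : N_function M.
Hypothesis Mmono : {in `]0, +oo[ &, {homo (fun l : R => M l / l ^+ 2) : x y / x <= y}}.

Lemma luxemburg_le (f : T -> R) (k : R) :
  0 < k -> mu.-integrable D (EFin \o (fun x => M (`|f x| / k))) ->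
  \int[mu]_(x in D) M (`|f x| / k) <= 1 -> (luxemburg mu M D f <= k%:E)%E.
Proof.
move=> k0 If fk; apply: ereal_inf_lbound; exists k => //; split => //.
rewrite -(fineK (integrable_fin_num mD If)); by rewrite lee_fin.
Qed.

(** Finiteness: if [W] is the modular of [f], quadratic scaling bounds the modular of f / (W + 1) by
    W / (W + 1)^2 <= 1. The infimum is then approached by admissible constants, which spares showing
    that it is attained. *)
Lemma luxemburg_approx (f : T -> R) :
  (forall k, 0 < k -> mu.-integrable D (EFin \o (fun x => M (`|f x| / k)))) ->
  exists l, [/\ 0 <= l, luxemburg mu M D f = l%:E & forall e, 0 < e ->
    exists a, [/\ 0 < a, a < l + e & \int[mu]_(x in D) M (`|f x| / a) <= 1]].
Proof.
move=> If; set L := luxemburg mu M D f.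
have L0 : (0 <= L)%E.
  by apply: le_ereal_inf_tmp => _ [k [k0 _] <-]; rewrite lee_fin ltW.
pose W := \int[mu]_(x in D) M (`|f x| / 1).
have W0 : 0 <= W by apply: Rintegral_ge0 => x _; rewrite (N_function_ge0 NM)// divr_ge0.
have k1 : 1 <= W + 1 by rewrite lerDr.
have k0 : 0 < W + 1 by exact: lt_le_trans k1.
have kW : \int[mu]_(x in D) M (`|f x| / (W + 1)) <= 1.
  apply: (@le_trans _ _ (\int[mu]_(x in D) ((W + 1)^-1 ^+ 2 * M (`|f x| / 1)))).
    apply: le_Rintegral => //; first exact: If.
      by apply: (integrableZl mD _ (If 1 _)).
    move=> x _; rewrite divr1 mulrC; apply: (N_function_scale NM Mmono) => //.
    by rewrite invr_ge0 ltW// invf_le1.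
  rewrite RintegralZl//; last exact: If.
  rewrite -/W expr2 -mulrA ler_pdivrMl// mulr1 ler_pdivrMl//.
  by rewrite (@le_trans _ _ (W + 1))// ?lerDl// ler_peMl// ltW.
have LW : (L <= (W + 1)%:E)%E by apply: luxemburg_le kW => //; exact: If.
have Lfin : L \is a fin_num by rewrite ge0_fin_numE//; apply: le_lt_trans LW _; rewrite ltry.
exists (fine L); split; [exact: fine_ge0|by rewrite fineK|] => e e0.
have [_ [a [a0 fa] <-]] := lb_ereal_inf_adherent e0 Lfin.
rewrite -/(luxemburg mu M D f) -/L -(fineK Lfin) -EFinD lte_fin => aL.
exists a; split => //; rewrite -lee_fin /Rintegral fineK//.
by apply: integrable_fin_num => //; exact: If.
Qed.

End luxemburg.

Section luxemburg_gradient.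
Context {R : realType} {n : nat}.
Variables (Omega : set 'rV[R]_n) (mu : {measure set 'rV[R]_n -> \bar R}).
Hypotheses (oO : open Omega) (radon : radon_on Omega mu).
Variable M : R -> R.
Hypothesis NM : N_function M.
Hypothesis Mmono : {in `]0, +oo[ &, {homo (fun l : R => M l / l ^+ 2) : x y / x <= y}}.
Variables C1 C2 : R.
Hypotheses (C10 : 0 < C1) (C20 : 0 < C2).
Local Notation J f := (\int[mu]_(x in Omega) f x).
Hypothesis grad_le : forall (theta : R) u, 0 < theta <= 1 -> Cc_smooth Omega u ->
  J (fun x => M (enorm (grad u x))) <=
    C1 * J (fun x => M (theta * enorm (hess u x))) + C2 * J (fun x => M (`|u x| / theta)).

Let mO : measurable Omega := open_measurable_rV oO.

Lemma integrable_modular_grad_div u k : 0 < k -> Cc_smooth Omega u ->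
  mu.-integrable Omega (EFin \o (fun x => M (`|enorm (grad u x)| / k))).
Proof.
move=> k0 Cu; have [su _ _] := Cu.
have := integrable_modular_grad oO radon NM (Cc_smooth_scale k^-1 Cu).
congr (_.-integrable _ (EFin \o _)); apply/funext => x.
by rewrite (grad_scale _ _ su) enormZ ger0_norm ?invr_ge0 ?(ltW k0)// ger0_norm ?enorm_ge0// mulrC.
Qed.

Lemma integrable_modular_hess_div u k : 0 < k -> Cc_smooth Omega u ->
  mu.-integrable Omega (EFin \o (fun x => M (`|enorm (hess u x)| / k))).
Proof.
move=> k0 Cu; have k0' : 0 <= k^-1 by rewrite invr_ge0 ltW.
have := integrable_modular_hess oO radon NM k0' Cu.
congr (_.-integrable _ (EFin \o _)); apply/funext => x.
by rewrite ger0_norm ?enorm_ge0// mulrC.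
Qed.

(** [a] and [b] are admissible constants rather than the norms themselves, which may be 0 and could
    not serve as divisors. For suitable [k] the modular of |grad u| / k is at most C1 + C2; dividing
    further by C = C1 + C2 + 1 >= 1 brings it below 1. *)
Lemma luxemburg_grad_le u a b : Cc_smooth Omega u -> 0 < a -> 0 < b ->
  J (fun x => M (`|u x| / a)) <= 1 -> J (fun x => M (`|enorm (hess u x)| / b)) <= 1 ->
  (luxemburg mu M Omega (fun x => enorm (grad u x)) <=
    ((C1 + C2 + 1) * (Num.sqrt (b * a) + a))%:E)%E.
Proof.
move=> Cu a0 b0 Ja Jb; have [su _ _] := Cu.
pose C := C1 + C2 + 1.
have C1' : 1 <= C by rewrite lerDr addr_ge0// ltW.
have C0 : 0 < C by exact: lt_le_trans C1'.
have sa0 : 0 < Num.sqrt a by rewrite sqrtr_gt0.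
have sb0 : 0 < Num.sqrt b by rewrite sqrtr_gt0.
have aE : Num.sqrt a * Num.sqrt a = a by rewrite -expr2 sqr_sqrtr// ltW.
have bE : Num.sqrt b * Num.sqrt b = b by rewrite -expr2 sqr_sqrtr// ltW.
(* theta balances theta b against a / theta, unless this would exceed 1 *)
have [theta [k [theta01 k0 bk ak kle]]] : exists theta k : R, [/\ 0 < theta <= 1, 0 < k,
    theta * b <= k, a / theta <= k & k <= Num.sqrt (b * a) + a].
  have [ab|/ltW ba] := leP a b; last first.
    exists 1, a; rewrite ltr01 lexx mul1r divr1; split => //.
    by rewrite lerDr sqrtr_ge0.
  exists (Num.sqrt a / Num.sqrt b), (Num.sqrt a * Num.sqrt b); split.
  - by rewrite divr_gt0//= ler_pdivrMr// mul1r ler_wsqrtr.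
  - by rewrite mulr_gt0.
  - by rewrite -{2}bE mulrA mulfVK ?gt_eqF.
  - rewrite ler_pdivrMr ?divr_gt0// -{1}aE mulrACA.
    by rewrite divff ?gt_eqF// mulr1.
  - by rewrite mulrC -sqrtrM ?(ltW b0)// lerDl ltW.
have /andP[th0 th1] := theta01.
have Ck0 : 0 < C * k by rewrite mulr_gt0.
have Igk := integrable_modular_grad_div k0 Cu.
(* The modular inequality for [k^-1 * u]: the choices of [theta] and [k] give theta / k <= 1 / b and
   1 / (theta k) <= 1 / a, so both terms are dominated by modulars that are at most 1. *)
have Jk : J (fun x => M (`|enorm (grad u x)| / k)) <= C1 + C2.
  have Cv := Cc_smooth_scale k^-1 Cu.
  have ki : 0 <= k^-1 by rewrite invr_ge0 ltW.
  have -> : (fun x => M (`|enorm (grad u x)| / k)) =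
      (fun x => M (enorm (grad (fun x => k^-1 * u x) x))).
    apply/funext => x.
    by rewrite (grad_scale _ _ su) enormZ ger0_norm ?enorm_ge0// ger0_norm// mulrC.
  apply: (le_trans (grad_le theta01 Cv)); rewrite lerD//.
    rewrite ler_piMr ?(ltW C10)//; apply: le_trans Jb; apply: le_Rintegral => //.
    - exact: (integrable_modular_hess oO radon NM (ltW th0) Cv).
    - exact: integrable_modular_hess_div.
    move=> x _; rewrite (hess_scale _ _ su) enormZ (ger0_norm ki) (ger0_norm (enorm_ge0 _)).
    apply: (N_function_le NM Mmono); first by rewrite !mulr_ge0 ?enorm_ge0// ltW.
    rewrite mulrA mulrC ler_wpM2l ?enorm_ge0//.
    by rewrite ler_pdivrMr// mulrC ler_pdivlMr.
  rewrite ler_piMr ?(ltW C20)//; apply: le_trans Ja; apply: le_Rintegral => //.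
  - exact: (integrable_modular_abs oO radon NM (ltW th0) Cv).
  - exact: (integrable_modular_abs oO radon NM (ltW a0) Cu).
  move=> x _; rewrite normrM (ger0_norm ki).
  apply: (N_function_le NM Mmono); first by rewrite !mulr_ge0// invr_ge0 ltW.
  rewrite [_ * `|u x|]mulrC -mulrA ler_wpM2l//.
  by rewrite -invfM lef_pV2 ?posrE ?mulr_gt0// -ler_pdivrMr.
apply: (@le_trans _ _ (C * k)%:E); last by rewrite lee_fin ler_wpM2l// ltW.
have IC := integrable_modular_grad_div Ck0 Cu.
apply: (luxemburg_le mO Ck0 IC).
apply: (@le_trans _ _ (J (fun x => C^-1 * M (`|enorm (grad u x)| / k)))).
  apply: le_Rintegral => //; first exact: (integrableZl _ _ Igk).
  move=> x _; rewrite invfM mulrCA.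
  have y0 : 0 <= `|enorm (grad u x)| / k by rewrite divr_ge0// ltW.
  apply: (@le_trans _ _ (C^-1 ^+ 2 * M (`|enorm (grad u x)| / k))).
    by apply: (N_function_scale NM Mmono) => //; rewrite invr_ge0 ltW//= invf_le1.
  apply: ler_wpM2r; first exact: (N_function_ge0 NM).
  by rewrite expr2 ler_piMr ?invr_ge0 ?(ltW C0)// invf_le1.
rewrite RintegralZl// ler_pdivrMl// mulr1 (le_trans Jk)//.
by rewrite /C lerDl.
Qed.

(** The bound is applied to admissible constants within [e] of the two norms, and [e] tends to 0;
    continuity of the square root at 0 covers norms that vanish. *)
Lemma luxemburg_grad_interpolation u : Cc_smooth Omega u ->
  (luxemburg mu M Omega (fun x => enorm (grad u x)) <=
   (C1 + C2 + 1)%:E * (luxemburg mu M Omega (fun x => enorm (hess u x))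
     * luxemburg mu M Omega u) `^ (2^-1)%R + (C1 + C2 + 1)%:E * luxemburg mu M Omega u)%E.
Proof.
move=> Cu.
have [l [l0 -> lP]] := luxemburg_approx mO NM Mmono (fun k k0 =>
  integrable_modular_abs oO radon NM (ltW k0) Cu).
have [h [h0 -> hP]] := luxemburg_approx mO NM Mmono (fun k k0 =>
  integrable_modular_hess_div k0 Cu).
have [g [g0 gE _]] := luxemburg_approx mO NM Mmono (fun k k0 =>
  integrable_modular_grad_div k0 Cu).
rewrite gE -[(h%:E * l%:E)%E]EFinM poweR_EFin powR12_sqrt ?mulr_ge0// -!EFinM -EFinD lee_fin -mulrDr.
set C := C1 + C2 + 1.
have C0 : 0 <= C by rewrite !addr_ge0// ltW.
pose F e := C * (Num.sqrt ((h + e) * (l + e)) + (l + e)).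
have gF e : 0 < e -> g <= F e.
  move=> e0; have [a [a0 al Ja]] := lP e e0; have [b [b0 bh Jb]] := hP e e0.
  have := luxemburg_grad_le Cu a0 b0 Ja Jb; rewrite gE lee_fin => /le_trans; apply.
  apply: ler_wpM2l => //; apply: lerD; last exact: ltW.
  by rewrite ler_wsqrtr// ler_pM// ltW.
have addc (z : R) : z + e @[e --> 0^'+] --> z.
  rewrite -[X in _ --> X]addr0; apply: cvgD; first exact: cvg_cst.
  exact/cvg_at_right_filter/cvg_id.
have cF : F e @[e --> 0^'+] --> C * (Num.sqrt (h * l) + l).
  apply: cvgM; first exact: cvg_cst.
  apply: cvgD; last exact: addc.
  apply: (@continuous_cvg _ _ _ _ _ _ Num.sqrt); first exact: sqrt_continuous.
  by apply: cvgM; exact: addc.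
rewrite -(cvg_lim _ cF)//; apply: limr_ge; first by apply/cvg_ex; exists (C * (Num.sqrt (h * l) + l)).
by near=> e; apply: gF; near: e; exact: nbhs_right_gt.
Unshelve. all: by end_near.
Qed.

End luxemburg_gradient.

Theorem theorem3p3 (R : realType) (n : nat) (Omega : set 'rV[R]_n)
    (M : R -> R) (mu : {measure set 'rV[R]_n -> \bar R})
    (phi : 'rV[R]_n -> R) (dphi : 'rV[R]_n -> 'rV[R]_n) (K1 K2 : R) :
  open Omega ->
  N_function M -> C1_pos M -> Delta2 M ->
  bounded_near (fun l : R => derive1 M l / l) 0^'+ ->
  W1infty_loc Omega phi dphi ->
  density_on Omega mu (fun x => expR (- phi x)) ->
  radon_on Omega mu ->
  {in `]0, +oo[ &, {homo (fun l : R => M l / l ^+ 2) : x y / x <= y}} ->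
  (forall u, Cc_smooth Omega u ->
    (\int[mu]_(x in Omega) (M (enorm (dphi x) * `|u x|))%:E
     <= K1%:E * \int[mu]_(x in Omega) (M (enorm (grad u x)))%:E
      + K2%:E * \int[mu]_(x in Omega) (M `|u x|)%:E)%E) ->
  (exists C1 C2 : R, [/\ 0 < C1, 0 < C2 &
    forall (theta : R) u, 0 < theta <= 1 -> Cc_smooth Omega u ->
    (\int[mu]_(x in Omega) (M (enorm (grad u x)))%:E
     <= C1%:E * \int[mu]_(x in Omega) (M (theta * enorm (hess u x)))%:E
      + C2%:E * \int[mu]_(x in Omega) (M (`|u x| / theta))%:E)%E])
  /\
  (exists C1 C2 : R, [/\ 0 < C1, 0 < C2 &
    forall u, Cc_smooth Omega u ->
    (luxemburg mu M Omega (fun x => enorm (grad u x))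
     <= C1%:E * (luxemburg mu M Omega (fun x => enorm (hess u x))
                 * luxemburg mu M Omega u) `^ (2^-1)%R
      + C2%:E * luxemburg mu M Omega u)%E]).
Proof.
move=> oO NM CM [c c0 MD] _ Wphi dens radon Mmono hardy.
have mO := open_measurable_rV oO.
(* The doubling constant is raised to at least 1, so that its powers can only enlarge the
   estimates. *)
have MD' x : 0 < x -> M (2 * x) <= Num.max c 1 * M x.
  move=> x0; apply: (le_trans (MD x x0)); apply: ler_wpM2r; last by rewrite le_max lexx.
  exact: (N_function_ge0 NM (ltW x0)).
have c1 : 1 <= Num.max c 1 by rewrite le_max lexx orbT.
have [C1 [C2 [C10 C20 grad_le]]] :=
  gradient_modular_le oO Wphi dens radon NM CM MD' Mmono c1 hardy.
split; last first.
  exists (C1 + C2 + 1), (C1 + C2 + 1); split; [by rewrite !addr_gt0..|] => u.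
  exact: (luxemburg_grad_interpolation oO radon NM Mmono C10 C20 grad_le).
exists C1, C2; split => // theta u th01 Cu; have /andP[th0 _] := th01.
(* All three modulars are finite, so the inequality between real integrals is also one between
   extended integrals. *)
have fi (f : 'rV[R]_n -> R) : mu.-integrable Omega (EFin \o f) ->
    (\int[mu]_(x in Omega) (f x)%:E = (\int[mu]_(x in Omega) f x)%:E)%E.
  by move=> If; rewrite /Rintegral fineK//; exact: integrable_fin_num.
rewrite (fi _ (integrable_modular_grad oO radon NM Cu)).
rewrite (fi _ (integrable_modular_hess oO radon NM (ltW th0) Cu)).
rewrite (fi _ (integrable_modular_abs oO radon NM (ltW th0) Cu)).
by rewrite -!EFinM -EFinD lee_fin; exact: grad_le.
Qed.
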